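(* Let $R$ be a complete equicharacteristic noetherian local domain with algebraically closed residue field $k$ and let $\nu$ be a rational valuation on $R$. Assume that the associated graded ring $\mathrm{gr}_\nu R$ is finitely generated as a $k$-algebra and let $(\xi_i)_{1\le i\le N}$ be elements of the maximal ideal of $R$ whose initial forms generate $\mathrm{gr}_\nu R$. Denote by $X$ the formal subspace of $\mathbf{A}^N(k)$ corresponding to the surjection $k[[u_1,\dots,u_N]]\to R$ determined by $u_i\mapsto\xi_i$. Then there exist regular fans $\Sigma$ with support $\mathbf{R}^N_{\ge0}$ such that the strict transform $X'$ of $X$ by the birational toric map $Z(\Sigma)\to\mathbf{A}^N(k)$ is nonsingular and transversal to the toric boundary at the point picked by $\nu$.
   Context: A valuation $\nu$ of $(R,m)$ whose valuation ring $(R_\nu,m_\nu)$ dominates $R$ is rational if $R/m=R_\nu/m_\nu$. With $\Phi$ its value group, $\mathrm{gr}_\nu R=\bigoplus_{\phi\in\Phi_{\ge0}}\{x\in R:\nu(x)\ge\phi\}/\{x\in R:\nu(x)>\phi\}$; the initial form of a nonzero $x\in R$ is its class in degree $\nu(x)$. A field of representatives $k\subset R$ is fixed, so that $R$ and $\mathrm{gr}_\nu R$ are $k$-algebras; the continuous $k$-algebra map $k[[u_1,\dots,u_N]]\to R$, $u_i\mapsto\xi_i$, is then surjective. For a regular fan $\Sigma$ with support $\mathbf{R}^N_{\ge0}$, $Z(\Sigma)$ is the corresponding nonsingular toric variety over $k$ and $Z(\Sigma)\to\mathbf{A}^N(k)$ the corresponding proper birational toric map; on the chart of an $N$-dimensional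 cone $\langle a^1,\dots,a^N\rangle$ it is $u_i\mapsto y_1^{a^1_i}\cdots y_N^{a^N_i}$. The toric boundary is the complement of the torus in $Z(\Sigma)$. The strict transform $X'$ of $X$ is the closure in $Z(\Sigma)\times_{\mathbf{A}^N(k)}\mathrm{Spec}\,k[[u_1,\dots,u_N]]$ of the part of the inverse image of $X$ lying over $u_1\cdots u_N\ne0$. The point picked by $\nu$ is the center of $\nu$ on $X'$. Transversality to the toric boundary at a point means that the local equations of the components of the toric boundary through that point restrict on $X'$ to part of a regular system of parameters. *)

(* Defs.v *)
From HB Require Import structures.
From mathcomp Require Import all_boot all_order all_algebra.
From mathcomp Require Import boolp classical_sets reals.
From mathcomp Require monalg.
From mathcomp Require Import mpoly ring.

Set Implicit Arguments.
Unset Strict Implicit.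
Unset Printing Implicit Defensive.

Import Order.TTheory GRing.Theory Num.Theory.

Local Open Scope classical_set_scope.
Local Open Scope ring_scope.
Local Open Scope quotient_scope.

Section CommutativeAlgebra.
Variable A : comNzRingType.
Implicit Types (I J S : set A) (x y : A).

(* Unlike MathComp's [idealr_closed], the unit ideal is allowed. *)
Definition is_ideal I : Prop :=
  [/\ I 0, forall x y, I x -> I y -> I (x + y) & forall a x, I x -> I (a * x)].

Definition is_prime_ideal I : Prop :=
  [/\ is_ideal I, ~ I 1 & forall x y, I (x * y) -> I x \/ I y].

Definition ideal_gen S : set A :=
  [set x | exists n (a s : 'I_n -> A),
             (forall i, S (s i)) /\ x = \sum_i a i * s i].

Definition ideal_mul I J : set A :=
  ideal_gen [set x | exists a b, [/\ I a, J b & x = a * b]].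

Definition ideal_exp I (n : nat) : set A := iter n (ideal_mul I) setT.

Definition invertible x : Prop := exists y, x * y = 1.

Definition nonunits : set A := [set x | ~ invertible x].

(* When this holds, [nonunits] is the unique maximal ideal. *)
Definition is_local : Prop := is_ideal nonunits.

Definition is_noetherian : Prop :=
  forall I, is_ideal I -> exists s : seq A, I = ideal_gen [set` s].

Definition is_adically_complete I : Prop :=
  (forall x, (forall n, ideal_exp I n x) -> x = 0) /\
  (forall u : nat -> A,
     (forall n, exists M, forall i j,
        (M <= i)%N -> (M <= j)%N -> ideal_exp I n (u i - u j)) ->
     exists l, forall n, exists M, forall i,
        (M <= i)%N -> ideal_exp I n (u i - l)).

Definition prime_chain (d : nat) : Prop :=
  exists q : 'I_d.+1 -> set A,
    (forall i, is_prime_ideal (q i)) /\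
    (forall i j : 'I_d.+1, (i < j)%N -> q i `<` q j).

Definition has_krull_dim (d : nat) : Prop :=
  prime_chain d /\ (forall e, prime_chain e -> (e <= d)%N).

Definition is_regular_system (s : seq A) : Prop :=
  nonunits = ideal_gen [set` s] /\ has_krull_dim (size s).

Definition is_regular_local_ring : Prop :=
  [/\ is_local, is_noetherian & exists s, is_regular_system s].

Definition part_of_regular_system (t : seq A) : Prop :=
  exists s, is_regular_system (t ++ s).

End CommutativeAlgebra.

Arguments nonunits : clear implicits.
Arguments is_local : clear implicits.
Arguments is_noetherian : clear implicits.
Arguments is_regular_local_ring : clear implicits.

Lemma ideal_gen_ideal (A : comNzRingType) (S : set A) : is_ideal (ideal_gen S).
Proof.
split.
- exists 0%N, (fun=> 0), (fun=> 0); split; first by case.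
  by rewrite big_ord0.
- move=> x y [n [a [s [Hs ->]]]] [m [b [t [Ht ->]]]].
  exists (n + m)%N, (fun i => match split i with inl j => a j | inr j => b j end),
    (fun i => match split i with inl j => s j | inr j => t j end); split.
    by move=> i; case: (split i).
  rewrite big_split_ord /=; congr (_ + _); apply: eq_bigr => i _.
    by rewrite (unsplitK (inl i : 'I_n + 'I_m)).
  by rewrite (unsplitK (inr i : 'I_n + 'I_m)).
- move=> c x [n [a [s [Hs ->]]]]; exists n, (fun i => c * a i), s; split=> //.
  by rewrite mulr_sumr; apply: eq_bigr => i _; rewrite mulrA.
Qed.

Lemma generator_ideal_gen (A : comNzRingType) (S : set A) x :
  S x -> ideal_gen S x.
Proof.
move=> Sx; exists 1%N, (fun=> 1), (fun=> x); split=> //.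
by rewrite big_ord1 mul1r.
Qed.

(* Local rings of closed subschemes of affine schemes: for an ideal J of A    *)
(* and a point p of V(J) = Spec (A/J), [local_ring p] is (A/J)_p.             *)

Record ideal (A : comNzRingType) := Ideal {
  ideal_set :> A -> Prop;
  idealP : is_ideal ideal_set
}.

Record subscheme_point (A : comNzRingType) (J : ideal A) := Point {
  point_set :> A -> Prop;
  point_prime : is_prime_ideal point_set;
  point_sub : J `<=` point_set
}.

Section LocalRing.
Variables (A : comNzRingType) (J : ideal A) (p : subscheme_point J).

Let J0 : J 0. Proof. by case: (idealP J). Qed.
Let JD x y : J x -> J y -> J (x + y).
Proof. by case: (idealP J) => _ H _; apply: H. Qed.
Let JM a x : J x -> J (a * x). Proof. by case: (idealP J) => _ _; apply. Qed.
Let JN x : J x -> J (- x). Proof. by rewrite -mulN1r; apply: JM. Qed.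
Let p1 : ~ p 1. Proof. by case: (point_prime p). Qed.
Let pM x y : ~ p x -> ~ p y -> ~ p (x * y).
Proof. by case: (point_prime p) => _ _ H nx ny /H[]. Qed.

Definition is_fraction (z : A * A) : bool := `[< ~ p z.2 >].
Definition fractions : Type := {z : A * A | is_fraction z}.
HB.instance Definition _ := Choice.on fractions.

Lemma fractionP (z : fractions) : ~ p (val z).2.
Proof. by have /asboolP := valP z. Qed.

Definition mkfrac (a b : A) (nb : ~ p b) : fractions :=
  exist is_fraction (a, b) (asboolT (nb : ~ p (a, b).2)).

(* a/b = c/d in (A/J)_p *)
Definition frac_equiv (x y : fractions) : bool :=
  `[< exists2 r, ~ p r &
        J (r * ((val x).1 * (val y).2 - (val y).1 * (val x).2)) >].

Lemma frac_equivP : equiv_class_of frac_equiv.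
Proof.
have sym x y : frac_equiv x y -> frac_equiv y x.
  move=> /asboolP[r nr Jr]; apply/asboolP; exists r => //.
  by rewrite -opprB mulrN; apply: JN.
split=> [x|x y|y x z].
- by apply/asboolP; exists 1 => //; rewrite subrr mulr0.
- by apply/idP/idP; apply: sym.
- move=> /asboolP[r nr Jr] /asboolP[s ns Js]; apply/asboolP.
  have ny := @fractionP y.
  exists (r * s * (val y).2); first by apply: pM => //; apply: pM.
  move: (val x) (val y) (val z) Jr Js => [a b] [c d] [e f] /= Jr Js.
  have -> : r * s * d * (a * f - e * b) =
     (s * f) * (r * (a * d - c * b)) + (r * b) * (s * (c * f - e * d)). by ring.
  by apply: JD; apply: JM.
Qed.

Canonical frac_equiv_equiv := EquivRelPack frac_equivP.
Canonical frac_equiv_encModRel := defaultEncModRel frac_equiv.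

Definition local_ring : Type := {eq_quot frac_equiv}.
HB.instance Definition _ : EqQuotient _ frac_equiv local_ring :=
  EqQuotient.on local_ring.
HB.instance Definition _ := Choice.on local_ring.

Definition frac (a b : A) (nb : ~ p b) : local_ring := \pi_local_ring (mkfrac a nb).

Lemma frac_eqP a b c d (nb : ~ p b) (nd : ~ p d) :
  frac a nb = frac c nd <-> exists2 r, ~ p r & J (r * (a * d - c * b)).
Proof.
split=> [/eqP|H]; last first.
  by apply/eqP; rewrite /frac piE; apply/asboolP.
by rewrite /frac piE => /asboolP.
Qed.

Lemma frac_ind (P : local_ring -> Prop) :
  (forall a b (nb : ~ p b), P (frac a nb)) -> forall z, P z.
Proof.
move=> H z; rewrite -[z]reprK.
case: (repr z) => -[a b] hb; have nb : ~ p b by have /asboolP := hb.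
suff -> : exist is_fraction (a, b) hb = mkfrac a nb by apply: H.
exact: val_inj.
Qed.

Definition loc_num (z : local_ring) : A := (val (repr z)).1.
Definition loc_den (z : local_ring) : A := (val (repr z)).2.
Lemma denP z : ~ p (loc_den z). Proof. exact: fractionP. Qed.
Lemma fracE z : frac (loc_num z) (@denP z) = z.
Proof.
have e : mkfrac (loc_num z) (@denP z) = repr z :> fractions.
  by apply: val_inj; rewrite /= /loc_num /loc_den -surjective_pairing.
by rewrite /frac e reprK.
Qed.

Definition loc_zero : local_ring := frac 0 p1.
Definition loc_one : local_ring := frac 1 p1.
Definition loc_opp (x : local_ring) : local_ring := frac (- loc_num x) (@denP x).
Definition loc_add (x y : local_ring) : local_ring :=
  frac (loc_num x * loc_den y + loc_num y * loc_den x) (pM (@denP x) (@denP y)).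
Definition loc_mul (x y : local_ring) : local_ring :=
  frac (loc_num x * loc_num y) (pM (@denP x) (@denP y)).

Lemma num_den a b (nb : ~ p b) :
  exists2 r, ~ p r & J (r * (loc_num (frac a nb) * b - a * loc_den (frac a nb))).
Proof. by apply/(frac_eqP _ _ (@denP (frac a nb)) nb); rewrite fracE. Qed.

Lemma loc_oppE a b (nb : ~ p b) : loc_opp (frac a nb) = frac (- a) nb.
Proof.
apply/frac_eqP; have [r nr Jr] := num_den a nb; exists r => //.
by rewrite mulNr mulNr -opprD mulrN; apply: JN.
Qed.

Lemma loc_addE a b c d (nb : ~ p b) (nd : ~ p d) :
  loc_add (frac a nb) (frac c nd) = frac (a * d + c * b) (pM nb nd).
Proof.
apply/frac_eqP; have [r nr Jr] := num_den a nb; have [s ns Js] := num_den c nd.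
exists (r * s); first exact: pM.
move: (loc_num (frac a nb)) (loc_den (frac a nb)) (loc_num (frac c nd))
  (loc_den (frac c nd)) Jr Js => a' b' c' d' Jr Js.
have -> : r * s * ((a' * d' + c' * b') * (b * d) - (a * d + c * b) * (b' * d')) =
  (s * d * d') * (r * (a' * b - a * b')) + (r * b * b') * (s * (c' * d - c * d')).
  by ring.
by apply: JD; apply: JM.
Qed.

Lemma loc_mulE a b c d (nb : ~ p b) (nd : ~ p d) :
  loc_mul (frac a nb) (frac c nd) = frac (a * c) (pM nb nd).
Proof.
apply/frac_eqP; have [r nr Jr] := num_den a nb; have [s ns Js] := num_den c nd.
exists (r * s); first exact: pM.
move: (loc_num (frac a nb)) (loc_den (frac a nb)) (loc_num (frac c nd))
  (loc_den (frac c nd)) Jr Js => a' b' c' d' Jr Js.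
have -> : r * s * (a' * c' * (b * d) - a * c * (b' * d')) =
  (s * c' * d) * (r * (a' * b - a * b')) + (r * a * b') * (s * (c' * d - c * d')).
  by ring.
by apply: JD; apply: JM.
Qed.

Lemma frac_eqW a b c d (nb : ~ p b) (nd : ~ p d) :
  a * d = c * b -> frac a nb = frac c nd.
Proof. by move=> e; apply/frac_eqP; exists 1; rewrite // e subrr mulr0. Qed.

Lemma loc_addA : associative loc_add.
Proof.
elim/frac_ind=> a b nb; elim/frac_ind=> c d nd; elim/frac_ind=> e f nf.
by rewrite !loc_addE; apply: frac_eqW; ring.
Qed.

Lemma loc_addC : commutative loc_add.
Proof.
elim/frac_ind=> a b nb; elim/frac_ind=> c d nd.
by rewrite !loc_addE; apply: frac_eqW; ring.
Qed.

Lemma loc_add0 : left_id loc_zero loc_add.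
Proof. by elim/frac_ind=> a b nb; rewrite loc_addE; apply: frac_eqW; ring. Qed.

Lemma loc_addN : left_inverse loc_zero loc_opp loc_add.
Proof.
by elim/frac_ind=> a b nb; rewrite loc_oppE loc_addE; apply: frac_eqW; ring.
Qed.

Lemma loc_mulA : associative loc_mul.
Proof.
elim/frac_ind=> a b nb; elim/frac_ind=> c d nd; elim/frac_ind=> e f nf.
by rewrite !loc_mulE; apply: frac_eqW; ring.
Qed.

Lemma loc_mulC : commutative loc_mul.
Proof.
elim/frac_ind=> a b nb; elim/frac_ind=> c d nd.
by rewrite !loc_mulE; apply: frac_eqW; ring.
Qed.

Lemma loc_mul1 : left_id loc_one loc_mul.
Proof. by elim/frac_ind=> a b nb; rewrite loc_mulE; apply: frac_eqW; ring. Qed.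

Lemma loc_mulD : left_distributive loc_mul loc_add.
Proof.
elim/frac_ind=> a b nb; elim/frac_ind=> c d nd; elim/frac_ind=> e f nf.
by rewrite !(loc_mulE, loc_addE); apply: frac_eqW; ring.
Qed.

Lemma loc_one_neq0 : loc_one != loc_zero.
Proof.
apply/eqP => /frac_eqP[r nr]; rewrite !mulr1 subr0 mulr1 => Jr.
by apply: nr; apply: (@point_sub _ _ p).
Qed.

HB.instance Definition _ :=
  GRing.isZmodule.Build local_ring loc_addA loc_addC loc_add0 loc_addN.
HB.instance Definition _ :=
  GRing.Zmodule_isComNzRing.Build local_ring
    loc_mulA loc_mulC loc_mul1 loc_mulD loc_one_neq0.

(* The restriction to the local ring of a function on the ambient scheme. *)
Definition germ (a : A) : local_ring := frac a p1.

Lemma germ_is_zmod_morphism : zmod_morphism germ.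
Proof.
move=> a b; rewrite /germ; apply/esym.
have -> : frac a p1 - frac b p1 = loc_add (frac a p1) (loc_opp (frac b p1)) by [].
by rewrite loc_oppE loc_addE; apply: frac_eqW; ring.
Qed.

Lemma germ_is_monoid_morphism : monoid_morphism germ.
Proof.
split=> // a b; have -> : germ a * germ b = loc_mul (germ a) (germ b) by [].
by rewrite /germ loc_mulE; apply: frac_eqW; ring.
Qed.

HB.instance Definition _ :=
  GRing.isZmodMorphism.Build A local_ring germ germ_is_zmod_morphism.
HB.instance Definition _ :=
  GRing.isMonoidMorphism.Build A local_ring germ germ_is_monoid_morphism.

End LocalRing.

Definition powerseries (n : nat) (k : comNzRingType) : Type := 'X_{1..n} -> k.

Notation "{ 'powerseries' k [ n ] }" := (powerseries n k)
  (at level 0, k, n at level 2, format "{ 'powerseries'  k [ n ] }") : type_scope.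

Section PowerSeries.
Variables (n : nat) (k : comNzRingType).
Local Notation S := {powerseries k[n]}.
Implicit Types (f g h : S) (m : 'X_{1..n}) (d : nat).

HB.instance Definition _ := gen_eqMixin S.
HB.instance Definition _ := gen_choiceMixin S.

(* The constant c and the variable u_i. *)
Definition psC (c : k) : S := fun m => if m == 0%MM then c else 0.
Definition psX (i : 'I_n) : S := fun m => if m == U_(i)%MM then 1 else 0.
Definition ps_add f g : S := fun m => f m + g m.
Definition ps_opp f : S := fun m => - f m.
Definition ps_mul f g : S := fun m =>
  \sum_(q : 'X_{1..n < (mdeg m).+1, (mdeg m).+1} | m == (q.1 + q.2)%MM)
    f q.1 * g q.2.

Definition truncation d f : {mpoly k[n]} :=
  \sum_(m : 'X_{1..n < d}) f m *: 'X_[m].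

Lemma truncationE d f m : (mdeg m < d)%N -> (truncation d f)@_m = f m.
Proof.
move=> lt_md; rewrite /truncation linear_sum /=.
rewrite (bigD1 (BMultinom lt_md)) //= mcoeffZ mcoeffX eqxx mulr1.
rewrite big1 ?addr0 // => q neq; rewrite mcoeffZ mcoeffX.
by rewrite (negbTE (_ : bmnm q != m)) ?mulr0.
Qed.

Lemma ps_mulE d f g m (p q : {mpoly k[n]}) : (mdeg m < d)%N ->
  (forall m', (mdeg m' < d)%N -> p@_m' = f m') ->
  (forall m', (mdeg m' < d)%N -> q@_m' = g m') ->
  ps_mul f g m = (p * q)@_m.
Proof.
move=> lt_md Hp Hq; rewrite mcoeffM; apply: eq_bigr => -[a b] /= _.
by rewrite Hp ?Hq //; apply: leq_trans lt_md; rewrite bmdeg.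
Qed.

Let tE f m := @truncationE (mdeg m).+1 f m (ltnSn _).
Let TE d f : forall m', (mdeg m' < d)%N -> (truncation d f)@_m' = f m'.
Proof. by move=> m'; apply: truncationE. Qed.
Let ME d f g : forall m', (mdeg m' < d)%N ->
  (truncation d f * truncation d g)@_m' = ps_mul f g m'.
Proof. by move=> m' lt; rewrite (ps_mulE lt (@TE d f) (@TE d g)). Qed.

Lemma ps_addA : associative ps_add.
Proof. by move=> f g h; apply/funext => m; apply: addrA. Qed.
Lemma ps_addC : commutative ps_add.
Proof. by move=> f g; apply/funext => m; apply: addrC. Qed.
Lemma ps_add0 : left_id (fun=> 0) ps_add.
Proof. by move=> f; apply/funext => m; apply: add0r. Qed.
Lemma ps_addN : left_inverse (fun=> 0) ps_opp ps_add.
Proof. by move=> f; apply/funext => m; apply: addNr. Qed.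

Lemma ps_mulA : associative ps_mul.
Proof.
move=> f g h; apply/funext => m.
rewrite (ps_mulE (ltnSn (mdeg m)) (@TE _ f) (@ME _ g h)).
by rewrite (ps_mulE (ltnSn (mdeg m)) (@ME _ f g) (@TE _ h)) mulrA.
Qed.

Lemma ps_mulC : commutative ps_mul.
Proof.
move=> f g; apply/funext => m; rewrite (ps_mulE (ltnSn (mdeg m)) (@TE _ f) (@TE _ g)).
by rewrite (ps_mulE (ltnSn (mdeg m)) (@TE _ g) (@TE _ f)) mulrC.
Qed.

Lemma ps_mul1 : left_id (psC 1) ps_mul.
Proof.
move=> f; apply/funext => m.
rewrite (ps_mulE (p := 1) (ltnSn (mdeg m)) _ (@TE _ f)) ?mul1r ?TE //.
by move=> m' _; rewrite mcoeff1 /psC; case: eqP.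
Qed.

Lemma ps_mulD : left_distributive ps_mul ps_add.
Proof.
move=> f g h; apply/funext => m.
rewrite (ps_mulE (p := truncation (mdeg m).+1 f + truncation (mdeg m).+1 g)
  (ltnSn (mdeg m)) _ (@TE _ h)).
  by rewrite mulrDl mcoeffD !ME.
by move=> m' lt; rewrite mcoeffD !TE.
Qed.

Lemma ps_one_neq0 : psC 1 != (fun=> 0).
Proof.
apply/eqP => /(congr1 (fun f : S => f 0%MM)); rewrite /psC eqxx => /eqP.
by rewrite oner_eq0.
Qed.

HB.instance Definition _ := GRing.isZmodule.Build S ps_addA ps_addC ps_add0 ps_addN.
HB.instance Definition _ := GRing.Zmodule_isComNzRing.Build S
  ps_mulA ps_mulC ps_mul1 ps_mulD ps_one_neq0.

End PowerSeries.

HB.mixin Record isOrderedAbelianGroup V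
    of Num.POrderedZmodule V := {
  oag_le_total : total (<=%O : rel V);
  oag_leD2r : forall z x y : V, x <= y -> x + z <= y + z
}.

#[short(type="oagType")]
HB.structure Definition OrderedAbelianGroup :=
  { V of Num.POrderedZmodule V & isOrderedAbelianGroup V }.

Section OrderedAbelianGroupTheory.
Variable Phi : oagType.
Implicit Types x y z t : Phi.

Lemma oag_leD x y z t : x <= y -> z <= t -> x + z <= y + t.
Proof.
move=> xy zt; apply: le_trans (oag_leD2r z _ _ xy) _.
by rewrite ![y + _]addrC; apply: oag_leD2r.
Qed.

Lemma oag_ltD2r z x y : x < y -> x + z < y + z.
Proof.
rewrite !lt_neqAle => /andP[neq le]; rewrite oag_leD2r // andbT.
by rewrite (inj_eq (addIr z)).
Qed.

Lemma oag_le_ltD x y z t : x <= y -> z < t -> x + z < y + t.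
Proof.
move=> xy zt; apply: le_lt_trans (oag_leD2r z _ _ xy) _.
by rewrite ![y + _]addrC; apply: oag_ltD2r.
Qed.

Lemma oag_addr_ge0 x y : 0 <= x -> 0 <= y -> 0 <= x + y.
Proof. by move=> hx hy; rewrite -[0]addr0 oag_leD. Qed.

Lemma oag_addr_eq0 x y : 0 <= x -> 0 <= y -> x + y = 0 -> x = 0 /\ y = 0.
Proof.
move=> hx hy e; have ex : x = 0.
  by apply/eqP; rewrite eq_le hx andbT -e -[leLHS]addr0 oag_leD.
by split=> //; rewrite -e ex add0r.
Qed.

End OrderedAbelianGroupTheory.

Local Notation "x %:F" := (@tofrac _ x).

(* The value at 0, which is +oo in the usual convention, is left unspecified: *)
(* every use of the function below distinguishes the case of 0.               *)
Record valuation (K : fieldType) (Phi : oagType) := Valuation {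
  val_fun :> K -> Phi;
  valM : forall x y, x != 0 -> y != 0 -> val_fun (x * y) = val_fun x + val_fun y;
  valD : forall x y, x != 0 -> y != 0 -> x + y != 0 ->
    Order.min (val_fun x) (val_fun y) <= val_fun (x + y);
  val_onto : forall phi, exists2 x, x != 0 & val_fun x = phi
}.

Definition valuation_ring (K : fieldType) (Phi : oagType)
  (nu : valuation K Phi) : set K := [set x | x = 0 \/ 0 <= nu x].

Definition valuation_ideal (K : fieldType) (Phi : oagType)
  (nu : valuation K Phi) : set K := [set x | x = 0 \/ 0 < nu x].

Record dominating_valuation (R : idomainType) (Phi : oagType) := Dominating {
  dom_val :> valuation {fraction R} Phi;
  dom_ring : forall x : R, valuation_ring dom_val x%:F;
  dom_ideal : forall x : R, valuation_ideal dom_val x%:F <-> nonunits R x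
}.

(* R/m -> R_nu/m_nu is injective by domination; this says that it is onto. *)
Definition is_rational (R : idomainType) (Phi : oagType)
    (nu : dominating_valuation R Phi) : Prop :=
  forall y, valuation_ring nu y -> exists x : R, valuation_ideal nu (y - x%:F).

(* The associated graded ring. The direct sum over phi >= 0 of                *)
(*   {x | nu x >= phi} / {x | nu x > phi}                                     *)
(* is obtained as the quotient of the ring of finite sums of x_phi t^phi with *)
(* nu x_phi >= phi, a subring of the monoid algebra R[Phi_{>=0}], by the      *)
(* ideal of those sums for which nu x_phi > phi for all phi.                  *)

Definition nneg (Phi : oagType) : Type := {phi : Phi | 0 <= phi}.
HB.instance Definition _ (Phi : oagType) := Choice.on (nneg Phi).
HB.instance Definition _ (Phi : oagType) := SubType.on (nneg Phi).

Section NonNegative.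
Import monalg.
Variable Phi : oagType.
Local Notation G := (nneg Phi).

Definition nneg0 : G := exist (fun phi : Phi => 0 <= phi) 0 (lexx 0).
Definition nnegD (x y : G) : G :=
  exist (fun phi : Phi => 0 <= phi) (val x + val y)
    (oag_addr_ge0 (valP x) (valP y)).

Lemma nnegDA : associative nnegD.
Proof. by move=> x y z; apply: val_inj; apply: addrA. Qed.
Lemma nnegDC : commutative nnegD.
Proof. by move=> x y; apply: val_inj; apply: addrC. Qed.
Lemma nneg0D : left_id nneg0 nnegD.
Proof. by move=> x; apply: val_inj; apply: add0r. Qed.
Lemma nnegD0 : right_id nneg0 nnegD.
Proof. by move=> x; apply: val_inj; apply: addr0. Qed.
Lemma nnegD_eq0 x y : nnegD x y = nneg0 -> x = nneg0 /\ y = nneg0.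
Proof.
move=> /(congr1 val) /= e.
have [ex ey] := oag_addr_eq0 (valP x) (valP y) e.
by split; apply: val_inj.
Qed.

HB.instance Definition _ := Choice_isMonomialDef.Build G
  nnegDA nneg0D nnegD0 nnegD_eq0.
HB.instance Definition _ := MonomialDef_isConomialDef.Build G nnegDC.

End NonNegative.

Module AssociatedGraded.
Section AssociatedGraded.
Import monalg.
Local Notation "g @_ k" := (mcoeff k g) : ring_scope.
Variables (R : idomainType) (Phi : oagType) (nu : dominating_valuation R Phi).
Local Notation G := (nneg Phi).

Definition val_ge (phi : Phi) : set R := [set x | x = 0 \/ phi <= nu x%:F].
Definition val_gt (phi : Phi) : set R := [set x | x = 0 \/ phi < nu x%:F].

Lemma val1 : nu 1 = 0.
Proof.
have := valM nu (oner_neq0 _) (oner_neq0 _); rewrite mulr1 => /eqP.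
by rewrite -subr_eq0 opprD addrA subrr add0r oppr_eq0 => /eqP.
Qed.

Lemma valN (x : {fraction R}) : x != 0 -> nu (- x) = nu x.
Proof.
have n1 : (-1 : {fraction R}) != 0 by rewrite oppr_eq0 oner_neq0.
have e : nu (-1) + nu (-1) = 0 by rewrite -valM // mulrNN mulr1 val1.
suff e1 : nu (-1) = 0 by move=> x0; rewrite -mulN1r valM // e1 add0r.
case/orP: (oag_le_total 0 (nu (-1))) => h.
  by case: (oag_addr_eq0 h h e).
have h' : 0 <= - nu (-1) by have := oag_leD2r (- nu (-1)) _ _ h; rewrite subrr add0r.
have /eqP : - nu (-1) = 0.
  by case: (oag_addr_eq0 h' h') => //; rewrite -opprD e oppr0.
by rewrite oppr_eq0 => /eqP.
Qed.

Lemma val_ge_add phi x y : val_ge phi x -> val_ge phi y -> val_ge phi (x + y).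
Proof.
move=> [->|hx]; first by rewrite add0r.
move=> [->|hy]; first by rewrite addr0; right.
have [->|x0] := eqVneq x 0; first by rewrite add0r; right.
have [->|y0] := eqVneq y 0; first by rewrite addr0; right.
have [->|xy0] := eqVneq (x + y) 0; first by left.
right; rewrite rmorphD /=.
apply: le_trans (valD nu _ _ _); rewrite ?tofrac_eq0 // -?rmorphD ?tofrac_eq0 //.
by rewrite /Order.min; case: ifP.
Qed.

Lemma val_gt_add phi x y : val_gt phi x -> val_gt phi y -> val_gt phi (x + y).
Proof.
move=> [->|hx]; first by rewrite add0r.
move=> [->|hy]; first by rewrite addr0; right.
have [->|x0] := eqVneq x 0; first by rewrite add0r; right.
have [->|y0] := eqVneq y 0; first by rewrite addr0; right.
have [->|xy0] := eqVneq (x + y) 0; first by left.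
right; rewrite rmorphD /=.
apply: lt_le_trans (valD nu _ _ _); rewrite ?tofrac_eq0 // -?rmorphD ?tofrac_eq0 //.
by rewrite /Order.min; case: ifP.
Qed.

Lemma val_ge_opp phi x : val_ge phi x -> val_ge phi (- x).
Proof.
move=> [->|hx]; first by rewrite oppr0; left.
have [->|x0] := eqVneq x 0; first by rewrite oppr0; left.
by right; rewrite rmorphN valN // tofrac_eq0.
Qed.

Lemma val_gt_opp phi x : val_gt phi x -> val_gt phi (- x).
Proof.
move=> [->|hx]; first by rewrite oppr0; left.
have [->|x0] := eqVneq x 0; first by rewrite oppr0; left.
by right; rewrite rmorphN valN // tofrac_eq0.
Qed.

Lemma val_ge_mul phi psi x y :
  val_ge phi x -> val_ge psi y -> val_ge (phi + psi) (x * y).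
Proof.
move=> [->|hx]; first by rewrite mul0r; left.
move=> [->|hy]; first by rewrite mulr0; left.
have [->|x0] := eqVneq x 0; first by rewrite mul0r; left.
have [->|y0] := eqVneq y 0; first by rewrite mulr0; left.
by right; rewrite rmorphM valM ?tofrac_eq0 // oag_leD.
Qed.

Lemma val_gt_mul phi psi x y :
  val_ge phi x -> val_gt psi y -> val_gt (phi + psi) (x * y).
Proof.
move=> [->|hx]; first by rewrite mul0r; left.
move=> [->|hy]; first by rewrite mulr0; left.
have [->|x0] := eqVneq x 0; first by rewrite mul0r; left.
have [->|y0] := eqVneq y 0; first by rewrite mulr0; left.
by right; rewrite rmorphM valM ?tofrac_eq0 // oag_le_ltD.
Qed.

Definition rees_pred : {pred {malg R[G]}} :=
  [pred f | `[< forall phi : G, val_ge (val phi) f@_phi >]].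

Lemma reesP f :
  reflect (forall phi : G, val_ge (val phi) f@_phi) (f \in rees_pred).
Proof. exact: asboolP. Qed.

Lemma rees_sum_ge (f g : {malg R[G]}) (phi : G) (P : R -> Prop) :
    P 0 -> (forall x y, P x -> P y -> P (x + y)) ->
    (forall a b, nnegD a b = phi -> P (f@_a * g@_b)) ->
  P (f * g)@_phi.
Proof.
move=> P0 PD PM; rewrite mcoeffMl; elim/big_ind: _ => // a _.
elim/big_ind: _ => // b _; case: eqP => [e|_]; last by rewrite mulr0n.
by rewrite mulr1n; apply: PM.
Qed.

Fact rees_subring : subring_closed rees_pred.
Proof.
split.
- apply/reesP => phi; rewrite mcoeff1; case: eqP => [->|_]; last by left.
  by right; rewrite rmorph1 val1.
- move=> f g /reesP hf /reesP hg; apply/reesP => phi; rewrite mcoeffB.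
  by apply: val_ge_add => //; apply: val_ge_opp.
- move=> f g /reesP hf /reesP hg; apply/reesP => phi.
  apply: rees_sum_ge; first by left.
    by move=> x y; apply: val_ge_add.
  by move=> a b <-; apply: val_ge_mul.
Qed.

HB.instance Definition _ := GRing.isSubringClosed.Build _ rees_pred rees_subring.

Definition rees : Type := {f : {malg R[G]} | f \in rees_pred}.
HB.instance Definition _ := SubChoice.on rees.
HB.instance Definition _ := [SubChoice_isSubComNzRing of rees by <:].

Definition rees_plus : {pred rees} :=
  [pred f | `[< forall phi : G, val_gt (val phi) (val f)@_phi >]].

Lemma rees_plusP f :
  reflect (forall phi : G, val_gt (val phi) (val f)@_phi) (f \in rees_plus).
Proof. exact: asboolP. Qed.

Fact rees_plus_ideal : idealr_closed rees_plus.
Proof.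
split.
- by apply/rees_plusP => phi; rewrite rmorph0 mcoeff0; left.
- apply/negP => /rees_plusP /(_ (nneg0 Phi)); rewrite rmorph1.
  by case=> [/eqP|]; rewrite ?oner_eq0 // rmorph1 val1 ltxx.
- move=> f g h /rees_plusP hg /rees_plusP hh; apply/rees_plusP => phi.
  rewrite rmorphD rmorphM mcoeffD; apply: val_gt_add => //.
  apply: rees_sum_ge; first by left.
    by move=> x y; apply: val_gt_add.
  by move=> a b <-; apply: val_gt_mul => //; apply/reesP/valP.
Qed.

HB.instance Definition _ := isIdealr.Build rees rees_plus rees_plus_ideal.

Definition graded_ring : Type := {ideal_quot rees_plus}.
HB.instance Definition _ := GRing.ComNzRing.on graded_ring.

(* The class of x t^0. *)
Fact gr_const_subproof (x : R) : << x *g nneg0 Phi >> \in rees_pred.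
Proof.
apply/reesP => phi; rewrite mcoeffU; case: eqP => [<-|_]; last by left.
rewrite mulr1n; have := dom_ring nu x; case=> [/eqP|]; last by right.
by rewrite tofrac_eq0 => /eqP ->; left.
Qed.

Definition rees_const (x : R) : rees :=
  exist (fun f => f \in rees_pred) _ (gr_const_subproof x).
Definition gr_const (x : R) : graded_ring := \pi_graded_ring (rees_const x).

Fact gr_const_zmod_morphism : zmod_morphism gr_const.
Proof.
move=> x y; rewrite /gr_const.
have -> : rees_const (x - y) = rees_const x - rees_const y.
  by apply: val_inj; rewrite rmorphB /= raddfB.
by rewrite rmorphB.
Qed.

Fact gr_const_monoid_morphism : monoid_morphism gr_const.
Proof.
rewrite /gr_const; split.
  have -> : rees_const 1 = 1 by apply: val_inj; rewrite rmorph1.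
  by rewrite rmorph1.
move=> x y; have -> : rees_const (x * y) = rees_const x * rees_const y.
  by apply: val_inj; rewrite rmorphM /= (rmorphM (@malgC _ _)).
by rewrite rmorphM.
Qed.

HB.instance Definition _ :=
  GRing.isZmodMorphism.Build R graded_ring gr_const gr_const_zmod_morphism.
HB.instance Definition _ :=
  GRing.isMonoidMorphism.Build R graded_ring gr_const gr_const_monoid_morphism.

(* The class of x t^(nu x). For x != 0 the default values of [insubd] are not *)
(* used: nu x >= 0 and x t^(nu x) belongs to [rees].                          *)
Definition initial_form (x : R) : graded_ring :=
  \pi_graded_ring (insubd (0 : rees) << x *g insubd (nneg0 Phi) (nu x%:F) >>).

Lemma initial_formE (x : R) (x0 : x != 0) :
  exists (phi : G) (h : << x *g phi >> \in rees_pred),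
    val phi = nu x%:F /\ initial_form x = \pi_graded_ring (exist (fun f => f \in rees_pred) _ h : rees).
Proof.
have nux : 0 <= nu x%:F.
  by case: (dom_ring nu x) => // /eqP; rewrite tofrac_eq0 (negbTE x0).
have e : val (insubd (nneg0 Phi) (nu x%:F)) = nu x%:F by rewrite insubdK.
exists (insubd (nneg0 Phi) (nu x%:F)).
have h : << x *g insubd (nneg0 Phi) (nu x%:F) >> \in rees_pred.
  apply/reesP => phi; rewrite mcoeffU; case: eqP => [<-|_]; last by left.
  by right; rewrite mulr1n e.
exists h; split=> //; congr (\pi_graded_ring _).
by apply: val_inj; rewrite insubdK.
Qed.

End AssociatedGraded.
End AssociatedGraded.
Export AssociatedGraded.

(* gr_nu R as an algebra over a subfield of R. *)
Definition gr_algebra_map (k : fieldType) (R : idomainType) (Phi : oagType)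
    (nu : dominating_valuation R Phi) (iota : {rmorphism k -> R}) :
    {rmorphism k -> graded_ring nu} := gr_const nu \o iota.

Definition generates_algebra (k : fieldType) (B : comNzRingType)
    (iota : {rmorphism k -> B}) (n : nat) (g : 'I_n -> B) : Prop :=
  forall z : B, exists p : {mpoly k[n]}, z = mmap iota g p.

Definition is_field_of_representatives (k : fieldType) (R : idomainType)
    (iota : {rmorphism k -> R}) : Prop :=
  forall x, exists c, nonunits R (x - iota c).

(* Continuity for the adic topologies of the maximal ideals. *)
Definition is_continuous (k : fieldType) (N : nat) (R : idomainType)
    (pi : {rmorphism {powerseries k[N]} -> R}) : Prop :=
  forall n, exists d, forall f : {powerseries k[N]},
    (forall m, (mdeg m < d)%N -> f m = 0) -> ideal_exp (nonunits R) n (pi f).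

(* Fans in R^N. A cone is given by a finite list of integral generators and   *)
(* a fan by a finite list of cones.                                           *)

Section Fans.
Variables (RR : realType) (N : nat).
Implicit Types (s t : seq 'rV[int]_N) (x : 'rV[RR]_N) (C : set 'rV[RR]_N).

Definition pairing (l x : 'rV[RR]_N) : RR := \sum_i l 0 i * x 0 i.

Definition cone s : set 'rV[RR]_N :=
  [set x | exists c : 'I_(size s) -> RR, (forall i, 0 <= c i) /\
     x = \sum_i c i *: map_mx intr (nth 0 s i)].

Definition is_face (F C : set 'rV[RR]_N) : Prop :=
  exists l, (forall x, C x -> 0 <= pairing l x) /\
            F = [set x | C x /\ pairing l x = 0].

(* The generators are distinct members of a basis of Z^N. *)
Definition is_regular_cone s : Prop :=
  exists (M : 'M[int]_N) (f : 'I_(size s) -> 'I_N),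
    [/\ M \in unitmx, injective f
      & forall i : 'I_(size s), nth 0 s i = row (f i) M].

Definition is_regular_fan (Sigma : seq (seq 'rV[int]_N)) : Prop :=
  [/\ forall s, s \in Sigma -> is_regular_cone s,
      forall s F, s \in Sigma -> is_face F (cone s) ->
        exists2 t, t \in Sigma & F = cone t
    & forall s t, s \in Sigma -> t \in Sigma ->
        is_face (cone s `&` cone t) (cone s) /\
        is_face (cone s `&` cone t) (cone t)].

Definition fan_support (Sigma : seq (seq 'rV[int]_N)) : set 'rV[RR]_N :=
  [set x | exists2 s, s \in Sigma & cone s x].

Definition orthant : set 'rV[RR]_N := [set x | forall i, 0 <= x 0 i].

End Fans.

(* The strict transform on the chart of an N-dimensional cone. The cone is    *)
(* <a^1, ..., a^N> where a^j is the j-th row of [a]. The corresponding chart  *)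
(* of Z(Sigma) x_{A^N} Spec k[[u]] is the spectrum of                         *)
(*   k[y] (x)_{k[u]} k[[u]] = k[[u]][y] / (u_i - y_1^{a^1_i} ... y_N^{a^N_i}) *)
(* and its closed subschemes are those of Spec k[[u]][y] whose ideal contains *)
(* the u_i - y_1^{a^1_i} ... y_N^{a^N_i}.                                     *)

Definition rows_of (N : nat) (a : 'M[int]_N) : seq 'rV[int]_N :=
  [seq row j a | j <- enum 'I_N].

Section StrictTransform.
Variables (k : fieldType) (R : idomainType) (N : nat).
Local Notation S := {powerseries k[N]}.
Local Notation A := {mpoly {powerseries k[N]}[N]}.
Variables (pi : {rmorphism S -> R}) (a : 'M[int]_N).

(* The entries of [a] are nonnegative when the fan has support R^N_{>=0}. *)
Definition toric_monomial (i : 'I_N) : A := \prod_j 'X_j ^+ `|a j i|%N.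

(* The inverse image of X = V(ker pi). *)
Definition inverse_image : set A :=
  ideal_gen ([set f | exists i, f = (psX k i)%:MP - toric_monomial i] `|`
             [set f | exists2 g, pi g = 0 & f = g%:MP]).

(* The closure of the locus u_1 ... u_N <> 0 of the inverse image. *)
Definition strict_transform_set : set A :=
  [set f | exists n, inverse_image ((\prod_i psX k i)%:MP ^+ n * f)].

Fact strict_transform_ideal : is_ideal strict_transform_set.
Proof.
have [I0 ID IM] := ideal_gen_ideal
  ([set f | exists i, f = (psX k i)%:MP - toric_monomial i] `|`
   [set f : A | exists2 g, pi g = 0 & f = g%:MP]).
set u := (\prod_i psX k i)%:MP : A.
split.
- by exists 0%N; rewrite mulr0.
- move=> f g [n Hn] [m Hm]; exists (n + m)%N.
  have -> : u ^+ (n + m) * (f + g) = u ^+ m * (u ^+ n * f) + u ^+ n * (u ^+ m * g).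
    by rewrite exprD; ring.
  by apply: ID; apply: IM.
- move=> b f [n Hn]; exists n; rewrite mulrCA; exact: IM.
Qed.

Definition strict_transform : ideal A := Ideal strict_transform_ideal.

(* A morphism Spec Frac(R) -> X' lifting the generic point of X = Spec R. *)
Definition lifts_generic_point (theta : {rmorphism A -> {fraction R}}) : Prop :=
  (forall g : S, theta g%:MP = (pi g)%:F) /\
  (forall f, strict_transform f -> theta f = 0).

(* The center of nu on X': R_nu dominates the image of the local ring at p.   *)
(* X' is not glued from its charts: the center is unique, and properties of   *)
(* its local ring can be stated on any chart which contains it.               *)
Definition is_center_of_valuation (Phi : oagType) (nu : valuation {fraction R} Phi)
    (p : subscheme_point strict_transform) : Prop :=
  exists theta : {rmorphism A -> {fraction R}},
    [/\ lifts_generic_point theta,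
        forall f, valuation_ring nu (theta f)
      & forall f, p f <-> valuation_ideal nu (theta f)].

Definition transversal_to_boundary (p : subscheme_point strict_transform) : Prop :=
  part_of_regular_system
    [seq germ p 'X_j | j <- enum 'I_N & `[< p 'X_j >]].

End StrictTransform.

(* Main.v *)
Require Import Defs.
From HB Require Import structures.
From mathcomp Require Import all_boot all_order all_algebra.
From mathcomp Require Import boolp classical_sets reals.
From mathcomp Require Import mpoly ring zify.

Set Implicit Arguments.
Unset Strict Implicit.
Unset Printing Implicit Defensive.

Import Order.TTheory GRing.Theory Num.Theory.

Local Open Scope classical_set_scope.
Local Open Scope ring_scope.

(* The semigroup of values of R is generated by the values v_i of the xi_i.   *)
(* Blowing up edges of the fan along the center of nu (Perron's algorithm)    *)
(* leads to a chart in which every coordinate y_j has either the value 0 or   *)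
(* one of the values tau_1, ..., tau_r, linearly independent over Z. A        *)
(* coordinate y_j of value 0 is a Laurent monomial u^m / u^n; if lambda is    *)
(* its residue, then xi^m - lambda xi^n has a greater value than xi^n, and    *)
(* hence it is the image of a power series in monomials u^e of weight greater *)
(* than that of u^n. Finitely many e suffice, and further blowing ups turn    *)
(* the u^e / u^n into multiples of coordinates of positive value: so          *)
(* y_j - lambda belongs to the ideal of these coordinates, and this ideal is  *)
(* the maximal ideal m of the local ring at the center. Krull's height        *)
(* theorem bounds its dimension by r. Conversely, since distinct monomials    *)
(* have distinct values, no monomial in the r generators of m belongs to the  *)
(* ideal generated by the monomials which do not divide it, and it follows    *)
(* that the ideals (y_1, ..., y_i) form a chain of r + 1 primes.              *)

(** * Noetherian rings *)

(** Regularity is read off from values. By [value_semigroup] every value on R is a weight, a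
    nonnegative combination of the values of the xi_i, and by Dickson's lemma the weights are well
    ordered. Residues against monomials can therefore be subtracted by recursion on the weight, and
    [series_expansion] writes each x of value at least phi as the image of a power series whose
    monomials all have weight at least phi.

    On the toric side, a chart is a unimodular matrix [a]; its coordinates y_j are Laurent monomials
    in the xi_i, and the strict transform is the kernel of evaluation into Frac R
    ([strict_transform_ker]), so the local ring at the center embeds in Frac R. Star subdivisions
    preserve regular fans on the orthant ([star_good]) and act on the values of the coordinates by
    subtracting a smaller one from a larger one. A chart with the fewest coordinates of positive
    value has these values linearly independent over Z ([minimal_independent]), and further
    subdivisions make finitely many Laurent monomials of nonnegative value regular at the center
    ([blowup_refine]). Applied to the monomials that occur in y_j - c, where y_j has value 0 and
    residue c ([laurent_expansion]), this shows that the coordinates of positive value generate the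
    maximal ideal ([center_maximal_ideal]).

    What remains is a criterion ([values_regular]): a noetherian local ring whose maximal ideal is
    generated by r elements, distinct monomials in which have distinct values, is regular of
    dimension r. Krull's height theorem bounds the dimension by r. Conversely, a monomial is never
    in the ideal of the monomials that do not divide it ([mono_independent]), since the weights in
    such an expression could be raised beyond the value of the monomial. Comparing leading terms,
    the ideals generated by initial segments of the generators are prime, and they form a strict
    chain. The generators are the local equations of the boundary components through the center,
    which gives transversality. *)

Section Ideals.
Variable A : comNzRingType.
Implicit Types (I J K P Q S T : set A) (x y z : A).

Lemma is_ideal0 I : is_ideal I -> I 0. Proof. by case. Qed.
Lemma is_idealD I x y : is_ideal I -> I x -> I y -> I (x + y).
Proof. by case=> _ h _; apply: h. Qed.
Lemma is_idealMl I a x : is_ideal I -> I x -> I (a * x).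
Proof. by case=> _ _; apply. Qed.
Lemma is_idealMr I a x : is_ideal I -> I x -> I (x * a).
Proof. by rewrite mulrC; apply: is_idealMl. Qed.
Lemma is_idealN I x : is_ideal I -> I x -> I (- x).
Proof. by rewrite -mulN1r; apply: is_idealMl. Qed.
Lemma is_idealB I x y : is_ideal I -> I x -> I y -> I (x - y).
Proof. by move=> h hx hy; apply: is_idealD => //; apply: is_idealN. Qed.

Lemma ideal_sum I (L : Type) (r : seq L) (C : pred L) (F : L -> A) :
  is_ideal I -> (forall i, C i -> I (F i)) -> I (\sum_(i <- r | C i) F i).
Proof.
move=> h hF; elim/big_ind: _ => //; first exact: is_ideal0.
by move=> x y; apply: is_idealD.
Qed.

Lemma ideal_gen_sub S I : is_ideal I -> S `<=` I -> ideal_gen S `<=` I.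
Proof.
move=> hI hS x [n [a [s [hs ->]]]]; apply: ideal_sum => // i _.
by apply: is_idealMl => //; apply: hS.
Qed.

Lemma ideal_gen_mono S T : S `<=` T -> ideal_gen S `<=` ideal_gen T.
Proof.
move=> h; apply: ideal_gen_sub; first exact: ideal_gen_ideal.
by move=> x /h; apply: generator_ideal_gen.
Qed.

Lemma ideal_gen_seqP (s : seq A) x : ideal_gen [set` s] x ->
  exists a : 'I_(size s) -> A, x = \sum_i a i * s`_i.
Proof.
have hI : is_ideal [set x | exists a : 'I_(size s) -> A, x = \sum_i a i * s`_i].
  split.
  - by exists (fun=> 0); rewrite big1 // => i _; rewrite mul0r.
  - move=> _ _ [a ->] [b ->]; exists (fun i => a i + b i).
    by rewrite -big_split; apply: eq_bigr => i _; rewrite mulrDl.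
  - move=> c _ [a ->]; exists (fun i => c * a i).
    by rewrite mulr_sumr; apply: eq_bigr => i _; rewrite mulrA.
apply: (ideal_gen_sub hI) => y /= ys.
have hy : (index y s < size s)%N by rewrite index_mem.
exists (fun i => (i == Ordinal hy)%:R).
rewrite (bigD1 (Ordinal hy)) //= eqxx mul1r nth_index // big1 ?addr0 // => i ne.
by rewrite (negbTE ne) mul0r.
Qed.

Definition ideal_add I J : set A := [set z | exists x y, [/\ I x, J y & z = x + y]].

Lemma ideal_add_ideal I J : is_ideal I -> is_ideal J -> is_ideal (ideal_add I J).
Proof.
move=> hI hJ; split.
- by exists 0, 0; split; [exact: is_ideal0|exact: is_ideal0|rewrite addr0].
- move=> _ _ [a [b [ha hb ->]]] [c [d [hc hd ->]]]; exists (a + c), (b + d).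
  by split; [exact: is_idealD|exact: is_idealD|rewrite addrACA].
- move=> r _ [a [b [ha hb ->]]]; exists (r * a), (r * b).
  by split; [exact: is_idealMl|exact: is_idealMl|rewrite mulrDr].
Qed.

Lemma ideal_addl I J : is_ideal J -> I `<=` ideal_add I J.
Proof. by move=> hJ x Ix; exists x, 0; split=> //; [exact: is_ideal0|rewrite addr0]. Qed.
Lemma ideal_addr I J : is_ideal I -> J `<=` ideal_add I J.
Proof. by move=> hI x Jx; exists 0, x; split=> //; [exact: is_ideal0|rewrite add0r]. Qed.

Definition principal x : set A := [set z | exists a, z = a * x].
Lemma principal_ideal x : is_ideal (principal x).
Proof.
split; first by exists 0; rewrite mul0r.
  by move=> _ _ [a ->] [b ->]; exists (a + b); rewrite mulrDl.
by move=> c _ [a ->]; exists (c * a); rewrite mulrA.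
Qed.
Lemma principal_id x : principal x x. Proof. by exists 1; rewrite mul1r. Qed.

Lemma setT_ideal : is_ideal [set: A]. Proof. by []. Qed.

Lemma ideal_mul_ideal I J : is_ideal (ideal_mul I J).
Proof. exact: ideal_gen_ideal. Qed.

Lemma ideal_exp_ideal I n : is_ideal (ideal_exp I n).
Proof. case: n => [|n]; [exact: setT_ideal|exact: ideal_mul_ideal]. Qed.

Lemma ideal_expX I x n : I x -> ideal_exp I n (x ^+ n).
Proof.
move=> Ix; elim: n => [|n IH] //; rewrite exprS; apply: generator_ideal_gen.
by exists x, (x ^+ n).
Qed.

Lemma prime_ideal P : is_prime_ideal P -> is_ideal P. Proof. by case. Qed.
Lemma prime1 P : is_prime_ideal P -> ~ P 1. Proof. by case. Qed.
Lemma primeM P x y : is_prime_ideal P -> ~ P x -> ~ P y -> ~ P (x * y).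
Proof. by case=> _ _ h nx ny /h[]. Qed.
Lemma primeMK P x y : is_prime_ideal P -> ~ P x -> P (x * y) -> P y.
Proof. by case=> _ _ h nx /h[]. Qed.
Lemma primeX P x n : is_prime_ideal P -> ~ P x -> ~ P (x ^+ n).
Proof.
move=> hP nx; elim: n => [|n IH]; first by rewrite expr0; apply: prime1.
by rewrite exprS; apply: primeM.
Qed.

Lemma ideal_colon I x : is_ideal I -> is_ideal [set a | I (a * x)].
Proof.
move=> hI; split=> /=; first by rewrite mul0r; apply: is_ideal0.
  by move=> a b ha hb; rewrite mulrDl; apply: is_idealD.
by move=> a b hb; rewrite -mulrA; apply: is_idealMl.
Qed.

Lemma ideal_setI I J : is_ideal I -> is_ideal J -> is_ideal (I `&` J).
Proof.
move=> hI hJ; split; first by split; apply: is_ideal0.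
  by move=> x y [? ?] [? ?]; split; apply: is_idealD.
by move=> a x [? ?]; split; apply: is_idealMl.
Qed.

(* For a prime P this is the contraction of the localization of I at P. *)
Definition saturation P I : set A := [set a | exists2 s, ~ P s & I (s * a)].

Lemma saturation_ideal P I : is_prime_ideal P -> is_ideal I -> is_ideal (saturation P I).
Proof.
move=> hP hI; split.
- by exists 1; [apply: prime1|rewrite mul1r; apply: is_ideal0].
- move=> a b [s ns hs] [t nt ht]; exists (s * t); first exact: primeM.
  have -> : s * t * (a + b) = t * (s * a) + s * (t * b) by ring.
  by apply: is_idealD => //; apply: is_idealMl.
- move=> c a [s ns hs]; exists s => //.
  by rewrite mulrCA; apply: is_idealMl.
Qed.

Lemma sub_saturation P I : is_prime_ideal P -> I `<=` saturation P I.
Proof. by move=> hP a Ia; exists 1; [apply: prime1|rewrite mul1r]. Qed.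

Lemma saturation_mono P I J : I `<=` J -> saturation P I `<=` saturation P J.
Proof. by move=> h a [s ns hs]; exists s => //; apply: h. Qed.

(** The finitely many denominators, all outside the prime P, are multiplied together. *)
Lemma saturation_seq P I (s : seq A) : is_prime_ideal P -> is_ideal I ->
  [set` s] `<=` saturation P I -> exists2 t, ~ P t & forall x, ideal_gen [set` s] x -> I (t * x).
Proof.
move=> hP hI; elim: s => [|x s IH] hs.
  exists 1; first exact: prime1.
  move=> y /ideal_gen_seqP[a ->]; rewrite big_ord0 mulr0; exact: is_ideal0.
have [t nt ht] : exists2 t, ~ P t & forall y, ideal_gen [set` s] y -> I (t * y).
  by apply: IH => y ys; apply: hs => /=; rewrite inE ys orbT.
have [u nu hu] : saturation P I x by apply: hs; rewrite /= inE eqxx.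
exists (t * u); first exact: primeM.
apply: (@ideal_gen_sub _ [set y | I (t * u * y)]).
  split=> /=; first by rewrite mulr0; apply: is_ideal0.
    by move=> a b ha hb; rewrite mulrDr; apply: is_idealD.
  by move=> a b hb; rewrite mulrCA; apply: is_idealMl.
move=> y /=; rewrite inE => /orP[/eqP ->|ys].
  by rewrite -mulrA; apply: is_idealMl.
rewrite mulrAC; apply: is_idealMr => //; apply: ht.
exact: generator_ideal_gen.
Qed.

Lemma is_idealB_mul P a b c d :
  is_ideal P -> P (a - b) -> P (c - d) -> P (a * c - b * d).
Proof.
move=> hP h1 h2; have -> : a * c - b * d = (a - b) * c + b * (c - d) by ring.
by apply: is_idealD => //; [apply: is_idealMr|apply: is_idealMl].
Qed.

Lemma det_congr P n (M M' : 'M[A]_n) : is_ideal P ->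
  (forall i j, P (M i j - M' i j)) -> P (\det M - \det M').
Proof.
move=> hP h.
rewrite /determinant -sumrB; apply: ideal_sum => // s _.
apply: is_idealB_mul => //; first by rewrite subrr; apply: is_ideal0.
elim: (index_enum _) => [|i r IH]; first by rewrite !big_nil subrr; apply: is_ideal0.
by rewrite !big_cons; apply: is_idealB_mul.
Qed.

(* The determinant trick behind Nakayama's lemma, in a form which includes    *)
(* the localization at P.                                                     *)
Lemma nakayama P I n (g : 'I_n -> A) (C : 'I_n -> 'I_n -> A) t :
  is_prime_ideal P -> is_ideal I -> ~ P t -> (forall i j, P (C i j)) ->
  (forall i, I (t * g i - \sum_j C i j * g j)) ->
  exists2 d, ~ P d & forall j, I (d * g j).
Proof.
move=> hP hI nt hC hg.
pose M : 'M[A]_n := t%:M - \matrix_(i, j) C i j.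
pose G : 'cV[A]_n := \col_j g j.
have hMG i : I ((M *m G) i 0).
  rewrite /M mulmxBl mul_scalar_mx !mxE.
  by under eq_bigr do rewrite !mxE.
exists (\det M).
  (* Modulo P the matrix is t times the identity, so its determinant is congruent to [t ^+ n]. *)
  move=> Pd; apply: (primeX hP nt (n := n)); rewrite -(det_scalar n t).
  rewrite -(subKr (\det M) (\det _)); apply: is_idealB => //; first exact: prime_ideal.
  apply: det_congr => [|i j]; first exact: prime_ideal.
  rewrite /M !mxE addrAC subrr add0r; apply: is_idealN => //; exact: prime_ideal.
(* Cramer's rule: multiplication by the adjugate. *)
move=> j; have -> : \det M * g j = (\adj M *m (M *m G)) j 0.
  by rewrite mulmxA mul_adj_mx mul_scalar_mx !mxE.
by rewrite mxE; apply: ideal_sum => // i _; apply: is_idealMl.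
Qed.

(** * Maximal members of families of ideals *)

Section Noetherian.
Hypothesis noethA : is_noetherian A.

Lemma total_seq_cover (G : set (set A)) (s : seq A) :
  total_on G subset -> G !=set0 -> (forall x, x \in s -> exists2 X, G X & X x) ->
  exists2 X, G X & forall x, x \in s -> X x.
Proof.
move=> tot [X0 GX0]; elim: s => [|x s IH] h; first by exists X0.
have [|X GX hX] := IH; first by move=> y ys; apply: h; rewrite inE ys orbT.
have [Y GY hY] := h x (mem_head _ _).
case: (tot X Y GX GY) => sXY; [exists Y|exists X] => // y; rewrite inE => /orP[/eqP ->|ys].
- by [].
- exact/sXY/hX.
- exact: sXY.
- exact: hX.
Qed.

(** Zorn's lemma: the union of a chain of ideals is finitely generated, and its generators already
    lie in one member of the chain. *)
Lemma noetherian_max (F : set (set A)) : F !=set0 -> (forall I, F I -> is_ideal I) ->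
  exists2 I, F I & forall J, F J -> I `<=` J -> J `<=` I.
Proof.
move=> [I0 FI0] hF.
(* The empty set is adjoined because Zorn's lemma also asks for the union of the empty chain. *)
have [|I [hI maxI]] := @Zorn_bigcup A (F `|` [set set0]).
  move=> G hG totG; have [[X0 GX0 FX0]|none] := pselect (exists2 X, G X & F X); last first.
    right; rewrite /= -subset0 => x [X GX Xx].
    by case: (hG X GX) => [FX|/= X0]; [case: none; exists X|move: Xx; rewrite X0].
  left; set U := \bigcup_(X in G) X.
  have Uid (Z : set A) : G Z -> Z !=set0 -> is_ideal Z.
    by move=> GZ [z Zz]; case: (hG Z GZ) => [/hF //|/= Z0]; move: Zz; rewrite Z0.
  have hU : is_ideal U.
    split; first by exists X0 => //; apply: is_ideal0; apply: hF.
    - move=> x y [X GX Xx] [Y GY Yy].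
      have cov (Z : set A) : G Z -> Z x -> Z y -> U (x + y).
        by move=> GZ Zx Zy; exists Z => //; apply: is_idealD => //; apply: Uid => //; exists x.
      case: (totG X Y GX GY) => sXY; first by apply: (cov Y) => //; apply: sXY.
      by apply: (cov X) => //; apply: sXY.
    - by move=> a x [X GX Xx]; exists X => //; apply: is_idealMl => //; apply: Uid => //; exists x.
  have [s es] := noethA hU.
  (* Adding 0 to the generators ensures that the member found is not the adjoined empty set. *)
  have [|x|X GX hX] := @total_seq_cover G (0 :: s) totG; first by exists X0.
    rewrite inE => /orP[/eqP ->|xs]; first by exists X0 => //; apply: is_ideal0; apply: hF.
    have : U x by rewrite es; apply: generator_ideal_gen.
    by case=> X GX Xx; exists X.
  have X0' := hX 0 (mem_head _ _).
  suff -> : U = X.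
    by case: (hG X GX) => // /= e; move: X0'; rewrite e.
  apply/seteqP; split; last by move=> x Xx; exists X.
  rewrite es; apply: ideal_gen_sub; first by apply: Uid => //; exists 0.
  by move=> x xs; apply: hX; rewrite inE xs orbT.
have FI : F I.
  case: hI => // /= e; case: (maxI I0) => //; last by left.
  rewrite e; split; first exact: sub0set.
  by move=> /(_ 0); apply; apply: is_ideal0; apply: hF.
exists I => // J FJ sIJ; apply: contrapT => nJI.
by case: (maxI J); [split|left].
Qed.

(** The generators are found inside [S]: an ideal maximal among those generated by finite subsets of
    [S] absorbs every element of [S]. *)
Lemma noetherian_gen S : exists s : seq A, (forall x, x \in s -> S x) /\
  ideal_gen S = ideal_gen [set` s].
Proof.
have [||I [s [hs ->]] maxI] := @noetherian_max
   [set I | exists s : seq A, (forall x, x \in s -> S x) /\ I = ideal_gen [set` s]].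
- by exists (ideal_gen [set` [::]]), [::].
- by move=> I [s [_ ->]]; apply: ideal_gen_ideal.
exists s; split=> //; apply/seteqP; split; last exact: ideal_gen_mono.
apply: ideal_gen_sub; first exact: ideal_gen_ideal.
move=> x Sx; apply: (maxI (ideal_gen [set` x :: s])).
- exists (x :: s); split=> // y; rewrite inE => /orP[/eqP ->|] //; exact: hs.
- by apply: ideal_gen_mono => y /= ys; rewrite inE ys orbT.
- by apply: generator_ideal_gen; rewrite /= inE eqxx.
Qed.

(** For an increasing sequence this is the ascending chain condition. *)
Lemma noetherian_stable (I : nat -> set A) : (forall n, is_ideal (I n)) ->
  exists n, forall m, I n `<=` I m -> I m `<=` I n.
Proof.
move=> hI; have [||_ [n ->] maxI] := @noetherian_max [set J | exists n, J = I n].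
- by exists (I 0%N), 0%N.
- by move=> _ [n ->].
by exists n => m; apply: maxI; exists m.
Qed.

Lemma saturation_uniform P I J : is_prime_ideal P -> is_ideal I -> is_ideal J ->
  J `<=` saturation P I -> exists2 t, ~ P t & forall x, J x -> I (t * x).
Proof.
move=> hP hI hJ sub; have [s es] := noethA hJ; rewrite es; apply: saturation_seq => //.
by move=> x xs; apply: sub; rewrite es; apply: generator_ideal_gen.
Qed.

(** * Descending chains at a minimal prime *)

Section PrincipalIdealTheorem.
Variable P : set A.
Hypothesis primeP : is_prime_ideal P.

(* Descending chain condition, after localization at P, for the ideals        *)
(* between J and K.                                                           *)
Definition local_dcc J K : Prop := forall I : nat -> set A,
  (forall n, is_ideal (I n)) -> (forall n m, (n <= m)%N -> I m `<=` I n) ->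
  (forall n, J `<=` I n) -> I 0%N `<=` K ->
  exists n, forall m, (n <= m)%N -> I n `<=` saturation P (I m).

(** Since P multiplies g into K, the quotient of K + (g) by K is, at P, a vector space of dimension
    at most one over the residue field; it adds at most one step to a chain. *)
Lemma local_dcc_adjoin J K g : is_ideal K -> J `<=` K ->
  (forall a, P a -> K (a * g)) -> local_dcc J K ->
  local_dcc J (ideal_add K (principal g)).
Proof.
move=> hK sJK hg dccK I hI decI sJI sIK.
have [n hn] : exists n, forall m, (n <= m)%N -> I n `&` K `<=` saturation P (I m `&` K).
  apply: dccK.
  - by move=> n; apply: ideal_setI.
  - by move=> n m le x [/(decI _ _ le) ? ?].
  - by move=> n x Jx; split; [apply: sJI|apply: sJK].
  - by move=> x [].
(* Either the chain enters K, or every term contains an element c g + k with c outside P. *)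
have [[m le sIm]|none] := pselect (exists2 m, (n <= m)%N & I m `<=` K).
  exists m => p le' x Ix; have [|s ns [hs _]] := hn p (leq_trans le le') x; last by exists s.
  by split; [apply: decI Ix|apply: sIm].
exists n => m le x Ix.
have [y [Iy [c [k [nc Kk ey]]]]] : exists y, I m y /\ exists c k, [/\ ~ P c, K k & y = c * g + k].
  apply: contrapT => hno; apply: none; exists m => // y Iy; apply: contrapT => nKy.
  apply: hno; exists y; split=> //.
  have [k [_ [Kk [c ->] ey]]] := sIK _ (decI _ _ (leq0n m) _ Iy).
  exists c, k; split=> //; last by rewrite addrC.
  by move=> Pc; apply: nKy; rewrite ey; apply: is_idealD => //; apply: hg.
have [k' [_ [Kk' [c' ->] ex]]] := sIK _ (decI _ _ (leq0n n) _ Ix).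
(* This combination eliminates g, so it lies in K, where the chain is known to be stationary. *)
have [|s ns [hs _]] := hn m le (c * x - c' * y).
  split; first by apply: is_idealB => //; apply: is_idealMl => //; apply: decI Iy.
  have -> : c * x - c' * y = c * k' - c' * k by rewrite ex ey; ring.
  by apply: is_idealB => //; apply: is_idealMl.
exists (s * c); first exact: primeM.
rewrite -(subrK (s * (c' * y)) (s * c * x)); apply: is_idealD => //; last first.
  by apply: is_idealMl => //; apply: is_idealMl.
by rewrite -mulrA -mulrBr.
Qed.

(** The localization of A/J at P is artinian. Take K maximal such that the chain condition holds
    from J to K. If K were inside P, an associated prime of A/K inside P would contain J, hence
    equal P by minimality, and K could be enlarged by [local_dcc_adjoin]. *)
Lemma local_dcc_minimal_prime J : is_ideal J ->
  (forall T, is_prime_ideal T -> J `<=` T -> T `<=` P -> P `<=` T) -> J `<=` P ->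
  local_dcc J setT.
Proof.
move=> hJ minP sJP.
have hPi := prime_ideal primeP.
have [||K [hK sJK dccK] maxK] := @noetherian_max
  [set K | [/\ is_ideal K, J `<=` K & local_dcc J K]].
- exists J; split=> // I hI decI sJI sIJ; exists 0%N => m _ x /sIJ /sJI Ix.
  exact: sub_saturation.
- by move=> K [].
(* If K is not inside P, it is the unit ideal at P, and intersecting a chain with K changes nothing
   there. *)
have [sKP|/existsNP[s /not_implyP[Ks ns]]] := pselect (K `<=` P); last first.
  move=> I hI decI sJI _.
  have [||||n hn] := dccK (fun n => I n `&` K).
  - by move=> n; apply: ideal_setI.
  - by move=> n m le x [/(decI _ _ le) ? ?].
  - by move=> n x Jx; split; [apply: sJI|apply: sJK].
  - by move=> x [].
  exists n => m le x Ix; have [|t nt [ht _]] := hn m le (s * x).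
    by split; [apply: is_idealMl|apply: is_idealMr].
  by exists (t * s); [apply: primeM|rewrite -mulrA].
exfalso.
pose sat := saturation P K.
have hsat : is_ideal sat by apply: saturation_ideal.
have [||_ [g ng ->] maxT] := @noetherian_max
  [set T | exists2 g, ~ sat g & T = [set a | sat (a * g)]].
- exists [set a | sat (a * 1)]; exists 1 => // -[s ns]; rewrite mulr1 => /sKP; exact: ns.
- by move=> _ [g _ ->]; apply: ideal_colon.
set T := [set a | sat (a * g)] in maxT.
(* A maximal annihilator of a nonzero class is prime. *)
have hT : is_prime_ideal T.
  split; [exact: ideal_colon|by rewrite /T /= mul1r|move=> a b Tab].
  have [Ta|nTa] := pselect (T a); [by left|right].
  apply: (maxT [set c | sat (c * (a * g))]); first by exists (a * g).
    by move=> c Tc; rewrite /= mulrCA; apply: is_idealMl.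
  by rewrite /= mulrA (mulrC b).
have sPT : P `<=` T.
  apply: minP => // [a Ja|a Ta].
    by apply: is_idealMr => //; apply: sub_saturation => //; apply: sJK.
  apply: contrapT => na; apply: ng; case: Ta => s ns; rewrite mulrA => Ks.
  by exists (s * a) => //; apply: primeM.
have [t nt ht] : exists2 t, ~ P t & forall a, P a -> K (t * (a * g)).
  have [||||t nt ht] := @saturation_uniform P K (ideal_mul P (principal g)).
  - by [].
  - by [].
  - exact: ideal_mul_ideal.
  - apply: ideal_gen_sub => // x [a [_ [Pa [c ->] ->]]].
    by rewrite mulrCA; apply: is_idealMl => //; apply: sPT.
  exists t => // a Pa; apply: ht; apply: generator_ideal_gen.
  by exists a, g; split=> //; apply: principal_id.
apply: ng; exists t => //.
apply: (maxK (ideal_add K (principal (t * g)))).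
- split; first exact: ideal_add_ideal (principal_ideal _).
    by move=> x /sJK; apply: ideal_addl; apply: principal_ideal.
  apply: local_dcc_adjoin => // a Pa; rewrite mulrCA; exact: ht.
- by apply: ideal_addl; apply: principal_ideal.
- by apply: ideal_addr => //; apply: principal_id.
Qed.

End PrincipalIdealTheorem.

(** * Krull's principal ideal theorem *)

Section KrullPIT.
Variables (Q0 Q P : set A) (x : A).
Hypotheses (pQ0 : is_prime_ideal Q0) (pQ : is_prime_ideal Q) (pP : is_prime_ideal P).
Hypotheses (sQ0Q : Q0 `<=` Q) (sQP : Q `<=` P) (Px : P x) (nQx : ~ Q x).

(** The n-th symbolic power of Q/Q0, pulled back from A/Q0 to A. *)
Definition symbolic_power n : set A :=
  saturation Q (ideal_add (ideal_exp Q n) Q0).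

Let hQ0 := prime_ideal pQ0.
Let hQ := prime_ideal pQ.
Let hsum n : is_ideal (ideal_add (ideal_exp Q n) Q0).
Proof. by apply: ideal_add_ideal => //; apply: ideal_exp_ideal. Qed.

Lemma symbolic_power_ideal n : is_ideal (symbolic_power n).
Proof. exact: saturation_ideal. Qed.

Lemma symbolic_power_dec n : symbolic_power n.+1 `<=` symbolic_power n.
Proof.
apply: saturation_mono => _ [a [b [ha hb ->]]]; exists a, b; split=> //.
move: ha; apply: ideal_gen_sub; first exact: ideal_exp_ideal.
by move=> _ [c [d [_ hd ->]]]; apply: is_idealMl => //; apply: ideal_exp_ideal.
Qed.

Lemma symbolic_power_decl n m : (n <= m)%N -> symbolic_power m `<=` symbolic_power n.
Proof.
move=> /subnKC <-; elim: (m - n)%N => [|d IH]; first by rewrite addn0.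
by rewrite addnS => y /symbolic_power_dec; apply: IH.
Qed.

Lemma sub_symbolic_power n : Q0 `<=` symbolic_power n.
Proof.
move=> a Qa; apply: sub_saturation => //; apply: ideal_addr => //; exact: ideal_exp_ideal.
Qed.

Lemma symbolic_powerMK n a : symbolic_power n (a * x) -> symbolic_power n a.
Proof.
by case=> s ns hs; exists (s * x); [apply: primeM|rewrite -mulrA (mulrC x)].
Qed.

(** Nakayama's lemma at Q makes the n-th power of Q vanish modulo Q0 after localization; as Q0 is
    prime, Q itself lies in Q0. *)
Lemma symbolic_power_stable_eq0 n :
  symbolic_power n `<=` symbolic_power n.+1 -> Q `<=` Q0.
Proof.
move=> stab.
have [t nt ht] : exists2 t, ~ Q t &
    forall a, ideal_exp Q n a -> ideal_add (ideal_exp Q n.+1) Q0 (t * a).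
  apply: saturation_uniform => //; first exact: ideal_exp_ideal.
  move=> a ha; apply: stab; apply: sub_saturation => //; exact: ideal_addl.
have [s es] := noethA (ideal_exp_ideal Q n).
have gs i : ideal_exp Q n (nth 0 s i).
  have [lt|ge] := ltnP i (size s); last by rewrite nth_default //; apply: is_ideal0; apply: ideal_exp_ideal.
  by rewrite es; apply: generator_ideal_gen; rewrite /= mem_nth.
have expE a : ideal_exp Q n.+1 a ->
    exists c : 'I_(size s) -> A, (forall i, Q (c i)) /\ a = \sum_i c i * s`_i.
  move: a; apply: ideal_gen_sub.
    split.
    - exists (fun=> 0); split=> [i|]; first exact: is_ideal0.
      by rewrite big1 // => i _; rewrite mul0r.
    - move=> _ _ [c [hc ->]] [d [hd ->]]; exists (fun i => c i + d i); split=> [i|].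
        exact: is_idealD.
      by rewrite -big_split; apply: eq_bigr => i _; rewrite mulrDl.
    - move=> b _ [c [hc ->]]; exists (fun i => b * c i); split=> [i|]; first exact: is_idealMl.
      by rewrite mulr_sumr; apply: eq_bigr => i _; rewrite mulrA.
  move=> _ [b [d [Qb hd ->]]]; have : ideal_exp Q n d by []; rewrite es => /ideal_gen_seqP[c ->].
  exists (fun i => b * c i); split=> [i|]; first exact: is_idealMr.
  by rewrite mulr_sumr; apply: eq_bigr => i _; rewrite mulrA.
have /choice[C hC] : forall i : 'I_(size s), exists c : 'I_(size s) -> A,
    (forall j, Q (c j)) /\ Q0 (t * s`_i - \sum_j c j * s`_j).
  move=> i; have [a [b [/expE[c [hc ->]] Qb ->]]] := ht _ (gs i).
  by exists c; split=> //; rewrite addrAC subrr add0r.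
have [d nd hd] := @nakayama Q Q0 (size s) (fun i => s`_i) C t pQ hQ0 nt
  (fun i j => (hC i).1 j) (fun i => (hC i).2).
have n0d : ~ Q0 d by move/sQ0Q.
have sn : ideal_exp Q n `<=` Q0.
  rewrite es; apply: ideal_gen_sub => // y /= ys.
  apply: (primeMK pQ0 n0d); have /(nthP 0)[i lt <-] := ys.
  exact: (hd (Ordinal lt)).
move=> a Qa; apply: contrapT => na; apply: (primeX pQ0 na (n := n)).
exact/sn/ideal_expX.
Qed.

(** If P were minimal over Q0 + (x), the ideals Q^(n) + (x) would become stationary at P. As x is
    not in Q, this gives Q^(n) = Q^(n+1) + x Q^(n) there; Nakayama's lemma removes the last summand,
    and Q = Q0 follows. *)
Theorem krull_principal_ideal : ~ Q `<=` Q0 ->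
  exists T, [/\ is_prime_ideal T, Q0 `<=` T, T x, T `<=` P & ~ P `<=` T].
Proof.
move=> nQQ0; apply: contrapT => none; apply: nQQ0.
pose J := ideal_add Q0 (principal x).
have hJ : is_ideal J by apply: ideal_add_ideal => //; apply: principal_ideal.
have dccT : local_dcc P J setT.
  apply: local_dcc_minimal_prime => // [T pT sJT sTP|].
    apply: contrapT => nPT; apply: none; exists T; split=> //.
      by move=> a Qa; apply: sJT; apply: ideal_addl => //; apply: principal_ideal.
    by apply: sJT; apply: ideal_addr => //; apply: principal_id.
  have hP := prime_ideal pP.
  move=> _ [a [_ [Qa [c ->] ->]]]; apply: is_idealD => //; last exact: is_idealMl.
  exact/sQP/sQ0Q.
have [|||//|n hn] := dccT (fun n => ideal_add (symbolic_power n) (principal x)).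
- by move=> n; apply: ideal_add_ideal; [apply: symbolic_power_ideal|apply: principal_ideal].
- move=> n m le _ [a [b [ha hb ->]]]; exists a, b; split=> //; exact: symbolic_power_decl ha.
- by move=> n _ [a [b [ha hb ->]]]; exists a, b; split=> //; apply: sub_symbolic_power.
apply: (@symbolic_power_stable_eq0 n).
have hP := prime_ideal pP.
have [s ns hs] : exists2 s, ~ P s & forall a, symbolic_power n a ->
    ideal_add (symbolic_power n.+1) (principal x) (s * a).
  apply: saturation_uniform => //; [|exact: symbolic_power_ideal|].
    by apply: ideal_add_ideal; [apply: symbolic_power_ideal|apply: principal_ideal].
  move=> a ha; apply: hn => //; apply: ideal_addl => //; exact: principal_ideal.
have [r er] := noethA (symbolic_power_ideal n).
have gr i : symbolic_power n (nth 0 r i).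
  have [lt|ge] := ltnP i (size r).
    by rewrite er; apply: generator_ideal_gen; rewrite /= mem_nth.
  by rewrite nth_default //; apply: is_ideal0; apply: symbolic_power_ideal.
have /choice[C hC] : forall i : 'I_(size r), exists c : 'I_(size r) -> A,
    (forall j, P (c j)) /\ symbolic_power n.+1 (s * r`_i - \sum_j c j * r`_j).
  move=> i; have [a [_ [ha [c ->] e]]] := hs _ (gr i).
  (* c x lies in the symbolic power and x is a unit at Q, so c lies in it; this puts the
     coefficients of the relation into (x), hence into P. *)
  have : symbolic_power n c.
    apply: symbolic_powerMK; have -> : c * x = s * r`_i - a by rewrite e addrAC subrr add0r.
    apply: is_idealB; [exact: symbolic_power_ideal| |exact: symbolic_power_dec].
    by apply: is_idealMl; [apply: symbolic_power_ideal|apply: gr].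
  rewrite {1}er => /ideal_gen_seqP[c' ec]; exists (fun j => x * c' j); split.
    by move=> j; apply: is_idealMr.
  rewrite e ec; have -> : \sum_j x * c' j * r`_j = (\sum_j c' j * r`_j) * x.
    by rewrite mulr_suml; apply: eq_bigr => j _; rewrite [RHS]mulrC mulrA.
  by rewrite addrK.
have [d nd hd] := @nakayama P _ (size r) (fun i => r`_i) C s pP
  (symbolic_power_ideal n.+1) ns (fun i j => (hC i).1 j) (fun i => (hC i).2).
have nQd : ~ Q d by move/sQP.
rewrite {1}er; apply: ideal_gen_sub; first exact: symbolic_power_ideal.
move=> y /= /(nthP 0)[i lt <-]; have [t nt ht] := hd (Ordinal lt).
by exists (t * d); [apply: primeM|rewrite -mulrA].
Qed.

End KrullPIT.

End Noetherian.
End Ideals.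

(** * Krull's height theorem *)

Section Height.
Variable A : comNzRingType.
Hypothesis noethA : is_noetherian A.
Implicit Types (P Q T : set A) (x : A).

Inductive chain_between : nat -> set A -> set A -> Prop :=
| Chain0 P : is_prime_ideal P -> chain_between 0 P P
| ChainS n P Q T : chain_between n P Q -> is_prime_ideal T -> Q `<` T ->
    chain_between n.+1 P T.

Lemma chain_between_prime n P Q : chain_between n P Q -> is_prime_ideal P /\ is_prime_ideal Q.
Proof. by elim=> [P' ?|m P' Q' T _ [? _]]. Qed.

Lemma chain_between_sub n P Q : chain_between n P Q -> P `<=` Q.
Proof. by elim=> [P' ?|m P' Q' T _ sPQ _ [sQT _] x /sPQ /sQT]. Qed.

(** Going down from Q, the principal ideal theorem exchanges each prime that misses x for one that
    contains x, at the cost of one link in total. *)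
Lemma chain_through n P Q x : chain_between n.+1 P Q -> Q x ->
  exists T, [/\ P `<=` T, T x & chain_between n T Q].
Proof.
elim: n Q => [|n IH] Q h; inversion h as [|m P1 Q1 T hc pT ltT]; subst; move=> Qx.
  by exists Q; split; [move=> a /(chain_between_sub hc) /ltT.1| |apply: Chain0].
have [Q1x|nQ1x] := pselect (Q1 x).
  by have [T [sPT Tx hT]] := IH _ hc Q1x; exists T; split=> //; apply: ChainS hT _ _.
inversion hc as [|m Q2 Q0 T hc' pQ1 ltQ1]; subst.
have [_ pQ0] := chain_between_prime hc'.
have [T [pT' sQ0T Tx sTQ nQT]] : exists T, [/\ is_prime_ideal T, Q0 `<=` T, T x, T `<=` Q & ~ Q `<=` T].
  by apply: (krull_principal_ideal noethA pQ0 pQ1 pT) => //; [case: ltQ1|case: ltT|case: ltQ1].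
have [T' [sPT' T'x hT']] : exists T', [/\ P `<=` T', T' x & chain_between n T' T].
  apply: IH => //; apply: ChainS hc' pT' _; split=> // sTQ0.
  by apply: nQ1x; apply: ltQ1.1; apply: sTQ0.
by exists T'; split=> //; apply: ChainS hT' pT _.
Qed.

(** Each generator is moved into the bottom prime by [chain_through] and shortens the chain by one;
    when none is left, minimality of Q allows no link. *)
Theorem krull_height n P Q (s : seq A) : chain_between n P Q ->
  (forall T, is_prime_ideal T -> P `<=` T -> [set` s] `<=` T -> T `<=` Q -> Q `<=` T) ->
  [set` s] `<=` Q -> (n <= size s)%N.
Proof.
elim: s n P => [|x s IH] n P hc minQ ssQ.
  case: n hc => // n h; inversion h as [|m P1 Q1 T hc pT ltT]; subst.
  have [pP _] := chain_between_prime h.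
  case: ltT => sQ1 []; move=> y Qy.
  apply: (chain_between_sub hc); apply: minQ => //; exact: chain_between_sub h.
case: n hc => // n hc.
have Qx : Q x by apply: ssQ; rewrite /= inE eqxx.
have [T [sPT Tx hT]] := chain_through hc Qx.
rewrite ltnS; apply: (IH n T hT) => [T' pT' sTT' ssT' sT'Q|y ys]; last first.
  by apply: ssQ; move: ys; rewrite /= inE => ->; rewrite orbT.
apply: minQ => // [y /sPT /sTT' //|y /=].
by rewrite inE => /orP[/eqP ->|ys]; [apply: sTT'|apply: ssT'].
Qed.

Lemma prime_chain_between d : prime_chain A d ->
  exists P Q, chain_between d P Q.
Proof.
case=> q [hq ltq].
have : forall i : nat, (i <= d)%N -> chain_between i (q ord0) (q (inord i)).
  elim=> [|i IH] le.
    have -> : inord 0 = ord0 :> 'I_d.+1 by apply: val_inj; rewrite /= inordK.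
    exact: Chain0.
  apply: ChainS (IH (ltnW le)) (hq _) _; apply: ltq.
  by rewrite !inordK // ltnS ltnW.
by move=> /(_ d (leqnn d)) h; exists (q ord0), (q (inord d)).
Qed.

Lemma prime_sub_nonunits P : is_prime_ideal P -> P `<=` nonunits A.
Proof.
move=> pP x Px [y e]; apply: (prime1 pP); rewrite -e.
by apply: (is_idealMr _ (prime_ideal pP)).
Qed.

Lemma local_prime : is_local A -> is_prime_ideal (nonunits A).
Proof.
move=> hl; split=> // [|x y nxy]; first by apply; exists 1; rewrite mulr1.
have [[x' ex]|?] := pselect (invertible x); [right|by left].
move=> [y' ey]; apply: nxy; exists (x' * y').
have -> : x * y * (x' * y') = (x * x') * (y * y') by ring.
by rewrite ex ey mulr1.
Qed.

Corollary local_krull_height (s : seq A) e : is_local A ->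
  nonunits A = ideal_gen [set` s] -> prime_chain A e -> (e <= size s)%N.
Proof.
move=> hl es /prime_chain_between[P [Q hc]].
have pm := local_prime hl; have [pP pQ] := chain_between_prime hc.
(* The chain is prolonged to the maximal ideal when it does not end there. *)
have [e' [le hc']] : exists e', (e <= e')%N /\ chain_between e' P (nonunits A).
  have [sm|nsm] := pselect (nonunits A `<=` Q).
    exists e; split=> //; have -> // : nonunits A = Q.
    by apply/seteqP; split=> //; apply: prime_sub_nonunits.
  exists e.+1; split; first exact: leqnSn.
  by apply: ChainS hc pm _; split=> //; apply: prime_sub_nonunits.
apply: (leq_trans le); apply: (krull_height hc') => [T pT _ sT _|].
  by rewrite es; apply: ideal_gen_sub; first exact: prime_ideal.
by move=> y ys; rewrite es; apply: generator_ideal_gen.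
Qed.

End Height.

(** * Krull's intersection theorem *)

Section KrullIntersection.
Variable A : comNzRingType.
Hypotheses (noethA : is_noetherian A) (localA : is_local A).

Let pm := local_prime localA.

Lemma local_unit (x : A) : ~ nonunits A x -> exists y, x * y = 1.
Proof. by move=> /contrapT. Qed.

Lemma local_nakayama (I N : set A) : is_ideal I -> is_ideal N ->
  N `<=` ideal_add I (ideal_mul (nonunits A) N) -> N `<=` I.
Proof.
move=> hI hN sN; have [s es] := noethA hN.
have mulE a : ideal_mul (nonunits A) N a ->
    exists c : 'I_(size s) -> A, (forall i, nonunits A (c i)) /\ a = \sum_i c i * s`_i.
  move: a; apply: ideal_gen_sub.
    split.
    - exists (fun=> 0); split=> [i|]; first exact: is_ideal0.
      by rewrite big1 // => i _; rewrite mul0r.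
    - move=> _ _ [c [hc ->]] [d [hd ->]]; exists (fun i => c i + d i); split=> [i|].
        exact: is_idealD.
      by rewrite -big_split; apply: eq_bigr => i _; rewrite mulrDl.
    - move=> b _ [c [hc ->]]; exists (fun i => b * c i); split=> [i|]; first exact: is_idealMl.
      by rewrite mulr_sumr; apply: eq_bigr => i _; rewrite mulrA.
  move=> _ [b [d [Qb Nd ->]]]; move: Nd; rewrite es => /ideal_gen_seqP[c ->].
  exists (fun i => b * c i); split=> [i|]; first exact: is_idealMr.
  by rewrite mulr_sumr; apply: eq_bigr => i _; rewrite mulrA.
have /choice[C hC] : forall i : 'I_(size s), exists c : 'I_(size s) -> A,
    (forall j, nonunits A (c j)) /\ I (1 * s`_i - \sum_j c j * s`_j).
  move=> i; have : N s`_i by rewrite es; apply: generator_ideal_gen; rewrite /= mem_nth.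
  move/sN => [a [_ [Ia /mulE[c [hc ->]] ->]]].
  by exists c; split=> //; rewrite mul1r addrK.
have [d nd hd] := nakayama pm hI (prime1 pm) (fun i j => (hC i).1 j) (fun i => (hC i).2).
have [d' ed] := local_unit nd.
rewrite es; apply: ideal_gen_sub => // y /= /(nthP 0)[i lt <-].
have -> : s`_i = d * s`_i * d' by rewrite mulrAC ed mul1r.
by apply: (is_idealMr _ hI); apply: (hd (Ordinal lt)).
Qed.

(* The classical argument of Krull: an ideal K containing I and m N and       *)
(* maximal for K :&: N = I + m N contains a power of m.                       *)
Theorem krull_intersection (I : set A) (F : nat -> set A) :
  is_ideal I -> (forall n, is_ideal (F n)) -> (forall n, I `<=` F n) ->
  (forall K, is_ideal K -> (forall x, nonunits A x -> exists n, K (x ^+ n)) ->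
     I `<=` K -> exists n, F n `<=` K) ->
  forall x, (forall n, F n x) -> I x.
Proof.
move=> hI hF sIF cofF; set N : set A := [set x | forall n, F n x].
have hN : is_ideal N.
  split; first by move=> n; apply: is_ideal0.
    by move=> x y hx hy n; apply: is_idealD.
  by move=> a x hx n; apply: is_idealMl.
have sIN : I `<=` N by move=> x Ix n; apply: sIF.
apply: local_nakayama => //.
set L := ideal_add _ _.
have hmN := ideal_mul_ideal (nonunits A) N.
have hL : is_ideal L by apply: ideal_add_ideal.
have sLN : L `<=` N.
  move=> _ [a [b [Ia hb ->]]]; apply: (is_idealD hN); first exact: sIN.
  move: b hb; apply: (ideal_gen_sub hN) => _ [c [d [_ Nd ->]]].
  exact: (is_idealMl _ hN).
have [||K [hK sLK KN] maxK] := @noetherian_max _ noethA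
  [set K | [/\ is_ideal K, L `<=` K & K `&` N `<=` L]].
- by exists L; split=> // x [].
- by move=> K [].
have sIK : I `<=` K by move=> x Ix; apply: sLK; apply: ideal_addl.
have [x mx|n sFK] := cofF K hK _ sIK; last by move=> x Nx; apply: KN; split=> //; apply: sFK.
(* The ideals (K : x^n) increase with n, so they become stationary. *)
have [n hn] := @noetherian_stable _ noethA (fun n => [set a | K (a * x ^+ n)])
  (fun n => ideal_colon _ hK).
exists n; apply: (maxK (ideal_add K (principal (x ^+ n)))).
- split; first exact: ideal_add_ideal (principal_ideal _).
    by move=> y /sLK; apply: ideal_addl; apply: principal_ideal.
  move=> _ [[a [_ [Ka [b ->] ->]]] Nab]; apply: KN; split=> //.
  (* x times the given element is in m N, hence in K; so b is in (K : x^(n+1)) = (K : x^n). *)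
  apply: is_idealD => //; apply: (hn n.+1).
    by move=> c /= Kc; rewrite exprS mulrCA; apply: is_idealMl.
  rewrite /= exprS mulrCA; rewrite -(addKr (x * a) (x * _)) -mulrDr.
  apply: is_idealD => //; first by apply: is_idealN => //; apply: is_idealMl.
  apply: sLK; apply: ideal_addr => //; apply: generator_ideal_gen.
  by exists x, (a + b * x ^+ n).
- by apply: ideal_addl; apply: principal_ideal.
- by apply: ideal_addr => //; apply: principal_id.
Qed.

End KrullIntersection.

(** * Hilbert's basis theorem *)

Section HilbertBasis.

Lemma noetherian_surj (A B : comNzRingType) (f : {rmorphism A -> B}) :
  (forall b, exists a, f a = b) -> is_noetherian A -> is_noetherian B.
Proof.
move=> surj noethA I hI.
have hJ : is_ideal [set a | I (f a)].
  split=> /=; first by rewrite rmorph0; apply: is_ideal0.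
    by move=> x y; rewrite rmorphD; apply: is_idealD.
  by move=> a x; rewrite rmorphM; apply: is_idealMl.
have [s es] := noethA _ hJ.
exists (map f s); apply/seteqP; split; last first.
  apply: ideal_gen_sub => // _ /= /mapP[a as_ ->].
  suff : [set a | I (f a)] a by [].
  by rewrite es; apply: generator_ideal_gen.
move=> b; have [a <-] := surj b => Ia.
have : [set a | I (f a)] a by [].
rewrite es => /ideal_gen_seqP[c ->]; rewrite rmorph_sum; apply: ideal_sum => [|i _].
  exact: ideal_gen_ideal.
rewrite rmorphM; apply: is_idealMl; first exact: ideal_gen_ideal.
by apply: generator_ideal_gen; rewrite /= map_f // mem_nth.
Qed.

Theorem hilbert_basis (A : comNzRingType) : is_noetherian A -> is_noetherian {poly A}.
Proof.
move=> noethA I hI.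
(* The ideal of coefficients of degree d of the polynomials in I of degree at most d; it grows with
   d and is constant from some [D] on. *)
pose L d : set A := [set c | exists p : {poly A}, [/\ I p, (size p <= d.+1)%N & c = p`_d]].
have hL d : is_ideal (L d).
  split.
  - by exists 0; split; [apply: is_ideal0|rewrite size_poly0|rewrite coef0].
  - move=> _ _ [p [Ip sp ->]] [q [Iq sq ->]]; exists (p + q); split.
    + exact: is_idealD.
    + by apply: leq_trans (size_polyD _ _) _; rewrite geq_max sp.
    + by rewrite coefD.
  - move=> a _ [p [Ip sp ->]]; exists (a%:P * p); split.
    + exact: is_idealMl.
    + by rewrite mul_polyC; apply: leq_trans (size_scale_leq _ _) _.
    + by rewrite coefCM.
have incL d m : (d <= m)%N -> L d `<=` L m.
  move=> /subnK <- _ [p [Ip sp ->]]; exists ('X^(m - d) * p); split.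
  - exact: is_idealMl.
  - apply: leq_trans (size_polyMleq _ _) _; rewrite size_polyXn addSn /= -addnS.
    by rewrite leq_add2l.
  - by rewrite coefXnM ltnNge leq_addr /= addKn.
have [D hD] := noetherian_stable noethA hL.
(* [S d] is a finite set of polynomials in I, combinations of which cancel the coefficient of degree
   d. *)
have /choice[S hS] : forall d, exists s : seq {poly A},
   (forall p, p \in s -> I p /\ (size p <= d.+1)%N) /\
   (forall p, I p -> (size p <= d.+1)%N ->
      exists q, ideal_gen [set` s] q /\ (size (p - q)%R <= d)%N).
  move=> d; have [s es] := noethA _ (hL d).
  have /choice[g hg] : forall c, exists p : {poly A}, c \in s -> [/\ I p, (size p <= d.+1)%N & c = p`_d].
    move=> c; have [cs|ncs] := boolP (c \in s); last by exists 0.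
    have : L d c by rewrite es; apply: generator_ideal_gen.
    by case=> p ?; exists p.
  exists (map g s); split=> [_ /mapP[c cs ->]|p Ip sp]; first by case: (hg c cs).
  have : L d p`_d by exists p.
  rewrite es => /ideal_gen_seqP[a ea].
  have gi (i : 'I_(size s)) := hg s`_i (mem_nth 0 (ltn_ord i)).
  exists (\sum_i (a i)%:P * g s`_i); split.
    apply: ideal_sum => [|i _]; first exact: ideal_gen_ideal.
    apply: is_idealMl; first exact: ideal_gen_ideal.
    by apply: generator_ideal_gen; rewrite /= map_f // mem_nth.
  apply/leq_sizeP => j; rewrite leq_eqVlt => /orP[/eqP <-|lt]; rewrite coefB coef_sum.
    rewrite ea; apply/eqP; rewrite subr_eq0; apply/eqP/eq_bigr => i _.
    by rewrite coefCM; case: (gi i) => _ _ <-.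
  rewrite nth_default ?(leq_trans sp) // big1 ?subr0 // => i _.
  by rewrite coefCM nth_default ?mulr0 //; case: (gi i) => _ h _; apply: leq_trans lt.
pose s := flatten [seq S d | d <- iota 0 D.+1].
have sS d : (d <= D)%N -> ideal_gen [set` S d] `<=` ideal_gen [set` s].
  move=> le; apply: ideal_gen_mono => p /= ps; apply/flattenP; exists (S d) => //.
  by apply: map_f; rewrite mem_iota add0n ltnS.
have hs := @ideal_gen_ideal _ [set` s].
exists s; apply/seteqP; split; last first.
  apply: ideal_gen_sub => // p /= /flattenP[_ /mapP[d _ ->] ps].
  by case: (hS d) => /(_ p ps)[].
suff main n p : I p -> (size p <= n)%N -> ideal_gen [set` s] p.
  by move=> p Ip; apply: (main (size p)).
elim: n p => [|n IH] p Ip sp.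
  by move: sp; rewrite leqn0 size_poly_eq0 => /eqP ->; apply: is_ideal0.
have [q [gq sq]] : exists q, ideal_gen [set` s] q /\ (size (p - q)%R <= n)%N.
  have [le|gt] := leqP n D.
    have [_ /(_ p Ip sp)[q [gq sq]]] := hS n; exists q; split=> //; exact: sS gq.
  (* Beyond degree [D], the leading coefficient already occurs in degree [D] and the cancelling
     polynomial is shifted by a power of X. *)
  have [p' [Ip' sp' ep']] : L D p`_n by apply: (hD n); [apply/incL/ltnW|exists p].
  have [_ /(_ p' Ip' sp')[q [gq sq]]] := hS D.
  exists ('X^(n - D) * q); split; first by apply: is_idealMl => //; apply: sS gq.
  have -> : p - 'X^(n - D) * q = (p - 'X^(n - D) * p') + 'X^(n - D) * (p' - q) by ring.
  apply: leq_trans (size_polyD _ _) _; rewrite geq_max; apply/andP; split.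
    apply/leq_sizeP => j; rewrite leq_eqVlt => /orP[/eqP <-|lt]; rewrite coefB coefXnM.
      by rewrite ltnNge leq_subr /= subKn ?(ltnW gt) // ep' subrr.
    rewrite nth_default ?(leq_trans sp) //; case: ifP => [|_]; rewrite ?subrr ?sub0r //.
    rewrite nth_default ?oppr0 //; apply: leq_trans sp' _.
    by rewrite ltn_subRL subnK // ltnW.
  apply: leq_trans (size_polyMleq _ _) _; rewrite size_polyXn addSn /=.
  by apply: leq_trans (leq_add (leqnn _) sq) _; rewrite subnK // ltnW.
rewrite -(subrK q p); apply: is_idealD => //; apply: IH => //.
apply: is_idealB => //; move: gq; apply: ideal_gen_sub => // r /= /flattenP[_ /mapP[d _ ->] rs].
by case: (hS d) => /(_ r rs)[].
Qed.

End HilbertBasis.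

(** * Polynomials in several variables and Dickson's lemma *)

Section MultivariatePolynomials.

Lemma mpoly_alg_ind (A : comNzRingType) n (C : {mpoly A[n]} -> Prop) :
  (forall c, C c%:MP) -> (forall i, C 'X_i) ->
  (forall p q, C p -> C q -> C (p + q)) -> (forall p q, C p -> C q -> C (p * q)) ->
  forall p, C p.
Proof.
move=> CC CX CD CM p; rewrite [p]mpolyE; elim/big_ind: _ => [||m _]; [|exact: CD|].
  by rewrite -(mpolyC0 n A).
rewrite -mul_mpolyC; apply: (CM) => //; rewrite mpolyXE_id.
elim/big_ind: _ => [||i _]; [by rewrite -(mpolyC1 n A)|exact: (CM)|].
elim: (m i) => [|d IH]; first by rewrite expr0 -(mpolyC1 n A).
by rewrite exprS; apply: (CM).
Qed.

Theorem noetherian_mpoly (A : comNzRingType) n :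
  is_noetherian A -> is_noetherian {mpoly A[n]}.
Proof.
move=> noethA; elim: n => [|n IH].
  apply: (noetherian_surj (f := mpolyC 0%N (R := A))) noethA.
  apply: mpoly_alg_ind => [c|[]//|p q [a <-] [b <-]|p q [a <-] [b <-]].
  - by exists c.
  - by exists (a + b); rewrite rmorphD.
  - by exists (a * b); rewrite rmorphM.
pose f : {rmorphism {poly {mpoly A[n]}} -> {mpoly A[n.+1]}} :=
  horner_eval ('X_ord_max : {mpoly A[n.+1]}) \o map_poly (@mwiden n A).
apply: (noetherian_surj (f := f)) (hilbert_basis IH).
apply: mpoly_alg_ind => [c|i|p q [a <-] [b <-]|p q [a <-] [b <-]].
- by exists (c%:MP)%:P; rewrite /f /= map_polyC /horner_eval hornerC /= mwidenC.
- have [lt|] := ltnP i n.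
    exists ('X_(Ordinal lt))%:P; rewrite /f /= map_polyC /horner_eval hornerC /=.
    by rewrite mwidenX mnmwiden1; congr 'X_[U_(_)]; apply: val_inj.
  move=> ge; exists 'X; rewrite /f /= map_polyX /horner_eval hornerX.
  by congr 'X_[U_(_)]; apply: val_inj; apply/eqP; rewrite eqn_leq ge -ltnS ltn_ord.
- by exists (a + b); rewrite rmorphD.
- by exists (a * b); rewrite rmorphM.
Qed.

Lemma noetherian_field (F : fieldType) : is_noetherian F.
Proof.
move=> I hI; have [[x [Ix x0]]|none] := pselect (exists x, I x /\ x != 0).
  exists [:: 1]; apply/seteqP; split=> [y _|y _].
    rewrite -[y]mulr1; apply: is_idealMl; first exact: ideal_gen_ideal.
    by apply: generator_ideal_gen; rewrite /= inE.
  by rewrite -[y](mulfVK x0); apply: is_idealMl.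
exists [::]; apply/seteqP; split=> [y Iy|y /ideal_gen_seqP[a ->]]; last first.
  by rewrite big_ord0; apply: is_ideal0.
have [->|y0] := eqVneq y 0; first by apply: is_ideal0; apply: ideal_gen_ideal.
by case: none; exists y.
Qed.

(* Noetherianity of polynomial rings, applied to a monomial ideal. *)
Theorem dickson n (D : set 'X_{1..n}) : exists s : seq 'X_{1..n},
  (forall m, m \in s -> D m) /\ (forall m, D m -> exists2 q, q \in s & (q <= m)%MM).
Proof.
have noethQ := @noetherian_mpoly _ n (@noetherian_field rat).
have [r [hr er]] := noetherian_gen noethQ [set p : {mpoly rat[n]} | exists2 m, D m & p = 'X_[m]].
have /choice[f hf] : forall p, exists m : 'X_{1..n}, p \in r -> D m /\ p = 'X_[m].
  move=> p; have [pr|npr] := boolP (p \in r); last by exists 0%MM.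
  by have [m Dm ep] := hr p pr; exists m.
exists (map f r); split=> [_ /mapP[p pr ->]|m Dm]; first by case: (hf p pr).
have : ideal_gen [set` r] ('X_[m] : {mpoly rat[n]}).
  by rewrite -er; apply: generator_ideal_gen; exists m.
move=> /ideal_gen_seqP[a /(congr1 (fun p => p@_m))].
rewrite mcoeffX eqxx raddf_sum /= => e.
(* Some summand contributes the monomial m, and the monomial generating that summand divides m. *)
have [i hi] : exists i : 'I_(size r), (a i * r`_i)@_m != 0.
  apply: contrapT => none; move/eqP: e; rewrite big1 ?oner_eq0 // => i _.
  by apply/eqP; apply: contrapT => h; apply: none; exists i; apply/negP.
have ri : r`_i \in r by rewrite mem_nth.
exists (f r`_i); first exact: map_f.
apply: contrapT => /negP nle; move/negP: hi; apply.
have [_ ->] := hf _ ri; apply/eqP.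
rewrite mcoeffM big1 // => -[q1 q2] /= /eqP em; rewrite mcoeffX.
case: eqP => [eq|_]; rewrite ?mulr0 //; case/negP: nle.
by move: (lem_addl q1 q2); rewrite -em eq.
Qed.

End MultivariatePolynomials.

(** * Weights and valuations *)

Section OrderedGroups.
Variable Phi : oagType.
Implicit Types x y z : Phi.

Lemma oag_ltNge x y : (x < y) = ~~ (y <= x).
Proof.
apply/idP/idP => [lt|nle]; first by rewrite lt_geF.
rewrite lt_neqAle; have [e|_] /= := eqVneq x y; first by rewrite e lexx in nle.
by case/orP: (oag_le_total x y) => // h; rewrite h in nle.
Qed.

Lemma oag_leNgt x y : (x <= y) = ~~ (y < x).
Proof. by rewrite oag_ltNge negbK. Qed.

Lemma oag_leD2rE z x y : (x + z <= y + z) = (x <= y).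
Proof.
apply/idP/idP => [h|]; last exact: oag_leD2r.
by have := oag_leD2r (- z) _ _ h; rewrite !addrK.
Qed.

Lemma oag_subr_ge0 x y : (0 <= y - x) = (x <= y).
Proof. by rewrite -(oag_leD2rE x 0) add0r subrK. Qed.

Lemma oag_mulrn_ge0 x n : 0 <= x -> 0 <= x *+ n.
Proof. by move=> hx; elim: n => // n IH; rewrite mulrS oag_addr_ge0. Qed.

Lemma oag_mulrn_gt0 x n : 0 < x -> (0 < n)%N -> 0 < x *+ n.
Proof.
move=> hx; case: n => // n _; rewrite mulrSr -[0]add0r.
by apply: oag_le_ltD => //; apply/oag_mulrn_ge0/ltW.
Qed.

Lemma oag_sum_ge0 (I : Type) (r : seq I) (C : pred I) (F : I -> Phi) :
  (forall i, C i -> 0 <= F i) -> 0 <= \sum_(i <- r | C i) F i.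
Proof.
by move=> h; elim/big_ind: _ => // x y; apply: oag_addr_ge0.
Qed.

End OrderedGroups.

Lemma total_seq_min (T : eqType) (R : rel T) (s : seq T) : total R -> transitive R ->
  s != [::] -> exists2 m, m \in s & forall q, q \in s -> R m q.
Proof.
move=> tot tr; elim: s => // x s IH _; have [->|/IH[m ms hm]] := eqVneq s [::].
  exists x; rewrite ?mem_head // => q; rewrite inE => /eqP ->.
  by case/orP: (tot x x).
case/orP: (tot x m) => h.
  exists x; rewrite ?mem_head // => q; rewrite inE => /orP[/eqP ->|/hm hq].
    by case/orP: (tot x x).
  exact: tr hq.
exists m; rewrite ?inE ?ms ?orbT // => q; rewrite inE => /orP[/eqP ->|/hm] //.
Qed.

(** * Weights of exponents *)

Section Weights.
Variables (Phi : oagType) (n : nat) (tau : 'I_n -> Phi).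
Hypothesis tau_ge0 : forall i, 0 <= tau i.

Definition weight (m : 'X_{1..n}) : Phi := \sum_i tau i *+ m i.

Lemma weightD m q : weight (m + q)%MM = weight m + weight q.
Proof. by rewrite -big_split; apply: eq_bigr => i _; rewrite mnmDE mulrnDr. Qed.

Lemma weightU i : weight U_(i)%MM = tau i.
Proof.
rewrite /weight (bigD1 i) //= mnm1E eqxx mulr1n big1 ?addr0 // => j ne.
by rewrite mnm1E eq_sym (negbTE ne) mulr0n.
Qed.

Lemma weight_ge0 m : 0 <= weight m.
Proof. by apply: oag_sum_ge0 => i _; apply: oag_mulrn_ge0. Qed.

Lemma weight_le m q : (m <= q)%MM -> weight m <= weight q.
Proof.
by move=> /submK <-; rewrite weightD -{1}[weight m]add0r oag_leD2rE weight_ge0.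
Qed.

(** By Dickson's lemma finitely many members of [D] lie below all others, and weights are monotone.
    So the weights are well ordered although [Phi] may not be. *)
Lemma weight_min (D : set 'X_{1..n}) : D !=set0 ->
  exists2 m, D m & forall q, D q -> weight m <= weight q.
Proof.
move=> [m0 Dm0]; have [s [sD Ds]] := dickson D.
have [q0 q0s _] := Ds m0 Dm0.
have [|||m ms hm] := @total_seq_min _ (fun a b => weight a <= weight b) s.
- by move=> a b; apply: oag_le_total.
- by move=> a b c; apply: (@le_trans _ Phi).
- by apply/eqP => e; rewrite e in q0s.
exists m; first exact: sD.
by move=> q /Ds[p ps le]; apply: le_trans (hm p ps) (weight_le le).
Qed.

Lemma weight_ind (C : 'X_{1..n} -> Prop) :
  (forall m, (forall q, weight q < weight m -> C q) -> C m) -> forall m, C m.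
Proof.
move=> step m; apply: contrapT => nC.
have [|q nq hq] := @weight_min [set q | ~ C q]; first by exists m.
apply: nq; apply: step => p lt; apply: contrapT => np.
by move: (hq p np); rewrite oag_leNgt lt.
Qed.

End Weights.

(** * Elements of bounded value *)

Section Valuations.
Variables (K : fieldType) (Phi : oagType) (nu : valuation K Phi).
Implicit Types (x y z : K) (phi psi : Phi).

Lemma valuation1 : nu 1 = 0.
Proof. by apply: (addrI (nu 1)); rewrite -Defs.valM ?oner_neq0 // mulr1 addr0. Qed.

Lemma valuationV x : x != 0 -> nu x^-1 = - nu x.
Proof.
move=> x0; apply: (addrI (nu x)); rewrite -Defs.valM ?invr_eq0 // divff //.
by rewrite valuation1 subrr.
Qed.

Lemma valuationX x n : x != 0 -> nu (x ^+ n) = nu x *+ n.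
Proof.
move=> x0; elim: n => [|n IH]; first by rewrite expr0 mulr0n valuation1.
by rewrite exprS Defs.valM ?expf_neq0 // IH mulrS.
Qed.

Lemma valuation_prod (I : Type) (r : seq I) (F : I -> K) :
  (forall i, F i != 0) -> nu (\prod_(i <- r) F i) = \sum_(i <- r) nu (F i).
Proof.
move=> F0; elim: r => [|i r IH]; first by rewrite !big_nil valuation1.
rewrite !big_cons Defs.valM ?IH //.
by elim: {IH} r => [|j r IH]; rewrite ?big_nil ?oner_neq0 // big_cons mulf_neq0.
Qed.

(** Zero is included by hand, the value of [nu] at 0 being arbitrary. *)
Definition vge phi : set K := [set x | x = 0 \/ phi <= nu x].
Definition vgt phi : set K := [set x | x = 0 \/ phi < nu x].

Lemma vgt0 phi : vgt phi 0. Proof. by left. Qed.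

Lemma vgeD phi x y : vge phi x -> vge phi y -> vge phi (x + y).
Proof.
move=> [->|hx]; first by rewrite add0r.
move=> [->|hy]; first by rewrite addr0; right.
have [->|x0] := eqVneq x 0; first by rewrite add0r; right.
have [->|y0] := eqVneq y 0; first by rewrite addr0; right.
have [->|xy0] := eqVneq (x + y) 0; first by left.
right; apply: le_trans (Defs.valD nu x0 y0 xy0).
by rewrite /Order.min; case: ifP.
Qed.

Lemma vgtD phi x y : vgt phi x -> vgt phi y -> vgt phi (x + y).
Proof.
move=> [->|hx]; first by rewrite add0r.
move=> [->|hy]; first by rewrite addr0; right.
have [->|x0] := eqVneq x 0; first by rewrite add0r; right.
have [->|y0] := eqVneq y 0; first by rewrite addr0; right.
have [->|xy0] := eqVneq (x + y) 0; first by left.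
right; apply: lt_le_trans (Defs.valD nu x0 y0 xy0).
by rewrite /Order.min; case: ifP.
Qed.

Lemma vgeM phi psi x y : vge phi x -> vge psi y -> vge (phi + psi) (x * y).
Proof.
move=> [->|hx]; first by rewrite mul0r; left.
move=> [->|hy]; first by rewrite mulr0; left.
have [->|x0] := eqVneq x 0; first by rewrite mul0r; left.
have [->|y0] := eqVneq y 0; first by rewrite mulr0; left.
by right; rewrite Defs.valM // oag_leD.
Qed.

Lemma vgtM phi psi x y : vge phi x -> vgt psi y -> vgt (phi + psi) (x * y).
Proof.
move=> [->|hx]; first by rewrite mul0r; left.
move=> [->|hy]; first by rewrite mulr0; left.
have [->|x0] := eqVneq x 0; first by rewrite mul0r; left.
have [->|y0] := eqVneq y 0; first by rewrite mulr0; left.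
by right; rewrite Defs.valM // oag_le_ltD.
Qed.

Lemma valuation_opp1 : nu (-1) = 0.
Proof.
have n1 : (-1 : K) != 0 by rewrite oppr_eq0 oner_neq0.
have e : nu (-1) + nu (-1) = 0 by rewrite -Defs.valM // mulrNN mulr1 valuation1.
case/orP: (oag_le_total 0 (nu (-1))) => h; first by case: (oag_addr_eq0 h h e).
have h' : 0 <= - nu (-1) by have := oag_leD2r (- nu (-1)) _ _ h; rewrite subrr add0r.
apply/eqP; rewrite -oppr_eq0; apply/eqP.
by case: (oag_addr_eq0 h' h') => //; rewrite -opprD e oppr0.
Qed.

Lemma vgtN phi x : vgt phi x -> vgt phi (- x).
Proof.
move=> hx; rewrite -mulN1r -[phi]add0r; apply: vgtM => //.
by right; rewrite valuation_opp1.
Qed.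

Lemma vgt_neq x : x != 0 -> ~ vgt (nu x) x.
Proof. by move=> /eqP x0 [|] //; rewrite ltxx. Qed.

Lemma vge_le phi psi x : phi <= psi -> vge psi x -> vge phi x.
Proof. by move=> h [->|h']; [left|right; apply: le_trans h']. Qed.
Lemma vge_vgt phi psi x : phi < psi -> vge psi x -> vgt phi x.
Proof. by move=> h [->|h']; [left|right; apply: lt_le_trans h']. Qed.

End Valuations.

(** * Regularity of a local ring from the values of its parameters *)

Section RegularByValues.
Variables (B : comNzRingType) (K : fieldType) (Phi : oagType) (nu : valuation K Phi).
Variable theta : {rmorphism B -> K}.
Hypothesis noethB : is_noetherian B.
Hypothesis theta_ge0 : forall b, vge nu 0 (theta b).
Hypothesis theta_gt0 : forall b, nonunits B b <-> vgt nu 0 (theta b).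
Variable s : seq B.
Local Notation r := (size s).
Hypothesis s_neq0 : forall i : 'I_r, theta s`_i != 0.
Hypothesis s_gen : nonunits B = ideal_gen [set` s].
Local Notation wt := (weight (fun i : 'I_r => nu (theta s`_i))).
Hypothesis wt_inj : injective wt.

Lemma values_local : is_local B.
Proof. by rewrite /is_local s_gen; apply: ideal_gen_ideal. Qed.

Let hM := values_local.
Let pM := local_prime hM.

Lemma generator_gt0 (i : 'I_r) : 0 < nu (theta s`_i).
Proof.
have : nonunits B s`_i by rewrite s_gen; apply: generator_ideal_gen; rewrite /= mem_nth.
by move=> /theta_gt0[/eqP|//]; rewrite (negbTE (s_neq0 i)).
Qed.

Let tau_ge0 (i : 'I_r) : 0 <= nu (theta s`_i). Proof. exact/ltW/generator_gt0. Qed.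

Definition mono (m : 'X_{1..r}) : B := \prod_(i < r) s`_i ^+ m i.

Lemma monoD m q : mono (m + q)%MM = mono m * mono q.
Proof. by rewrite -big_split; apply: eq_bigr => i _; rewrite mnmDE exprD. Qed.

Lemma mono0 : mono 0%MM = 1.
Proof. by rewrite /mono big1 // => i _; rewrite mnm0E expr0. Qed.

Lemma monoU i : mono U_(i)%MM = s`_i.
Proof.
rewrite /mono (bigD1 i) //= mnm1E eqxx expr1 big1 ?mulr1 // => j ne.
by rewrite mnm1E eq_sym (negbTE ne) expr0.
Qed.

Lemma theta_mono_neq0 m : theta (mono m) != 0.
Proof.
by rewrite rmorph_prod; apply/prodf_neq0 => i _; rewrite rmorphXn expf_neq0.
Qed.

Lemma nu_mono m : nu (theta (mono m)) = wt m.
Proof.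
rewrite rmorph_prod valuation_prod => [|i]; last by rewrite rmorphXn expf_neq0.
by apply: eq_bigr => i _; rewrite rmorphXn valuationX.
Qed.

Definition monomial_ideal (D : set 'X_{1..r}) : set B :=
  ideal_gen [set x | exists2 q, D q & x = mono q].

Lemma monomial_ideal_ideal D : is_ideal (monomial_ideal D).
Proof. exact: ideal_gen_ideal. Qed.
Hint Resolve monomial_ideal_ideal : core.

Lemma mem_mono D q : D q -> monomial_ideal D (mono q).
Proof. by move=> Dq; apply: generator_ideal_gen; exists q. Qed.

Lemma monomial_ideal_sub (D : set 'X_{1..r}) (I : set B) :
  is_ideal I -> (forall q, D q -> I (mono q)) -> monomial_ideal D `<=` I.
Proof. by move=> hI h; apply: ideal_gen_sub => // _ [q Dq ->]; apply: h. Qed.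

Lemma monomial_ideal_mono D D' : D `<=` D' -> monomial_ideal D `<=` monomial_ideal D'.
Proof. by move=> h; apply: monomial_ideal_sub => // q /h; apply: mem_mono. Qed.

Lemma monomial_ideal_le D m q : D m -> (m <= q)%MM -> monomial_ideal D (mono q).
Proof. by move=> Dm /submK <-; rewrite monoD; apply: is_idealMl => //; apply: mem_mono. Qed.

Lemma monomial_ideal_peel D D1 q1 x : monomial_ideal D x ->
  (forall q, D q -> q = q1 \/ D1 q) ->
  exists c w, monomial_ideal D1 w /\ x = c * mono q1 + w.
Proof.
move=> Dx hD; have : ideal_add (monomial_ideal D1) (principal (mono q1)) x.
  move: x Dx; apply: monomial_ideal_sub.
    by apply: ideal_add_ideal => //; apply: principal_ideal.
  move=> q /hD[->|D1q]; first by apply: ideal_addr => //; apply: principal_id.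
  by apply: ideal_addl; [apply: principal_ideal|apply: mem_mono].
by case=> w [_ [hw [c ->] ->]]; exists c, w; rewrite addrC.
Qed.

Lemma monomial_ideal_vgt D phi x : (forall q, D q -> phi < wt q) ->
  monomial_ideal D x -> vgt nu phi (theta x).
Proof.
move=> h; move: x; apply: (@monomial_ideal_sub _ [set x | vgt nu phi (theta x)]).
  split=> /=; first by rewrite rmorph0; apply: vgt0.
    by move=> x y; rewrite rmorphD; apply: vgtD.
  by move=> a x hx; rewrite rmorphM -[phi]add0r; apply: vgtM.
by move=> q /h lt; right; rewrite nu_mono.
Qed.

Lemma monomial_ideal_nonunit D c q : nonunits B c ->
  (forall i, D (q + U_(i))%MM) -> monomial_ideal D (c * mono q).
Proof.
rewrite s_gen => /ideal_gen_seqP[a ->] h; rewrite mulr_suml; apply: ideal_sum => // i _.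
by rewrite -mulrA -monoU -monoD addmC; apply: is_idealMl => //; apply: mem_mono.
Qed.

(** Krull's intersection theorem modulo the monomial ideal: an ideal containing a power of every
    generator contains all monomials of large degree. *)
Lemma monomial_ideal_krull D x :
  (forall n, monomial_ideal (D `|` [set q | (n <= mdeg q)%N]) x) -> monomial_ideal D x.
Proof.
move: x; apply: (@krull_intersection _ noethB hM (monomial_ideal D)
  (fun n => monomial_ideal (D `|` [set q | (n <= mdeg q)%N]))) => // [n|J hJ powJ sJ].
  by apply: monomial_ideal_mono => q; left.
have /choice[M hMi] : forall i : 'I_r, exists n, J (s`_i ^+ n).
  move=> i; apply: powJ; rewrite s_gen; apply: generator_ideal_gen.
  by rewrite /= mem_nth.
exists (\sum_i M i).+1; apply: monomial_ideal_sub => // q [Dq|/= ltq].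
  exact/sJ/mem_mono.
have [i lti] : exists i, (M i < q i)%N.
  apply: contrapT => none; move: ltq; rewrite ltnNge => /negP; apply.
  rewrite mdegE; apply: leq_sum => i _; rewrite leqNgt; apply/negP => lt.
  by apply: none; exists i.
rewrite /mono (bigD1 i) //=; apply: is_idealMr => //.
by rewrite -(subnK (ltnW lti)) exprD; apply: is_idealMl.
Qed.

(** Only monomials of weight at least [wt m] can be kept in the expression; none of them is m, so by
    injectivity all have weight greater than [wt m], against the value of [mono m]. *)
Lemma mono_independent m : ~ monomial_ideal [set q | ~~ (q <= m)%MM] (mono m).
Proof.
move=> h0; pose U phi := [set q | ~~ (q <= m)%MM /\ phi <= wt q].
have UU i q : ~~ (q <= m)%MM -> ~~ (q + U_(i) <= m)%MM.
  by apply: contra => /(lepm_trans _) -> //; apply: lem_addr.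
(* Induction on the weight of [q0]: the bound below the weights in use is raised step by step up to
   [wt m]. *)
suff main q0 : wt q0 <= wt m -> monomial_ideal (U (wt q0)) (mono m).
  have /(_ (lexx _)) := main m.
  move=> /(monomial_ideal_vgt (phi := wt m)) => hv.
  have := @vgt_neq _ _ nu _ (theta_mono_neq0 m); rewrite nu_mono; apply; apply: hv.
  move=> q [nle le]; rewrite lt_neqAle le andbT; apply/eqP => /wt_inj e.
  by rewrite e lepm_refl in nle.
move: q0; apply: (weight_ind tau_ge0) => q0 IH le0; apply: monomial_ideal_krull => n.
pose E := U (wt q0) `|` [set q | (n <= mdeg q)%N].
pose L := [seq val q | q <- enum {: 'X_{1..r < n}} & ~~ (val q <= m)%MM && (wt (val q) < wt q0)].
have LP q : (mdeg q < n)%N -> ~~ (q <= m)%MM -> wt q < wt q0 -> q \in L.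
  move=> lt nle ltw; apply/mapP; exists (BMultinom lt) => //.
  by rewrite mem_filter /= nle ltw mem_enum.
have [L0|Ln0] := eqVneq L [::].
  move: h0; apply: monomial_ideal_mono => q nle.
  have [lt|ge] := ltnP (mdeg q) n; last by right.
  left; split=> //; rewrite oag_leNgt; apply/negP => ltw.
  by have := LP q lt nle ltw; rewrite L0.
(* Modulo monomials of degree at least n only finitely many exponents are too light; [q1] is the
   heaviest, and the induction hypothesis removes all lighter ones. *)
have [|||q1 q1L max1] := @total_seq_min _ (fun a b => wt b <= wt a) L.
- by move=> a b; apply: oag_le_total.
- by move=> a b c h1 h2; apply: (le_trans h2 h1).
- by [].
have [nle1 lt1] : ~~ (q1 <= m)%MM /\ wt q1 < wt q0.
  by move/mapP: q1L => [q]; rewrite mem_filter => /andP[/andP[h1 h2] _] ->.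
have lt1m := lt_le_trans lt1 le0.
have [|c [w [hw e]]] := @monomial_ideal_peel (U (wt q1))
  [set q | ~~ (q <= m)%MM /\ wt q1 < wt q] q1 (mono m) (IH q1 lt1 (ltW lt1m)).
  move=> q [nle le]; have [->|ne] := eqVneq q q1; [by left|right; split=> //].
  by rewrite lt_neqAle le andbT (inj_eq wt_inj) eq_sym.
(* A unit coefficient would give [mono q1] a value greater than its weight. As a nonunit, c trades
   [mono q1] for its multiples by generators, which are heavier. *)
have nc : nonunits B c.
  apply: contrapT => uc; have := @vgt_neq _ _ nu _ (theta_mono_neq0 q1); rewrite nu_mono; apply.
  have [c' ec] := contrapT uc.
  have -> : theta (mono q1) = theta c' * (theta (mono m) - theta w).
    rewrite e -rmorphB addrK -rmorphM mulrA (mulrC c') ec mul1r //.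
  rewrite -[wt q1]add0r; apply: vgtM => //; apply: vgtD; first by right; rewrite nu_mono.
  by apply/vgtN/(monomial_ideal_vgt _ hw) => q [].
rewrite e; apply: is_idealD => //.
  have sub : [set q | ~~ (q <= m)%MM /\ wt q1 < wt q] `<=` E.
    move=> q [nle lt]; have [ltn|ge] := ltnP (mdeg q) n; last by right.
    left; split=> //; rewrite oag_leNgt; apply/negP => ltw.
    by move: (max1 q (LP q ltn nle ltw)); rewrite oag_leNgt lt.
  move: (monomial_ideal_mono sub hw) => hw'.
  apply: (monomial_ideal_mono sub); apply: monomial_ideal_nonunit => // i; split.
    exact: UU.
  rewrite weightD weightU -{1}[wt q1]addr0; apply: oag_le_ltD => //; exact: generator_gt0.
move: hw; apply: monomial_ideal_mono => q [nle lt].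
have [ltn|ge] := ltnP (mdeg q) n; last by right.
left; split=> //; rewrite oag_leNgt; apply/negP => ltw.
by move: (max1 q (LP q ltn nle ltw)); rewrite oag_leNgt lt.
Qed.

(* The leading term of f modulo D, for the degree lexicographic order.        *)
Lemma monomial_corner D f : ~ monomial_ideal D f -> exists m c w,
  [/\ ~ nonunits B c, ~ D m, monomial_ideal (D `|` [set q | (m < q)%O]) w & f = c * mono m + w].
Proof.
move=> nDf; have [n hn] : exists n, ~ monomial_ideal (D `|` [set q | (n <= mdeg q)%N]) f.
  by apply: contrapT => none; apply/nDf/monomial_ideal_krull => n; apply: contrapT => h; apply: none; exists n.
(* Exponents m such that f lies in D plus the monomials from m on. Their degrees are below n, so T
   is finite and has a largest member, the exponent of the leading term. *)
pose T := [set m : 'X_{1..r} | monomial_ideal (D `|` [set q | (m <= q)%O]) f].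
have Tlt m : T m -> (mdeg m < n)%N.
  move=> Tm; rewrite ltnNge; apply/negP => le; apply: hn; move: Tm.
  apply: monomial_ideal_mono => q [Dq|/= /lemc_mdeg leq]; [by left|right].
  exact: leq_trans le leq.
have T0 : T 0%MM.
  rewrite /T /= -[f]mulr1 -mono0; apply: is_idealMl => //; apply: mem_mono; right.
  exact: lexx.
pose L := [seq val q | q <- enum {: 'X_{1..r < n}} & `[< T (val q) >]].
have LP q : T q -> q \in L.
  move=> Tq; apply/mapP; exists (BMultinom (Tlt q Tq)) => //.
  by rewrite mem_filter /= mem_enum andbT; apply/asboolP.
have [|||m mL maxm] := @total_seq_min _ (fun a b : 'X_{1..r} => (b <= a)%O) L.
- by move=> a b; apply: le_total.
- by move=> a b c h1 h2; apply: (le_trans h2 h1).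
- by apply/eqP => e; have := LP _ T0; rewrite e.
have Tm : T m by move/mapP: mL => [q]; rewrite mem_filter => /andP[/asboolP h _] ->.
(* Otherwise the next exponent after m of degree below n would also belong to T, or f would reduce
   to monomials of degree at least n. *)
have nD : ~ monomial_ideal (D `|` [set q | (m < q)%O]) f.
  move=> h; pose L' := [seq val q | q <- enum {: 'X_{1..r < n}} & (m < val q)%O].
  have L'P q : (mdeg q < n)%N -> (m < q)%O -> q \in L'.
    by move=> lt mq; apply/mapP; exists (BMultinom lt); rewrite // mem_filter /= mq mem_enum.
  have [L0|Ln0] := eqVneq L' [::].
    apply: hn; move: h; apply: monomial_ideal_mono => q [Dq|/= mq]; [by left|right=> /=].
    by rewrite leqNgt; apply/negP => lt; have := L'P q lt mq; rewrite L0.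
  have [|||m' m'L minm] := @total_seq_min _ (fun a b : 'X_{1..r} => (a <= b)%O) L'.
  - by move=> a b; apply: le_total.
  - by move=> a b c; apply: le_trans.
  - by [].
  have [ltd ltm] : (mdeg m' < n)%N /\ (m < m')%O.
    move/mapP: m'L => [q]; rewrite mem_filter => /andP[lt _] ->; split=> //.
    exact: bmdeg.
  have /maxm : m' \in L.
    apply: LP; move: h; apply: monomial_ideal_mono => q [Dq|/= mq]; [by left|right=> /=].
    have [lt|ge] := ltnP (mdeg q) n; first exact/minm/L'P.
    by apply/ltW/lt_mdeg_ltmc; apply: leq_trans ge.
  by rewrite leNgt ltm.
have [|c [w [hw e]]] := @monomial_ideal_peel _ (D `|` [set q | (m < q)%O]) m f Tm.
  move=> q [Dq|/= le]; first by right; left.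
  by move: le; rewrite le_eqVlt => /orP[/eqP ->|lt]; [left|right; right].
exists m, c, w; split=> //.
  move=> nc; apply: nD; rewrite e; apply: is_idealD => //.
  apply: monomial_ideal_nonunit => // i; right => /=.
  by apply: lt_mdeg_ltmc; rewrite mdegD mdeg1 addn1.
move=> Dm; apply: nD; rewrite e; apply: is_idealD => //.
by apply: is_idealMl => //; apply: mem_mono; left.
Qed.

(** The corresponding monomial ideal is generated by the first i elements of [s]. *)
Definition touches (i : nat) : set 'X_{1..r} :=
  [set q | exists2 j : 'I_r, (j < i)%N & (0 < q j)%N].

Lemma touches_le i q m : touches i q -> (q <= m)%MM -> touches i m.
Proof. by case=> j lt qj /mnm_lepP /(_ j) le; exists j => //; apply: leq_trans le. Qed.

(** Leading terms with unit coefficients multiply: if f g were in the ideal, [mono (m + m')] would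
    be a combination of touching monomials and of later ones in the order. None of these divides m +
    m', against [mono_independent]. *)
Lemma touches_prime i : is_prime_ideal (monomial_ideal (touches i)).
Proof.
have notin m : ~ touches i m -> forall D, D `<=` [set q | ~~ (q <= m)%MM] ->
    ~ monomial_ideal D (mono m).
  by move=> _ D sD /(monomial_ideal_mono sD); apply: mono_independent.
split=> //.
  rewrite -mono0; apply: (notin 0%MM) => [[j _]|q]; first by rewrite mnm0E.
  case=> j _ qj; apply/negP => /mnm_lepP /(_ j); rewrite mnm0E leqn0 => /eqP e.
  by rewrite e in qj.
move=> f g fg; apply: contrapT => /not_orP[nf ng].
have [m [c [w [uc nm hw ef]]]] := monomial_corner nf.
have [m' [c' [w' [uc' nm' hw' eg]]]] := monomial_corner ng.
pose D := touches i `|` [set q | (m + m' < q)%MM%O].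
pose E := touches i `|` [set q | ((m + m')%MM < q)%O].
have nmm : ~ touches i (m + m')%MM.
  case=> j lt; rewrite mnmDE addn_gt0 => /orP[h|h]; [apply: nm|apply: nm']; by exists j.
have sE : E `<=` [set q | ~~ (q <= m + m')%MM].
  move=> q [tq|/= lt]; apply/negP => le; first by apply: nmm; apply: touches_le tq le.
  move: lt; rewrite ltNge; move/negP; apply.
  by rewrite -(submK le) lemc_addl.
apply: (notin _ nmm _ sE).
have [d ed] : exists d, c * c' * d = 1 by apply: contrapT => h; case: (primeM pM uc uc').
have key : monomial_ideal E (c * c' * mono (m + m')%MM).
  have -> : c * c' * mono (m + m')%MM = f * g - (w * (c' * mono m') + w' * (c * mono m + w)).
    by rewrite ef eg monoD; ring.
  have mulE q1 q2 a b : (forall q, (q1 < q)%O -> ((m + m')%MM < (q + q2)%MM)%O) ->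
      monomial_ideal (touches i `|` [set q | (q1 < q)%O]) a -> monomial_ideal E (a * (b * mono q2)).
    move=> hq; move: a; apply: (@monomial_ideal_sub _ [set a | monomial_ideal E (a * (b * mono q2))]).
      exact: ideal_colon.
    move=> q hqq; rewrite /= mulrCA -monoD; apply: is_idealMl => //.
    case: hqq => [tq|/= lt]; first by apply: (@monomial_ideal_le _ q); [left|apply: lem_addr].
    by apply: mem_mono; right; apply: hq.
  apply: is_idealB => //; first by move: fg; apply: monomial_ideal_mono => q; left.
  apply: is_idealD => //.
    by apply: (mulE m) hw => q lt; rewrite ltmc_add2l.
  rewrite mulrDr; apply: is_idealD => //.
    by apply: (mulE m') hw' => q lt; rewrite addmC ltmc_add2l.
  move: w hw {ef}; apply: (@monomial_ideal_sub _ [set w | monomial_ideal E (w' * w)]).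
    by split=> /=; [rewrite mulr0; apply: is_ideal0|move=> a b; rewrite mulrDr; apply: is_idealD
      |move=> a b hb; rewrite mulrCA; apply: is_idealMl].
  move=> q [tq|/= lt].
    by apply: is_idealMl => //; apply: mem_mono; left.
  rewrite /= -[mono q]mul1r; apply: (mulE m') hw' => q' lt'.
  by rewrite addmC; apply: lemc_lt_add => //; apply: ltW.
rewrite -[mono _]mul1r -ed -mulrA (mulrC d) mulrA.
exact: is_idealMr.
Qed.

(** The chain of the primes [monomial_ideal (touches i)] is strict by [mono_independent] and gives
    the lower bound for the dimension; Krull's height theorem gives the upper one. *)
Theorem values_regular : is_regular_system s.
Proof.
split=> //; split; last by move=> e; apply: local_krull_height.
exists (fun i : 'I_r.+1 => monomial_ideal (touches i)); split=> [i|i j lt].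
  exact: touches_prime.
split.
  apply: monomial_ideal_mono => q [l ltl ql]; exists l => //; exact: ltn_trans ltl lt.
have lti : (i < r)%N by apply: leq_trans lt _; rewrite -ltnS.
move=> /(_ (mono U_(Ordinal lti)%MM)) h.
have /h : monomial_ideal (touches j) (mono U_(Ordinal lti)%MM).
  by apply: mem_mono; exists (Ordinal lti); rewrite // mnm1E eqxx.
have sub : touches i `<=` [set q | ~~ (q <= U_(Ordinal lti))%MM].
  move=> q [l ltl ql]; apply/negP => /mnm_lepP /(_ l); rewrite mnm1E.
  case: eqP => [e|_]; first by rewrite -e ltnn in ltl.
  by rewrite leqn0 => /eqP e; rewrite e in ql.
by move=> /(monomial_ideal_mono sub); apply: mono_independent.
Qed.

Theorem values_regular_local_ring : is_regular_local_ring B.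
Proof. by split=> //; exists s; apply: values_regular. Qed.

End RegularByValues.

(** * Power series and the semigroup of values *)

Section PowerSeriesMonomials.
Variables (k : comNzRingType) (n : nat).
Local Notation S := {powerseries k[n]}.
Implicit Types (f g : S) (m e : 'X_{1..n}).

Definition series_of_mpoly (p : {mpoly k[n]}) : S := fun m => p@_m.

Fact series_of_mpoly_zmod_morphism : zmod_morphism series_of_mpoly.
Proof. by move=> p q; apply/funext => m; rewrite /series_of_mpoly mcoeffB. Qed.

Fact series_of_mpoly_monoid_morphism : monoid_morphism series_of_mpoly.
Proof.
split=> [|p q]; apply/funext => m; first by rewrite /series_of_mpoly mcoeff1 [RHS]/(@psC n k 1 m) /psC; case: eqP.
by apply/esym; apply: ps_mulE (ltnSn _) _ _.
Qed.

HB.instance Definition _ :=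
  GRing.isZmodMorphism.Build {mpoly k[n]} S series_of_mpoly series_of_mpoly_zmod_morphism.
HB.instance Definition _ :=
  GRing.isMonoidMorphism.Build {mpoly k[n]} S series_of_mpoly series_of_mpoly_monoid_morphism.

Definition series_monomial e : S := series_of_mpoly 'X_[e].

Lemma series_monomialE e m : series_monomial e m = (e == m)%:R.
Proof. exact: mcoeffX. Qed.

Lemma series_monomial_prod e : series_monomial e = \prod_i psX k i ^+ e i.
Proof.
rewrite /series_monomial mpolyXE_id rmorph_prod; apply: eq_bigr => i _.
rewrite rmorphXn; congr (_ ^+ _); apply/funext => m.
by rewrite /= /series_of_mpoly mcoeffX /psX eq_sym; case: eqP.
Qed.

Lemma mul_series_monomial g e m :
  (g * series_monomial e) m = if (e <= m)%MM then g (m - e)%MM else 0.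
Proof.
have -> : (g * series_monomial e) m = (truncation (mdeg m).+1 g * 'X_[e])@_m.
  by apply: ps_mulE (ltnSn _) _ _ => m' lt //; rewrite truncationE.
case: ifP => [le|nle].
  transitivity ((truncation (mdeg m).+1 g * 'X_[e])@_(e + (m - e))).
    by rewrite addmC submK.
  by rewrite mcoeffMX truncationE // ltnS mdegB.
rewrite mcoeffM big1 // => -[q1 q2] /= /eqP em; rewrite mcoeffX.
case: eqP => [eq|_]; rewrite ?mulr0 //.
by move: nle (lem_addl q1 q2); rewrite -em eq => ->.
Qed.

Lemma psC_mul c g m : (@psC n k c * g) m = c * g m.
Proof.
have -> : (@psC n k c * g) m = (c%:MP * truncation (mdeg m).+1 g)@_m.
  apply: ps_mulE (ltnSn _) _ _ => m' lt; last by rewrite truncationE.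
  by rewrite mcoeffC /psC; case: eqP => _; rewrite ?mulr1 ?mulr0.
by rewrite mcoeffCM truncationE.
Qed.

(** By Dickson's lemma finitely many exponents of [D] divide all monomials of the support. This
    turns an infinite series into a finite combination, to which ring morphisms apply. *)
Lemma series_support_ideal (D : set 'X_{1..n}) f : (forall m, f m != 0 -> D m) ->
  ideal_gen [set x | exists2 e, D e & x = series_monomial e] f.
Proof.
move=> hD; have [s [sD Ds]] := dickson D.
have {hD Ds} : forall m, f m != 0 -> exists2 e, e \in s & (e <= m)%MM.
  by move=> m /hD /Ds.
have hI := @ideal_gen_ideal _ [set x | exists2 e, D e & x = series_monomial e].
elim: s f sD => [|e s IH] f sD hf.
  have -> : f = 0; last exact: is_ideal0.
  by apply/funext => m; apply/eqP; apply/negPn/negP => /hf[].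
(* [f1] is the part of f divisible by the monomial e, divided by it; [f2] is the rest. *)
pose f1 : S := fun m => f (m + e)%MM.
pose f2 : S := fun m => if (e <= m)%MM then 0 else f m.
have -> : f = f1 * series_monomial e + f2.
  apply/funext => m; have -> : (f1 * series_monomial e + f2) m =
    (f1 * series_monomial e) m + f2 m by [].
  rewrite mul_series_monomial /f2 /f1; case: ifP => [le|_]; last by rewrite add0r.
  by rewrite submK // addr0.
apply: is_idealD => //.
  apply: is_idealMl => //; apply: generator_ideal_gen; exists e => //.
  by apply: sD; rewrite mem_head.
apply: IH => [m ms|m]; first by apply: sD; rewrite inE ms orbT.
rewrite /f2; case: ifP => [_|nle]; first by rewrite eqxx.
by move=> /hf[e']; rewrite inE => /orP[/eqP ->|]; [rewrite nle|exists e'].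
Qed.

End PowerSeriesMonomials.

(** * Values as weights of monomials *)

Section ValueSemigroup.
Import monalg.
Variables (k : fieldType) (R : idomainType) (iota : {rmorphism k -> R}).
Variables (Phi : oagType) (nu : dominating_valuation R Phi).
Variables (N : nat) (xi : 'I_N -> R).
Hypothesis xi_neq0 : forall i, xi i != 0.
Hypothesis xi_generate : generates_algebra (gr_algebra_map nu iota)
  (fun i => initial_form nu (xi i)).
Local Notation G := (nneg Phi).
Local Notation wt := (weight (fun i => nu (tofrac (xi i)))).

Let homogeneous (d : Phi) (f : rees nu) : Prop :=
  forall phi : G, val phi <> d -> mcoeff phi (val f) = 0.

Let homogeneousM d e f g : homogeneous d f -> homogeneous e g -> homogeneous (d + e) (f * g).
Proof.
move=> hf hg phi ne; rewrite rmorphM.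
apply: (@rees_sum_ge R Phi _ _ phi (fun z => z = 0)) => // [x y -> ->|a b eab].
  by rewrite addr0.
have [ea|na] := pselect (val a = d); last by rewrite hf // mul0r.
have [eb|nb] := pselect (val b = e); last by rewrite (hg b) // mulr0.
by case: ne; rewrite -eab /= ea eb.
Qed.

(** The initial form of x is a polynomial in those of the xi_i. If no monomial had weight nu x, this
    polynomial would have no component in that degree, where the initial form of x is nonzero. *)
Lemma value_semigroup (x : R) : x != 0 -> exists m, nu (tofrac x) = wt m.
Proof.
move=> x0; have [phi [h [ephi einit]]] := initial_formE nu x0.
have [p ep] := xi_generate (initial_form nu x).
have /choice[e he] : forall i, exists e : rees nu,
    homogeneous (nu (tofrac (xi i))) e /\ initial_form nu (xi i) = \pi_(graded_ring nu)%qT e.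
  move=> i; have [psi [h' [epsi ->]]] := initial_formE nu (xi_neq0 i).
  exists (exist (fun f => f \in rees_pred nu) _ h'); split=> // psi' ne.
  rewrite /= mcoeffU; case: eqP => [eq|_]; last by rewrite mulr0n.
  by case: ne; rewrite -eq.
apply: contrapT => none.
(* The polynomial evaluated on homogeneous lifts of the initial forms. *)
pose z : rees nu := \sum_(m <- mpoly.msupp p)
  rees_const nu (iota (mpoly.mcoeff m p)) * \prod_i e i ^+ m i.
have hz : mcoeff phi (val z) = 0.
  rewrite /z; elim/big_ind: _ => [|a b ha hb|m _].
  - by rewrite rmorph0 mcoeff0.
  - by rewrite rmorphD mcoeffD ha hb addr0.
  have : homogeneous (0 + wt m) (rees_const nu (iota (mpoly.mcoeff m p)) * \prod_i e i ^+ m i).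
    apply: homogeneousM.
      move=> psi ne; rewrite /= mcoeffU; case: eqP => [eq|_]; last by rewrite mulr0n.
      by case: ne; rewrite -eq.
    have h1 : homogeneous 0 1.
      move=> psi ne; rewrite rmorph1 mcoeff1; case: eqP => // eq.
      by case: ne; rewrite eq.
    rewrite /weight; elim/big_ind2: _ => // [a b c d|i _]; first exact: homogeneousM.
    elim: (m i) => [|d IH]; first by rewrite expr0 mulr0n.
    by rewrite exprS mulrS; apply: homogeneousM => //; case: (he i).
  by apply; rewrite ephi add0r => eq; apply: none; exists m.
have : \pi_(graded_ring nu)%qT (exist (fun f => f \in rees_pred nu) _ h : rees nu) =
       \pi_(graded_ring nu)%qT z.
  rewrite -einit ep /mpoly.mmap /z rmorph_sum; apply: eq_bigr => m _.
  rewrite rmorphM /mpoly.mmap1 rmorph_prod; congr (_ * _).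
  by apply: eq_bigr => i _; rewrite rmorphXn; case: (he i) => _ ->.
move=> /eqP; rewrite -Quotient.idealrBE => /rees_plusP /(_ phi).
rewrite rmorphB mcoeffB hz subr0 /= mcoeffUU => -[/eqP|].
  by rewrite (negbTE x0).
by rewrite ephi ltxx.
Qed.

End ValueSemigroup.

(** * Expansion of elements in monomials of increasing weight *)

Section SeriesExpansion.
Variables (k : fieldType) (R : idomainType) (iota : {rmorphism k -> R}).
Hypothesis k_representatives : is_field_of_representatives iota.
Variables (Phi : oagType) (nu : dominating_valuation R Phi).
Hypothesis nu_rational : is_rational nu.
Variables (N : nat) (xi : 'I_N -> R).
Hypothesis xi_neq0 : forall i, xi i != 0.
Hypothesis xi_generate : generates_algebra (gr_algebra_map nu iota)
  (fun i => initial_form nu (xi i)).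
Local Notation S := {powerseries k[N]}.
Variable pi : {rmorphism S -> R}.
Hypothesis pi_const : forall c : k, pi (psC c) = iota c.
Hypothesis pi_var : forall i, pi (psX k i) = xi i.
Local Notation wt := (weight (fun i => nu (tofrac (xi i)))).
Local Notation "x %:F" := (tofrac x).

Lemma residue (y : {fraction R}) : vge nu 0 y -> exists c, vgt nu 0 (y - (iota c)%:F).
Proof.
move=> /nu_rational[x hx]; have [c /dom_ideal hc] := k_representatives x.
exists c; have -> : y - (iota c)%:F = (y - x%:F) + (x - iota c)%:F.
  by rewrite rmorphB addrA subrK.
exact: (vgtD hx (hc _ _)).
Qed.

Lemma dom_ge0 (x : R) : vge nu 0 x%:F. Proof. exact: dom_ring. Qed.

Lemma iota_value c : c != 0 -> nu (iota c)%:F = 0.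
Proof.
move=> c0; have ic0 : (iota c)%:F != 0 by rewrite tofrac_eq0 fmorph_eq0.
have iV0 : (iota c^-1)%:F != 0 by rewrite tofrac_eq0 fmorph_eq0 invr_eq0.
have ge0 (d : k) : (iota d)%:F != 0 -> 0 <= nu (iota d)%:F.
  by move=> d0; case: (dom_ge0 (iota d)) => // /eqP; rewrite (negbTE d0).
have /(oag_addr_eq0 (ge0 c ic0) (ge0 _ iV0))[] // : nu (iota c)%:F + nu (iota c^-1)%:F = 0.
by rewrite -Defs.valM // -!rmorphM divff // !rmorph1 valuation1.
Qed.

Definition xi_mono (m : 'X_{1..N}) : R := \prod_i xi i ^+ m i.

Lemma xi_mono_neq0 m : (xi_mono m)%:F != 0.
Proof. by rewrite tofrac_eq0; apply/prodf_neq0 => i _; rewrite expf_neq0. Qed.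

Lemma nu_xi_mono m : nu (xi_mono m)%:F = wt m.
Proof.
rewrite rmorph_prod valuation_prod => [|i]; last first.
  by rewrite rmorphXn expf_neq0 // tofrac_eq0.
by apply: eq_bigr => i _; rewrite rmorphXn valuationX // tofrac_eq0.
Qed.

Lemma pi_monomial m : pi (series_monomial k m) = xi_mono m.
Proof.
rewrite series_monomial_prod rmorph_prod; apply: eq_bigr => i _.
by rewrite rmorphXn pi_var.
Qed.

Lemma xi_ge0 i : 0 <= nu (xi i)%:F.
Proof. by case: (dom_ge0 (xi i)) => // /eqP; rewrite tofrac_eq0 (negbTE (xi_neq0 i)). Qed.

(** c is the residue of the quotient of x by the monomial. *)
Lemma approximate (x : R) m : vge nu (wt m) x%:F ->
  exists c, vgt nu (wt m) (x - iota c * xi_mono m)%:F.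
Proof.
move=> hx; have X0 := xi_mono_neq0 m.
have [|c hc] := residue (y := x%:F / (xi_mono m)%:F).
  rewrite -[0](subrr (wt m)); apply: vgeM => //; right.
  by rewrite valuationV // nu_xi_mono.
exists c; rewrite -[wt m]addr0 -nu_xi_mono.
have -> : (x - iota c * xi_mono m)%:F = (xi_mono m)%:F * (x%:F / (xi_mono m)%:F - (iota c)%:F).
  by rewrite mulrBr mulrCA divff // mulr1 rmorphB rmorphM (mulrC (iota c)%:F).
by apply: vgtM => //; right.
Qed.

(** The closure conditions make [C] an R-submodule of Frac R, and [series_support_ideal] makes f a
    finite combination of monomials from [D]. *)
Lemma pi_support (C : set {fraction R}) (D : set 'X_{1..N}) (f : S) :
  (forall x y, C x -> C y -> C (x + y)) -> C 0 -> (forall a x, C x -> C (a%:F * x)) ->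
  (forall m, D m -> C (xi_mono m)%:F) ->
  (forall m, f m != 0 -> D m) -> C (pi f)%:F.
Proof.
move=> CD C0 CM hC /series_support_ideal.
apply: (@ideal_gen_sub _ _ [set f | C (pi f)%:F]).
  split=> /=; first by rewrite !rmorph0.
    by move=> g h hg hh; rewrite !rmorphD; apply: (CD).
  by move=> a g hg; rewrite !rmorphM; apply: (CM).
by move=> _ [m Dm ->]; rewrite /= pi_monomial; apply: hC.
Qed.

Lemma pi_support_vgt phi (f : S) : (forall m, f m != 0 -> phi < wt m) -> vgt nu phi (pi f)%:F.
Proof.
apply: pi_support => [x y| |a x hx|m lt]; [exact: vgtD|exact: vgt0| |].
  by rewrite -[phi]add0r; apply: vgtM => //; apply: dom_ge0.
by right; rewrite nu_xi_mono.
Qed.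

Let lt_weight (m q : 'X_{1..N}) : Prop := wt m < wt q.

Let lt_weight_wf : well_founded lt_weight.
Proof. by move=> m; elim/(weight_ind xi_ge0): m => m IH; constructor. Qed.

Let representative phi : 'X_{1..N} := xget 0%MM [set m | wt m = phi].

Let cut m (g : S) : S := fun q => if wt q < wt m then g q else 0.

Section Expansion.
Variable x : R.

Let step m (g : S) : k := if representative (wt m) == m then
  xget 0 [set c | vgt nu (wt m) (x - pi g - iota c * xi_mono m)%:F] else 0.

(* The coefficient of the monomial m is determined by the coefficients of the *)
(* monomials of smaller weight; only one monomial of each weight is used.     *)
Let expansion : S := Fix lt_weight_wf (fun=> k) (fun m rec => step m (fun q =>
  match pselect (lt_weight q m) with left h => rec q h | right _ => 0 end)).

Let expansionE m : expansion m = step m (cut m expansion).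
Proof.
rewrite /expansion Fix_eq => [|q f g efg]; last first.
  congr step; apply/funext => p; case: pselect => // h; exact: efg.
congr step; apply/funext => q; rewrite /cut; case: pselect => [|/negP/negbTE] h.
  by rewrite ifT.
by rewrite h.
Qed.

(** Such a value phi would be the weight of a chosen monomial, whose coefficient was picked so that
    the difference has value greater than phi; all other new terms are heavier. Both partial sums
    and the full expansion are covered by [T]. *)
Let expansion_cut (T : pred 'X_{1..N}) (g : S) phi :
  g = (fun m => if T m then expansion m else 0) ->
  (forall m, wt m <= phi -> T m) ->
  (forall m, wt m = phi -> vge nu phi (x - pi (cut m expansion))%:F) ->
  x - pi g != 0 -> nu (x - pi g)%:F <> phi.
Proof.
move=> eg dT hcut z0 ez.
pose m := representative phi.
have em : wt m = phi.
  have [q eq] := value_semigroup xi_neq0 xi_generate z0.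
  by apply: (@xgetPex _ _ [set m | wt m = phi]); exists q; rewrite /= -eq.
have hm := hcut m em; rewrite -{1}em in hm.
have [|c0 hc0] := approximate (m := m) (x := x - pi (cut m expansion)); first by [].
have hc : vgt nu (wt m) (x - pi (cut m expansion) - iota (expansion m) * xi_mono m)%:F.
  rewrite [in iota _]expansionE /step em eqxx.
  set P := [set c | _]; have : P (xget 0 P) by apply: xgetPex; exists c0; rewrite /P /= -em.
  by [].
pose h : S := g - cut m expansion - psC (expansion m) * series_monomial k m.
have hh q : h q != 0 -> phi < wt q.
  have -> : h q = g q - cut m expansion q - expansion m * series_monomial k m q.
    by rewrite /h -psC_mul.
  rewrite eg /cut series_monomialE em => nz; rewrite oag_ltNge; apply/negP => le.
  move/negP: nz; apply; rewrite (dT _ le); apply/eqP.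
  have [<-|ne] := eqVneq m q; first by rewrite em ltxx subr0 mulr1 subrr.
  rewrite mulr0 subr0; have [lt|nlt] := boolP (wt q < phi); first by rewrite subrr.
  have eq : wt q = phi by apply/eqP; rewrite eq_le le oag_leNgt.
  by rewrite subr0 expansionE /step eq ifN.
have hv : vgt nu phi (x - pi g)%:F.
  have -> : x - pi g = (x - pi (cut m expansion) - iota (expansion m) * xi_mono m) - pi h.
    rewrite /h !rmorphB rmorphM pi_const pi_monomial; ring.
  rewrite rmorphB; apply: vgtD; first by rewrite -em.
  exact/vgtN/pi_support_vgt.
by case: hv => [/eqP|]; rewrite ?tofrac_eq0 ?(negbTE z0) // ez ltxx.
Qed.

Let expansion_vge m : vge nu (wt m) (x - pi (cut m expansion))%:F.
Proof.
elim/(weight_ind xi_ge0): m => m IH.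
have [->|z0] := eqVneq (x - pi (cut m expansion)) 0; first by rewrite rmorph0; left.
right; rewrite oag_leNgt; apply/negP => lt.
apply: (@expansion_cut [pred q | wt q < wt m] (cut m expansion)
  (nu (x - pi (cut m expansion))%:F)) => //.
- by move=> q le; apply: le_lt_trans lt.
- by move=> q eq; rewrite -eq; apply: IH; rewrite eq.
Qed.

(** If x differed from the image of its expansion, the difference would have a value, and
    [expansion_cut] excludes every value. Below phi the recursion picks only zero coefficients. *)
Lemma series_expansion phi : vge nu phi x%:F ->
  exists g : S, pi g = x /\ forall m, g m != 0 -> phi <= wt m.
Proof.
move=> hx; exists expansion; split.
  apply/eqP; rewrite eq_sym -subr_eq0; apply/negPn/negP => z0.
  apply: (@expansion_cut predT expansion (nu (x - pi expansion)%:F)) => //.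
  by move=> q <-; apply: expansion_vge.
move=> m; elim/(weight_ind xi_ge0): m => m IH nz.
rewrite oag_leNgt; apply/negP => lt; move/eqP: nz; apply.
rewrite expansionE /step; case: ifP => // _.
(* The earlier coefficients vanish by induction, so the coefficient at m is the residue of x
   itself. *)
have -> : cut m expansion = 0.
  apply/funext => q; rewrite /cut; case: ifP => // ltq; apply/eqP/negPn/negP => nz.
  by move: (IH q ltq nz); rewrite oag_leNgt (lt_trans ltq lt).
rewrite rmorph0 subr0.
set P := [set c | _]; have [|c hc] := approximate (m := m) (x := x).
  by apply: vge_le (ltW lt) hx.
have : P (xget 0 P) by apply: xgetPex; exists c.
set d := xget 0 P; rewrite /P /= => hd; apply: contrapT => /eqP d0.
have : vgt nu (wt m) (iota d * xi_mono m)%:F.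
  have -> : iota d * xi_mono m = x - (x - iota d * xi_mono m) by ring.
  by rewrite rmorphB; apply: vgtD; [apply: vge_vgt lt hx|apply: vgtN].
rewrite rmorphM; case=> [/eqP|].
  by rewrite mulf_eq0 (negbTE (xi_mono_neq0 m)) orbF tofrac_eq0 fmorph_eq0 (negbTE d0).
by rewrite Defs.valM ?xi_mono_neq0 ?tofrac_eq0 ?fmorph_eq0 // iota_value // add0r nu_xi_mono ltxx.
Qed.

End Expansion.

Lemma series_expansion_gt x phi : vgt nu phi x%:F ->
  exists g : S, pi g = x /\ forall m, g m != 0 -> phi < wt m.
Proof.
have [-> _|x0] := eqVneq x 0; first by exists 0; rewrite rmorph0; split=> // m; rewrite eqxx.
case=> [/eqP|lt]; first by rewrite tofrac_eq0 (negbTE x0).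
have [|g [eg hg]] := @series_expansion x (nu x%:F); first by right.
by exists g; split=> // m /hg; apply: lt_le_trans.
Qed.

Lemma pi_surj x : exists g, pi g = x.
Proof. by have [g [eg _]] := series_expansion (dom_ge0 x); exists g. Qed.

End SeriesExpansion.

(** * Star subdivisions of fans *)

Section AddRow.
Variables (N : nat) (i j : 'I_N).
Hypothesis ij : i != j.

(** Row j is added to row i. On a cone with rows as generators, this is one half of the star
    subdivision at the sum of the two rays. *)
Definition add_row (M : 'M[int]_N) : 'M[int]_N := (1%:M + delta_mx i j) *m M.

Lemma add_row_unitmx M : M \in unitmx -> add_row M \in unitmx.
Proof.
move=> uM; rewrite unitmx_mul uM andbT.
have e : (1%:M + delta_mx i j) *m (1%:M - delta_mx i j) = 1%:M :> 'M[int]_N.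
  rewrite mulmxDl mul1mx mulmxBr mulmx1 mul_delta_mx_0 1?eq_sym // subr0.
  exact: subrK.
by case: (mulmx1_unit e).
Qed.

Lemma add_rowE M l m : add_row M l m = M l m + (l == i)%:R * M j m.
Proof.
rewrite /add_row mulmxDl mul1mx mxE; congr (_ + _).
rewrite mxE (bigD1 j) //= mxE eqxx andbT big1 ?addr0 // => a ne.
by rewrite mxE (negbTE ne) andbF mul0r.
Qed.

Lemma row_add_row M l : row l (add_row M) = row l M + (l == i)%:R *: row j M.
Proof. by apply/rowP => b; rewrite mxE add_rowE !mxE. Qed.

End AddRow.

Section StarSubdivisions.
Variables (RR : realType) (N : nat).
Local Notation V := 'rV[int]_N.
Implicit Types (s t : seq V) (c d : V -> RR) (p q v w : V) (Sigma : seq (seq V)).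

Definition real_vector v : 'rV[RR]_N := map_mx intr v.

(** Coordinates are functions on all integral vectors, so that coordinates in different cones can be
    compared for equality. *)
Definition supported s c : Prop :=
  (forall v, 0 <= c v) /\ (forall v, v \notin s -> c v = 0).

Definition combination s c : 'rV[RR]_N := \sum_(v <- s) c v *: real_vector v.

Lemma supported_sub s t c : {subset s <= t} -> supported s c -> supported t c.
Proof.
by move=> st [c0 cs]; split=> // v vt; apply: cs; apply: contra vt; apply: st.
Qed.

Lemma combination_sub s t c : uniq s -> uniq t -> {subset t <= s} -> supported t c ->
  combination s c = combination t c.
Proof.
move=> us ut ts [_ ct]; rewrite /combination (bigID (mem t)) /= [X in _ + X]big1 ?addr0.
  rewrite -big_filter; apply: perm_big; apply: uniq_perm => //; first exact: filter_uniq.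
  by move=> v; rewrite mem_filter; apply: andb_idr; apply: ts.
by move=> v nv; rewrite ct ?scale0r.
Qed.

Lemma supported_filter s (C : pred V) c : supported s c ->
  (forall v, v \in s -> ~~ C v -> c v = 0) -> supported (filter C s) c.
Proof.
move=> [c0 cs] h; split=> // v; rewrite mem_filter negb_and => nv.
have [vs|/cs //] := boolP (v \in s); apply: h => //.
by move: nv; rewrite vs orbF.
Qed.

Lemma combination_supported s t c : uniq s -> uniq t -> supported s c -> supported t c ->
  combination s c = combination t c.
Proof.
move=> us ut [c0 cs] [_ ct].
have h : supported (filter (mem t) s) c.
  split=> // v; rewrite mem_filter negb_and => /orP[]; [exact: ct|exact: cs].
rewrite (combination_sub us _ _ h) ?(combination_sub ut _ _ h) ?filter_uniq // => v;
  by rewrite mem_filter => /andP[].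
Qed.

Lemma coneP s x : uniq s ->
  cone s x <-> exists2 c, supported s c & x = combination s c.
Proof.
move=> us; split=> [[c [c0 ->]]|[c [c0 _] ->]]; last first.
  exists (fun i => c (nth 0 s i)); split=> [i|]; first exact: c0.
  by rewrite /combination (big_nth 0) big_mkord.
exists (fun v => \sum_(i < size s | nth 0 s i == v) c i).
  split=> v; first by apply: sumr_ge0.
  move=> vs; apply: big1 => i /eqP e; move: vs; rewrite -e.
  by rewrite mem_nth.
rewrite /combination (big_nth 0) big_mkord; apply: eq_bigr => i _; congr (_ *: _).
rewrite (big_pred1 i) // => j; rewrite /= nth_uniq //.
Qed.

Lemma pairing_combination (l : 'rV[RR]_N) s c :
  pairing l (combination s c) = \sum_(v <- s) c v * pairing l (real_vector v).
Proof.
rewrite /pairing /combination.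
under eq_bigr => i _ do rewrite summxE mulr_sumr.
rewrite exchange_big; apply: eq_bigr => v _; rewrite mulr_sumr.
by apply: eq_bigr => i _; rewrite mxE mulrCA.
Qed.

(* A simplicial fan, in terms of the coordinates of the points of its cones:  *)
(* two cones meet along a common face if and only if each point has a unique  *)
(* set of coordinates with support in a cone of the fan.                      *)
Record good_fan Sigma : Prop := GoodFan {
  good_regular : forall s, s \in Sigma ->
    uniq s /\ exists2 M : 'M[int]_N, M \in unitmx & {subset s <= rows_of M};
  good_face : forall s (C : pred V), s \in Sigma ->
    exists2 t, t \in Sigma & t =i filter C s;
  good_inj : forall s t c d, s \in Sigma -> t \in Sigma ->
    supported s c -> supported t d -> combination s c = combination t d -> c = d;
  good_ge0 : forall s v, s \in Sigma -> v \in s -> forall i, 0 <= v 0 i;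
  good_cover : forall x, @orthant RR N x ->
    exists s c, [/\ s \in Sigma, supported s c & combination s c = x]
}.

Section GoodFanTheory.
Variable Sigma : seq (seq V).
Hypothesis gS : good_fan Sigma.

Let uS s : s \in Sigma -> uniq s. Proof. by case/(good_regular gS). Qed.

Lemma mem_cone s v : uniq s -> v \in s -> cone s (real_vector v).
Proof.
move=> us vs; apply/coneP => //; exists (fun u => (u == v)%:R : RR).
  by split=> [u|u nu]; [case: eqP|case: eqP nu => // ->; rewrite vs].
rewrite /combination (bigD1_seq v) //= eqxx scale1r big1 ?addr0 // => u /negbTE ->.
by rewrite scale0r.
Qed.

(** As s is part of a basis, a linear form can take the value 0 on the rays shared with t and 1 on
    the others. It cuts out the common rays, and uniqueness of coordinates shows that they span the
    intersection. *)
Lemma good_inter_face s t : s \in Sigma -> t \in Sigma ->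
  is_face (@cone RR N s `&` cone t) (cone s).
Proof.
move=> sS tS; have [us [M uM sM]] := good_regular gS sS; have ut := uS tS.
pose b : 'cV[RR]_N := \col_j (row j M \notin t)%:R.
pose l := (map_mx intr (invmx M) *m b)^T.
have lE v : v \in s -> pairing l (real_vector v) = (v \notin t)%:R.
  move=> /sM /mapP[j _ ev].
  have : (map_mx intr M *m l^T) j 0 = (v \notin t)%:R :> RR.
    by rewrite trmxK mulmxA -map_mxM mulmxV // map_mx1 mul1mx mxE ev.
  rewrite mxE => <-; apply: eq_bigr => i _; rewrite ev !mxE mulrC; congr (_ * _).
exists l; split=> [x|].
  move=> /(coneP _ us)[c [c0 _] ->]; rewrite pairing_combination big_seq.
  by apply: sumr_ge0 => v /lE ->; rewrite mulr_ge0.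
apply/seteqP; split=> x.
  move=> [hx /(coneP _ ut)[d hd ex]]; split=> //.
  move/(coneP _ us): hx => [c hc ex']; rewrite ex' pairing_combination big_seq.
  have ecd : c = d by apply: (good_inj gS sS tS) => //; rewrite -ex -ex'.
  apply: big1 => v /lE ->; have [_|nt] := boolP (v \in t); first by rewrite mulr0.
  by rewrite ecd; case: hd => _ -> //; rewrite mul0r.
move=> [hx]; move: (hx) => /(coneP _ us)[c hc ->]; rewrite pairing_combination.
rewrite big_seq => /eqP; rewrite psumr_eq0 => [|v /lE ->]; last first.
  by case: hc => c0 _; rewrite mulr_ge0.
move=> /allP h; split; apply/coneP => //; exists c => //; last first.
  apply: combination_supported => //.
  split=> [|v nt]; first by case: hc.
  have [vs|] := boolP (v \in s); last by case: hc => _; apply.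
  by have := h v vs; rewrite vs lE //= nt mulr1 => /eqP.
split=> [|v nt]; first by case: hc.
have [vs|] := boolP (v \in s); last by case: hc => _; apply.
by have := h v vs; rewrite vs lE //= nt mulr1 => /eqP.
Qed.

Lemma good_regular_fan : is_regular_fan RR Sigma.
Proof.
split.
- move=> s sS; have [us [M uM sM]] := good_regular gS sS.
  have /choice[f hf] : forall i : 'I_(size s), exists j, nth 0 s i = row j M.
    by move=> i; have /sM /mapP[j _ e] := mem_nth 0 (ltn_ord i); exists j.
  exists M, f; split=> // i j e; apply/val_inj/eqP.
  by rewrite /= -(nth_uniq 0 _ _ us) // !hf e.
- move=> s F sS [l [l0 ->]]; have us := uS sS.
  have [t tS et] := good_face gS (fun v => pairing l (real_vector v) == 0) sS.
  have ut := uS tS.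
  have ts : {subset t <= s} by move=> v; rewrite et mem_filter => /andP[].
  exists t => //; apply/seteqP; split=> x.
    move=> [/(coneP _ us)[c hc ->]]; rewrite pairing_combination big_seq => /eqP.
    rewrite psumr_eq0 => [|v vs]; last first.
      by case: hc => c0 _; rewrite mulr_ge0 // l0 //; apply: mem_cone.
    move=> /allP h; have ht : supported t c.
      apply: (@supported_sub (filter (fun v => pairing l (real_vector v) == 0) s)).
        by move=> v; rewrite et.
      apply: supported_filter => // v vs nv; have := h v vs; rewrite vs /= mulf_eq0.
      by rewrite (negbTE nv) orbF => /eqP.
    by apply/coneP => //; exists c => //; apply: combination_sub.
  move=> /(coneP _ ut)[c hc ->]; split.
    apply/coneP => //; exists c; first exact: supported_sub hc.
    by apply/esym/combination_sub.
  rewrite pairing_combination big_seq; apply: big1 => v.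
  by rewrite et mem_filter => /andP[/eqP -> _]; rewrite mulr0.
- move=> s t sS tS; split; first exact: good_inter_face.
  by rewrite setIC; apply: good_inter_face.
Qed.

Lemma good_support : fan_support Sigma = @orthant RR N.
Proof.
apply/seteqP; split=> x.
  move=> [s sS /(coneP _ (uS sS))[c [c0 _] ->]] i; rewrite summxE big_seq.
  apply: sumr_ge0 => v vs; rewrite !mxE mulr_ge0 // ler0z.
  exact: (good_ge0 gS sS vs).
move=> /(good_cover gS)[s [c [sS hc <-]]]; exists s => //.
by apply/coneP; [apply: uS|exists c].
Qed.

(** * Subdivision of the cones containing two given rays *)

Section Star.
Variables (s0 : seq V) (p q : V).
Hypotheses (s0S : s0 \in Sigma) (ps0 : p \in s0) (qs0 : q \in s0) (pq : p != q).
Let w := p + q.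
Let both s := (p \in s) && (q \in s).

Definition replace u s : seq V := [seq if v == u then w else v | v <- s].

(** The sum w replaces p in one half of each cone and q in the other; the last list holds the common
    walls, with w but neither p nor q. *)
Definition star : seq (seq V) :=
  [seq s <- Sigma | ~~ both s] ++
  [seq replace p s | s <- Sigma & both s] ++
  [seq replace q s | s <- Sigma & both s] ++
  [seq filter (predC1 q) (replace p s) | s <- Sigma & both s].

(** The vector w has coordinates 1, 1 on p, q; as a ray of s it would have a second set of
    coordinates. *)
Lemma new_ray s : s \in Sigma -> w \notin s.
Proof.
move=> sS; apply/negP => ws.
pose c v : RR := (v == w)%:R; pose d v : RR := (v == p)%:R + (v == q)%:R.
have hc : supported s c.
  by split=> [v|v nv]; rewrite /c; [exact: ler0n|case: eqP nv => // ->; rewrite ws].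
have hd : supported s0 d.
  split=> [v|v nv]; first by rewrite addr_ge0.
  rewrite /d; case: eqP nv => [->|_]; first by rewrite ps0.
  by case: eqP => [->|_ _]; rewrite ?qs0 ?addr0.
have delta u t : uniq t -> u \in t -> \sum_(v <- t) (v == u)%:R *: real_vector v = real_vector u.
  move=> ut tu; rewrite (bigD1_seq u) //= eqxx scale1r big1 ?addr0 // => v /negbTE ->.
  by rewrite scale0r.
have e : c = d.
  apply: (good_inj gS sS s0S hc hd); rewrite /combination delta ?uS //.
  under eq_bigr do rewrite scalerDl.
  by rewrite big_split /= !delta ?uS // /real_vector map_mxD.
have ep := congr1 (fun f => f p) e; have eq := congr1 (fun f => f q) e.
move: ep eq; rewrite /c /d !eqxx (eq_sym q p) (negbTE pq) addr0 add0r.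
case: eqP => [e1 _|_ /eqP]; last by rewrite eq_sym oner_eq0.
case: eqP => [e2 _|_ /eqP]; last by rewrite eq_sym oner_eq0.
by move: pq; rewrite e1 -e2 eqxx.
Qed.

Lemma mem_replace u s v : s \in Sigma -> u \in s ->
  (v \in replace u s) = (v == w) || ((v \in s) && (v != u)).
Proof.
move=> sS us; apply/mapP/idP => [[x xs ->]|].
  by have [_|ne] /= := eqVneq x u; rewrite ?eqxx // xs ne orbT.
case/orP => [/eqP ->|/andP[vs ne]]; first by exists u => //; rewrite eqxx.
by exists v => //; rewrite (negbTE ne).
Qed.

Lemma replace_uniq u s : s \in Sigma -> u \in s -> uniq (replace u s).
Proof.
move=> sS us; have nw := new_ray sS; rewrite map_inj_in_uniq ?uS // => x y xs ys.
have [->|_] := eqVneq x u; have [->|_] := eqVneq y u => // e; move: nw.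
  by rewrite e ys.
by rewrite -e xs.
Qed.

Lemma star_case s' : s' \in star ->
  (s' \in Sigma /\ ~~ both s') \/
  exists s u, [/\ s \in Sigma, both s, u = p \/ u = q, {subset s' <= replace u s}
     & uniq s' /\ ~~ both s'].
Proof.
rewrite !mem_cat => /or4P[].
- by rewrite mem_filter => /andP[nb sS]; left.
- move=> /mapP[s]; rewrite mem_filter => /andP[bs sS] ->; right.
  have /andP[ps qs] := bs; exists s, p; split=> //; [by left|split; first exact: replace_uniq].
  rewrite /both mem_replace // eqxx andbF orbF; apply/nandP; left.
  by apply: contraNN (new_ray sS) => /eqP <-.
- move=> /mapP[s]; rewrite mem_filter => /andP[bs sS] ->; right.
  have /andP[ps qs] := bs; exists s, q; split=> //; [by right|split; first exact: replace_uniq].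
  rewrite /both andbC mem_replace // eqxx andbF orbF; apply/nandP; left.
  by apply: contraNN (new_ray sS) => /eqP <-.
- move=> /mapP[s]; rewrite mem_filter => /andP[bs sS] ->; right.
  have /andP[ps qs] := bs; exists s, p; split=> //; [by left| |split].
  + by move=> v; rewrite mem_filter => /andP[].
  + by rewrite filter_uniq // replace_uniq.
  + by rewrite /both !mem_filter /= eqxx andbF.
Qed.

(* Expresses coordinates for the subdivision in terms of the original rays.   *)
Definition collapse c v : RR :=
  if v == w then 0 else c v + ((v == p) || (v == q))%:R * c w.

Lemma collapse_combination s' c : s' \in star -> supported s' c ->
  exists2 s, s \in Sigma & supported s (collapse c) /\
    combination s (collapse c) = combination s' c.
Proof.
move=> s'S hc; have [c0 cs'] := hc.
case: (star_case s'S) => [[sS nb]|[s [u [sS bs hu sub [us' nb]]]]].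
  have nw := new_ray sS.
  have -> : collapse c = c.
    apply/funext => v; rewrite /collapse (cs' w nw) mulr0 addr0.
    by case: eqP => // ->; rewrite cs'.
  by exists s'.
have /andP[ps qs] := bs; have nw := new_ray sS; have us := uS sS.
have uin : u \in s by case: hu => ->.
have sub' : {subset s' <= w :: s}.
  by move=> v /sub; rewrite mem_replace // inE => /orP[->|/andP[-> _]] //; rewrite orbT.
exists s => //; split.
  split=> v; first by rewrite /collapse; case: ifP => // _; rewrite addr_ge0 // mulr_ge0.
  move=> vs; rewrite /collapse; case: eqP => // /eqP ne.
  rewrite cs'; last by apply: contra vs => /sub'; rewrite inE (negbTE ne).
  case: eqP vs => [->|_]; first by rewrite ps.
  by case: eqP => [->|_]; rewrite ?qs // mul0r addr0.
have uws : uniq (w :: s) by rewrite /= nw.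
rewrite -(combination_sub uws us' sub' hc) /combination big_cons.
have delta x : x \in s -> \sum_(v <- s) ((v == x)%:R * c w) *: real_vector v = c w *: real_vector x.
  move=> xs; rewrite (bigD1_seq x) //= eqxx mul1r big1 ?addr0 // => v /negbTE ->.
  by rewrite mul0r scale0r.
transitivity (\sum_(v <- s) (c v *: real_vector v + ((v == p)%:R * c w) *: real_vector v +
    ((v == q)%:R * c w) *: real_vector v)).
  rewrite [LHS]big_seq [RHS]big_seq; apply: eq_bigr => v vs; rewrite -!scalerDl; congr (_ *: _).
  rewrite /collapse ifN; last by apply: contra nw => /eqP <-.
  rewrite -addrA -mulrDl; congr (_ + _ * _).
  by case: (eqVneq v p) => [->|_]; [rewrite (negbTE pq) addr0|rewrite add0r].
rewrite !big_split /= !delta // /w /real_vector map_mxD scalerDr.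
by rewrite [RHS]addrC addrA.
Qed.

(** No cone of the subdivision contains both p and q, so one of these two coordinates is zero and
    the coordinate of w is recovered as the minimum of the collapsed coordinates at p and q. *)
Lemma collapse_inj s' t' c d : s' \in star -> t' \in star ->
  supported s' c -> supported t' d -> collapse c = collapse d -> c = d.
Proof.
move=> s'S t'S hc hd e.
have pw : p != w by apply/eqP => epw; have := new_ray s0S; rewrite -epw ps0.
have qw : q != w by apply/eqP => epw; have := new_ray s0S; rewrite -epw qs0.
have minE s'' f : s'' \in star -> supported s'' f ->
    f w = Num.min (collapse f p) (collapse f q).
  move=> s''S [f0 fs]; rewrite /collapse (negbTE pw) (negbTE qw) !eqxx orbT mul1r.
  have : ~~ both s'' by case: (star_case s''S) => [[]|[s [u [_ _ _ _ []]]]].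
  rewrite negb_and => /orP[/fs ->|/fs ->]; rewrite add0r.
    by rewrite min_l // lerDr.
  by rewrite min_r // lerDr.
have ew : c w = d w by rewrite (minE _ _ s'S hc) (minE _ _ t'S hd) e.
apply/funext => v; have [->|ne] := eqVneq v w; first by [].
have := congr1 (fun f => f v) e; rewrite /collapse (negbTE ne) ew.
exact: addIr.
Qed.

Lemma star_good : good_fan star.
Proof.
have mem1 s : s \in Sigma -> ~~ both s -> s \in star.
  by move=> sS nb; rewrite mem_cat mem_filter nb sS.
have mem2 s : s \in Sigma -> both s -> replace p s \in star.
  move=> sS bs; rewrite !mem_cat; apply/or4P; apply: Or42.
  by apply: map_f; rewrite mem_filter bs.
have mem3 s : s \in Sigma -> both s -> replace q s \in star.
  move=> sS bs; rewrite !mem_cat; apply/or4P; apply: Or43.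
  by apply: map_f; rewrite mem_filter bs.
have mem4 s : s \in Sigma -> both s -> filter (predC1 q) (replace p s) \in star.
  move=> sS bs; rewrite !mem_cat; apply/or4P; apply: Or44.
  by apply/mapP; exists s; rewrite // mem_filter bs.
split.
- move=> s' /star_case[[sS _]|[s [u [sS bs hu sub [us' nb]]]]]; first exact: (good_regular gS).
  split=> //; have [us [M uM sM]] := good_regular gS sS; have /andP[ps qs] := bs.
  have uin : u \in s by case: hu => ->.
  have [x [xs xu ex]] : exists x, [/\ x \in s, x != u & w = u + x].
    by case: hu => ->; [exists q; rewrite eq_sym|exists p; rewrite /w addrC].
  have /mapP[i _ ei] := sM u uin; have /mapP[j _ ej] := sM x xs.
  have ij : j != i by apply: contra xu => /eqP e; rewrite ei ej e.
  exists (add_row i j M); first by apply: add_row_unitmx; rewrite // eq_sym.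
  move=> v /sub; rewrite mem_replace // => hv; apply/mapP.
  case/orP: hv => [/eqP ->|/andP[vs vu]].
    by exists i; rewrite ?mem_enum // row_add_row eqxx scale1r ex ei ej.
  have /mapP[l _ el] := sM v vs; exists l; rewrite ?mem_enum // row_add_row.
  have -> : l == i = false by apply: contraNF vu => /eqP e; rewrite el ei e.
  by rewrite scale0r addr0.
- move=> s' C s'S; case: (star_case s'S) => [[sS nb]|[s [u [sS bs hu sub [us' nb]]]]].
    have [t tS et] := good_face gS C sS; exists t => //; apply: mem1 => //.
    by apply: contra nb => /andP[]; rewrite !et !mem_filter => /andP[_ h1] /andP[_ h2]; apply/andP.
  have /andP[ps qs] := bs; have uin : u \in s by case: hu => ->.
  have nw := new_ray sS.
  have sub' v : v \in s' -> v != w -> v \in s.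
    by move=> /sub; rewrite mem_replace // => /orP[/eqP ->|/andP[]]; rewrite ?eqxx.
  set F := filter C s'.
  have Fs' v : v \in F -> v \in s' by rewrite mem_filter => /andP[].
  have nF : ~~ both F by apply: contra nb => /andP[/Fs' ? /Fs' ?]; apply/andP.
  have pw : p != w by apply/eqP => epw; rewrite -epw ps in nw.
  have qw : q != w by apply/eqP => epw; rewrite -epw qs in nw.
  (* A face without w comes from [Sigma]. For one with w, replacing w by p and q gives a face of
     [Sigma], whose subdivision contains it. *)
  have [wF|nwF] := boolP (w \in F); last first.
    have [t tS et] := good_face gS (mem F) sS.
    have eF : t =i F.
      move=> v; rewrite et mem_filter /=; apply: andb_idr => vF; apply: sub'.
        exact: Fs'.
      by apply: contra nwF => /eqP <-.
    by exists t => //; apply: mem1 => //; rewrite /both !eF.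
  have [t tS et] := good_face gS [pred v | [|| v \in F, v == p | v == q]] sS.
  have tE v : v \in t = [|| (v \in F) && (v != w), v == p | v == q].
    rewrite et mem_filter /=; have [->|vp] := eqVneq v p; first by rewrite !orbT ps.
    have [->|vq] := eqVneq v q; first by rewrite !orbT qs.
    rewrite !orbF; apply/andP/andP => [[vF vs]|[vF vw]]; split=> //.
      by apply: contra nw => /eqP <-.
    exact/sub'/vw/Fs'.
  have bt : both t by rewrite /both !tE !eqxx !orbT.
  have /andP[pt qt] := bt.
  have [qF|nqF] := boolP (q \in F).
    exists (replace p t); first exact: mem2.
    move=> v; rewrite mem_replace // tE; have [->|vw] /= := eqVneq v w; first by rewrite wF.
    rewrite andbT; have [->|vp] := eqVneq v p.
      by rewrite andbF; apply/esym; apply: contraNF nF => pF; rewrite /both pF.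
    by rewrite andbT; have [->|vq] := eqVneq v q; rewrite ?qF ?orbT ?orbF.
  have [pF|npF] := boolP (p \in F).
    exists (replace q t); first exact: mem3.
    move=> v; rewrite mem_replace // tE; have [->|vw] /= := eqVneq v w; first by rewrite wF.
    rewrite andbT; have [->|vq] := eqVneq v q; first by rewrite andbF (negbTE nqF).
    by rewrite andbT orbF; have [->|vp] := eqVneq v p; rewrite ?pF ?orbT ?orbF.
  exists (filter (predC1 q) (replace p t)); first exact: mem4.
  move=> v; rewrite mem_filter mem_replace // tE /=.
  have [->|vw] /= := eqVneq v w; first by rewrite wF eq_sym qw.
  rewrite andbT; have [->|vq] /= := eqVneq v q; first by rewrite (negbTE nqF).
  by have [->|vp] /= := eqVneq v p; rewrite ?orbF ?andbT ?andbF ?(negbTE npF).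
- move=> s' t' c d s'S t'S hc hd e.
  have [s sS [hs es]] := collapse_combination s'S hc.
  have [t tS [ht et]] := collapse_combination t'S hd.
  apply: (collapse_inj s'S t'S hc hd); apply: (good_inj gS sS tS hs ht).
  by rewrite es et.
- move=> s' v /star_case[[sS _]|[s [u [sS bs hu sub [us' nb]]]]] vs i.
    exact: (good_ge0 gS sS vs).
  have /andP[ps qs] := bs; have uin : u \in s by case: hu => ->.
  move: (sub v vs); rewrite mem_replace // => /orP[/eqP ->|/andP[vs' _]].
    by rewrite mxE addr_ge0 ?(good_ge0 gS sS).
  exact: (good_ge0 gS sS vs').
- move=> x /(good_cover gS)[s [c [sS hc ex]]].
  have [bs|nb] := boolP (both s); last by exists s, c; split=> //; apply: mem1.
  have /andP[ps qs] := bs; have nw := new_ray sS; have [c0 cs] := hc.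
  have pw : p != w by apply/eqP => epw; rewrite -epw ps in nw.
  have qw : q != w by apply/eqP => epw; rewrite -epw qs in nw.
  (* With u the ray of smaller coordinate, c u * u + c u' * u' = c u * w + (c u' - c u) * u', a
     point of the half where w replaces u. *)
  have main u u' : u \in s -> u' \in s -> u != u' -> u != w -> u' != w -> c u <= c u' ->
      (forall v, ((v == p) || (v == q)) = ((v == u) || (v == u'))) -> replace u s \in star ->
      exists s' c', [/\ s' \in star, supported s' c' & combination s' c' = x].
    move=> us u's uu' uw u'w le epq rS.
    pose c' v : RR := if v == w then c u else if v == u then 0 else
       if v == u' then c u' - c u else c v.
    have hc' : supported (replace u s) c'.
      split=> v; rewrite /c'.
        by case: eqP => // _; case: eqP => // _; case: eqP => // _; rewrite subr_ge0.
      rewrite mem_replace // negb_or => /andP[vw]; rewrite (negbTE vw) negb_and negbK.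
      case: eqP => // _; rewrite orbF => vs; rewrite ifN ?cs //.
      by apply: contra vs => /eqP ->.
    exists (replace u s), c'; split=> //.
    have [t tS [ht <-]] := collapse_combination rS hc'.
    have ec : collapse c' = c.
      apply/funext => v; rewrite /collapse epq /c' eqxx.
      have [->|vw] := eqVneq v w; first by rewrite cs.
      have [->|vu] := eqVneq v u; first by rewrite mul1r add0r.
      have [->|vu'] := eqVneq v u'; first by rewrite mul1r subrK.
      by rewrite mul0r addr0.
    rewrite ec in ht *; rewrite -ex; apply: combination_supported => //; exact: uS.
  case/orP: (le_total (c p) (c q)) => le.
    by apply: (main p q) => //; apply: mem2.
  apply: (main q p) => //; [by rewrite eq_sym|by move=> v; rewrite orbC|exact: mem3].
Qed.

End Star.
End GoodFanTheory.

End StarSubdivisions.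

(** * Charts reached by star subdivisions *)

Section FanCharts.
Variables (RR : realType) (N : nat).

Definition fan_chart (a : 'M[int]_N) : Prop :=
  a \in unitmx /\ exists2 Sigma, good_fan RR Sigma & rows_of a \in Sigma.

Lemma fan_chart_uniq a : fan_chart a -> uniq (rows_of a).
Proof. by case=> _ [Sigma gS aS]; case: (good_regular gS aS). Qed.

Lemma fan_chart_ge0 a i j : fan_chart a -> 0 <= a i j.
Proof.
case=> _ [Sigma gS aS].
have := good_ge0 gS aS (map_f (fun l => row l a) (mem_enum 'I_N i)).
by move=> /(_ j); rewrite mxE.
Qed.

Lemma fan_chart_add_row a i j : i != j -> fan_chart a -> fan_chart (add_row i j a).
Proof.
move=> ij ca; have ua := fan_chart_uniq ca; have [uma [Sigma gS aS]] := ca.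
split; first exact: add_row_unitmx.
have /injectiveP inj_row : injectiveb (fun l => row l a) by [].
have mr l : row l a \in rows_of a by apply: map_f; rewrite mem_enum.
have ne : row i a != row j a by apply: contra ij => /eqP /inj_row ->.
exists (star Sigma (row i a) (row j a)).
  exact: (star_good gS aS (mr i) (mr j) ne).
rewrite !mem_cat; apply/or4P; apply: Or42; apply/mapP; exists (rows_of a).
  by rewrite mem_filter !mr.
rewrite /replace -map_comp; apply: eq_map => l /=; rewrite row_add_row.
have [->|nl] := eqVneq l i; first by rewrite eqxx scale1r.
by rewrite scale0r addr0 ifN //; apply: contra nl => /eqP /inj_row ->.
Qed.

Let e_ (j : 'I_N) : 'rV[int]_N := row j 1%:M.

Let e_inj : injective e_.
Proof.
move=> i j /rowP /(_ j); rewrite !mxE eqxx; case: eqP => // _ /eqP.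
Qed.

Definition orthant_fan : seq (seq 'rV[int]_N) :=
  [seq [seq row j 1%:M | j <- enum A] | A : {set 'I_N} <- enum {: {set 'I_N}}].

Lemma orthant_fan_good : good_fan RR orthant_fan.
Proof.
have memP s : s \in orthant_fan -> exists A : {set 'I_N}, s = [seq e_ j | j <- enum A].
  by move=> /mapP[A _ ->]; exists A.
have Aofan (A : {set 'I_N}) : [seq e_ j | j <- enum A] \in orthant_fan.
  by apply: map_f; rewrite mem_enum.
have uA (A : {set 'I_N}) : uniq [seq e_ j | j <- enum A].
  by rewrite map_inj_uniq ?enum_uniq.
have sA (A : {set 'I_N}) : {subset [seq e_ j | j <- enum A] <= rows_of 1%:M}.
  by move=> _ /mapP[j _ ->]; apply/mapP; exists j; rewrite ?mem_enum.
have u1 : uniq (rows_of 1%:M : seq 'rV[int]_N) by rewrite map_inj_uniq ?enum_uniq.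
have comb1 c i : combination (rows_of 1%:M) c 0 i = c (e_ i) :> RR.
  rewrite /combination summxE big_map big_enum /= (bigD1 i) //= !mxE eqxx mulr1.
  by rewrite big1 ?addr0 // => j ne; rewrite !mxE (negbTE ne) mulr0.
split.
- by move=> s /memP[A ->]; split=> //; exists 1%:M => //; apply: unitmx1.
- move=> s C /memP[A ->]; exists [seq e_ j | j <- enum [set j in A | C (e_ j)]] => // v.
  rewrite mem_filter; apply/mapP/andP => [[j]|[Cv /mapP[j]]].
    by rewrite mem_enum inE => /andP[jA Cj] ->; split=> //; apply: map_f; rewrite mem_enum.
  by rewrite mem_enum => jA ev; exists j => //; rewrite mem_enum inE jA -ev.
- move=> s t c d /memP[A ->] /memP[A' ->] hc hd e; apply/funext => v.
  have [/mapP[i _ ->]|nv] := boolP (v \in (rows_of 1%:M : seq 'rV[int]_N)).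
    rewrite -(comb1 c) -(comb1 d) (combination_sub u1 (uA A) (@sA A) hc).
    by rewrite (combination_sub u1 (uA A') (@sA A') hd) e.
  by rewrite (hc.2 v) ?(hd.2 v) //; apply: contra nv; apply: sA.
- by move=> s v /memP[A ->] /mapP[j _ ->] i; rewrite !mxE ler0n.
- move=> x x0; exists (rows_of 1%:M), (fun v => \sum_(j | v == e_ j) x 0 j); split.
  + apply/mapP; exists (setTfor 'I_N); first by rewrite mem_enum.
    by rewrite enum_setT /rows_of enumT.
  + split=> v; first by apply: sumr_ge0 => j _; apply: x0.
    move=> nv; apply: big1 => j /eqP ev; move: nv; rewrite ev.
    by rewrite map_f // mem_enum.
  + apply/rowP => i; rewrite comb1 (big_pred1 i) // => j.
    by rewrite (inj_eq e_inj) eq_sym.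
Qed.

Lemma fan_chart1 : fan_chart 1%:M.
Proof.
split; first exact: unitmx1.
exists orthant_fan; first exact: orthant_fan_good.
apply/mapP; exists (setTfor 'I_N); first by rewrite mem_enum.
by rewrite enum_setT /rows_of enumT.
Qed.

End FanCharts.

(** * Perron's algorithm *)

Section Perron.
Variables (RR : realType) (Phi : oagType) (N : nat) (v : 'I_N -> Phi).
Hypothesis v_ge0 : forall i, 0 <= v i.
Implicit Types (a : 'M[int]_N) (tau : 'I_N -> Phi) (e : 'cV[int]_N).

Lemma oag_mulrz_ge0 (x : Phi) (z : int) : 0 <= x -> 0 <= z -> 0 <= x *~ z.
Proof. by move=> hx; case: z => // n _; rewrite -pmulrn oag_mulrn_ge0. Qed.

Lemma oag_mulrz_gt0 (x : Phi) (z : int) : 0 < x -> 0 < z -> 0 < x *~ z.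
Proof. by move=> hx; case: z => // n n0; rewrite -pmulrn oag_mulrn_gt0. Qed.

Lemma oag_sum_eq0 (I : finType) (F : I -> Phi) : (forall i, 0 <= F i) ->
  \sum_i F i = 0 -> forall i, F i = 0.
Proof.
move=> F0 + i; rewrite (bigD1 i) //= => /oag_addr_eq0[] //.
exact: oag_sum_ge0.
Qed.

Definition value e : Phi := \sum_i v i *~ e i 0.

(* The chart a of some fan, with the values tau of its coordinates.           *)
Definition toric_state a tau : Prop :=
  [/\ fan_chart RR a, forall j, 0 <= tau j
    & forall i, v i = \sum_j tau j *~ a j i].

Lemma toric_state1 : toric_state 1%:M v.
Proof.
split=> // [|i]; first exact: fan_chart1.
rewrite (bigD1 i) //= mxE eqxx mulr1z big1 ?addr0 // => j ne.
by rewrite mxE (negbTE ne) mulr0z.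
Qed.

(** The vector [a *m e] holds the exponents, in the coordinates of the chart, of the Laurent
    monomial with exponents [e]. *)
Lemma valueE a tau e : toric_state a tau -> value e = \sum_l tau l *~ (a *m e) l 0.
Proof.
case=> _ _ hv; rewrite /value; under eq_bigr => i _ do rewrite hv mulrz_suml.
rewrite exchange_big; apply: eq_bigr => l _; rewrite mxE mulrz_sumr.
by apply: eq_bigr => i _; rewrite mulrzA.
Qed.

(** Each step blows up y_i = y_j = 0 and passes to the chart with coordinates y_i and y_j / y_i,
    which contains the center because tau i <= tau j. Only coordinates of positive value, called
    active, take part. *)
Inductive blowup : 'M[int]_N -> ('I_N -> Phi) -> 'M[int]_N -> ('I_N -> Phi) -> Prop :=
| BlowupRefl a tau : blowup a tau a tau
| BlowupStep a tau i j a' tau' : i != j -> 0 < tau i -> tau i <= tau j ->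
    blowup (add_row i j a) (fun l => if l == j then tau j - tau i else tau l) a' tau' ->
    blowup a tau a' tau'.

Lemma blowup_trans a1 t1 a2 t2 a3 t3 :
  blowup a1 t1 a2 t2 -> blowup a2 t2 a3 t3 -> blowup a1 t1 a3 t3.
Proof. by elim=> // a tau i j a' tau' ij ti le _ IH /IH; apply: BlowupStep. Qed.

Lemma blowup_state a tau a' tau' :
  blowup a tau a' tau' -> toric_state a tau -> toric_state a' tau'.
Proof.
elim=> // {a'} {tau'} {}a {}tau i j a' tau' ij ti le _ IH [ca t0 hv]; apply: IH; split.
- exact: fan_chart_add_row.
- by move=> l; case: eqP => // _; rewrite oag_subr_ge0.
- move=> m; rewrite hv (bigD1 j) //= (bigD1 i) //= [RHS](bigD1 j) //= [X in _ = _ + X](bigD1 i) //=.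
  have -> : add_row i j a j m = a j m by rewrite add_rowE eq_sym (negbTE ij) mul0r addr0.
  have -> : add_row i j a i m = a i m + a j m by rewrite add_rowE eqxx mul1r.
  rewrite eqxx (negbTE ij) mulrzBl mulrzDr (addrC (tau i *~ a i m) (tau i *~ a j m)) !addrA subrK.
  congr (_ + _).
  apply: eq_bigr => l /andP[lj li].
  by rewrite add_rowE (negbTE li) (negbTE lj) mul0r addr0.
Qed.

Lemma add_row_mulmx i j a e l :
  (add_row i j a *m e) l 0 = (a *m e) l 0 + (l == i)%:R * (a *m e) j 0.
Proof.
rewrite !mxE mulr_sumr -big_split; apply: eq_bigr => m _.
by rewrite add_rowE mulrDl mulrA.
Qed.

Lemma blowup_active a tau a' tau' l : blowup a tau a' tau' -> 0 < tau' l -> 0 < tau l.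
Proof.
elim=> // {a'} {tau'} {}a {}tau i j a' tau' ij ti le _ IH /IH.
by case: eqP => // -> _; apply: lt_le_trans le.
Qed.

Lemma blowup_inactive a tau a' tau' l e : blowup a tau a' tau' ->
  ~~ (0 < tau l) -> (a' *m e) l 0 = (a *m e) l 0.
Proof.
elim=> // {a'} {tau'} {}a {}tau i j a' tau' ij ti le _ IH nl.
have li : l != i by apply: contra nl => /eqP ->.
rewrite IH ?add_row_mulmx ?(negbTE li) ?mul0r ?addr0 //.
by case: eqP nl => // -> /negP[]; apply: lt_le_trans le.
Qed.

Definition nonneg_on_active a tau e : Prop := forall l, 0 < tau l -> 0 <= (a *m e) l 0.

Lemma blowup_nonneg a tau a' tau' e : blowup a tau a' tau' ->
  nonneg_on_active a tau e -> nonneg_on_active a' tau' e.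
Proof.
elim=> // {a'} {tau'} {}a {}tau i j a' tau' ij ti le _ IH h; apply: IH => l hl.
have tj := lt_le_trans ti le.
rewrite add_row_mulmx addr_ge0 ?mulr_ge0 ?ler0n ?h //.
by move: hl; case: eqP => [->|].
Qed.

(* The bounds -m <= d <= M for the exponents d of a Laurent monomial in the   *)
(* coordinates of positive value improve after finitely many steps, as long   *)
(* as exponents of both signs remain: a step replaces one of two extreme      *)
(* exponents M, -m by M - m.                                                  *)
Lemma principalize_bounded D : forall a tau e (M m : nat), (M + m <= D)%N ->
  (forall l, 0 < tau l -> - (m%:Z) <= (a *m e) l 0 <= M%:Z) ->
  exists a' tau', blowup a tau a' tau' /\
    (nonneg_on_active a' tau' e \/ nonneg_on_active a' tau' (- e)).
Proof.
pose extreme a tau e (M m : nat) := [pred l | (0 < tau l)%R &&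
  (((a *m e) l 0 == M%:Z) || ((a *m e) l 0 == - m%:Z))] : pred 'I_N.
elim: D => [|D IHD] a tau e M m.
  rewrite leqn0 addn_eq0 => /andP[/eqP -> /eqP ->] h; exists a, tau.
  split; first exact: BlowupRefl.
  by left=> l /h /andP[]; rewrite oppr0.
(* Inner induction on the number of active exponents equal to M or -m; when one of the two bounds is
   no longer attained, it decreases. *)
have [n] := ubnP #|extreme a tau e M m|; elim: n a tau M m => // n IHn a tau M m lec leD bd.
have [M0|Mpos] := posnP M.
  exists a, tau; split; [exact: BlowupRefl|right=> l /bd /andP[_]].
  have -> : (a *m - e) l 0 = - (a *m e) l 0 by rewrite mulmxN mxE.
  by rewrite M0 oppr_ge0.
have [m0|mpos] := posnP m.
  exists a, tau; split; [exact: BlowupRefl|left=> l /bd /andP[]].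
  by rewrite m0 oppr0.
have [/existsP[i /andP[ti /eqP di]]|noM] := boolP [exists l, (0 < tau l) && ((a *m e) l 0 == M%:Z)]; last first.
  apply: (IHD a tau e M.-1 m); first by rewrite -ltnS -addSn prednK.
  move=> l tl; have := bd l tl; have : (a *m e) l 0 != M%:Z.
    by apply: contraNneq noM => e1; apply/existsP; exists l; rewrite tl e1 eqxx.
  by move: ((a *m e) l 0) => z; lia.
have [/existsP[j /andP[tj /eqP dj]]|nom] := boolP [exists l, (0 < tau l) && ((a *m e) l 0 == - m%:Z)]; last first.
  apply: (IHD a tau e M m.-1); first by rewrite -ltnS -addnS prednK.
  move=> l tl; have := bd l tl; have : (a *m e) l 0 != - m%:Z.
    by apply: contraNneq nom => e1; apply/existsP; exists l; rewrite tl e1 eqxx.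
  by move: ((a *m e) l 0) => z; lia.
have ij : i != j.
  by apply/eqP => eij; move: dj; rewrite -eij di; lia.
have main u w : u != w -> 0 < tau u -> tau u <= tau w ->
    (a *m e) u 0 + (a *m e) w 0 = M%:Z - m%:Z -> extreme a tau e M m u ->
    exists a' tau', blowup a tau a' tau' /\
    (nonneg_on_active a' tau' e \/ nonneg_on_active a' tau' (- e)).
  move=> uw tu le euw exu.
  pose tau1 l := if l == w then tau w - tau u else tau l.
  have act l : 0 < tau1 l -> 0 < tau l.
    by rewrite /tau1; case: eqP => // -> _; apply: lt_le_trans le.
  have [||| a' [tau' [b h]]] := IHn (add_row u w a) tau1 M m.
  - apply: (@leq_trans #|extreme a tau e M m|); last by rewrite -ltnS.
    apply: proper_card; apply/properP; split; last first.
      (* M - m is strictly between -m and M, since both M and m are positive here. *)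
      exists u => //; rewrite !inE /= add_row_mulmx eqxx mul1r euw.
      rewrite negb_and; apply/orP; right; lia.
    apply/fintype.subsetP => l; rewrite !inE => /andP[/act tl]; rewrite tl add_row_mulmx.
    have [->|_] := eqVneq l u; last by rewrite mul0r addr0.
    by move: exu => /andP[_ ->].
  - by [].
  - move=> l /act tl; rewrite add_row_mulmx; have [->|_] := eqVneq l u.
      by rewrite mul1r euw; lia.
    by rewrite mul0r addr0 bd.
  - exists a', tau'; split=> //; exact: BlowupStep uw tu le b.
case/orP: (oag_le_total (tau i) (tau j)) => le.
  by apply: (main i j) => //; [rewrite di dj|rewrite /extreme /= ti di eqxx].
apply: (main j i) => //; first by rewrite eq_sym.
  by rewrite di dj addrC.
by rewrite /extreme /= tj dj eqxx orbT.
Qed.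

Lemma principalize a tau e : exists a' tau', blowup a tau a' tau' /\
  (nonneg_on_active a' tau' e \/ nonneg_on_active a' tau' (- e)).
Proof.
pose M := (\sum_l `|(a *m e)%R l 0%R|)%N.
apply: (@principalize_bounded (M + M)%N a tau e M M) => // l _.
have : (`|(a *m e)%R l 0%R| <= M)%N by rewrite /M (bigD1 l) //= leq_addr.
by move: ((a *m e) l 0) => z; lia.
Qed.

Lemma value0_active a tau e : toric_state a tau -> nonneg_on_active a tau e ->
  value e = 0 -> forall l, 0 < tau l -> (a *m e) l 0 = 0.
Proof.
move=> st he; rewrite (valueE e st) => h0 l tl.
have [_ t0 _] := st.
have ge0 i : 0 <= tau i *~ (a *m e) i 0.
  have [ti|nti] := boolP (0 < tau i); first by apply/oag_mulrz_ge0/he.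
  have -> : tau i = 0 by apply/eqP; rewrite eq_le t0 andbT oag_leNgt.
  by rewrite mul0rz.
have := oag_sum_eq0 ge0 h0 l; apply: contra_eq => ne.
have gt0 : 0 < (a *m e) l 0 by rewrite lt_neqAle eq_sym ne he.
by have := oag_mulrz_gt0 tl gt0; rewrite lt_neqAle eq_sym => /andP[].
Qed.

Lemma valueN e : value (- e) = - value e.
Proof. by rewrite /value -sumrN; apply: eq_bigr => i _; rewrite mxE mulrNz. Qed.

(** The monomials are treated one at a time, and [blowup_nonneg] preserves what has been
    achieved. *)
Lemma blowup_refine a tau (E : seq 'cV[int]_N) : toric_state a tau ->
  (forall e, e \in E -> 0 <= value e) -> exists a' tau', blowup a tau a' tau' /\
  forall e, e \in E -> nonneg_on_active a' tau' e.
Proof.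
move=> st; elim: E => [|e E IH] hE; first by exists a, tau; split=> //; apply: BlowupRefl.
have [|a1 [t1 [b1 h1]]] := IH; first by move=> x xE; apply: hE; rewrite inE xE orbT.
have [a2 [t2 [b2 h2]]] := principalize a1 t1 e.
have b := blowup_trans b1 b2; exists a2, t2; split=> // x.
rewrite inE => /orP[/eqP ->|xE]; last exact: blowup_nonneg b2 (h1 x xE).
(* If the exponents come out nonpositive, the value, being nonnegative, is 0, and so are the active
   exponents. *)
case: h2 => // hN l tl; have st2 := blowup_state b st.
have v0 : value e = 0.
  have h0 := hE e (mem_head _ _); apply/eqP; rewrite eq_le h0 andbT.
  have [_ t0 _] := st2; rewrite -(oag_leD2rE (- value e)) subrr add0r -valueN (valueE _ st2).
  apply: oag_sum_ge0 => i _; have [ti|nti] := boolP (0 < t2 i); first by apply/oag_mulrz_ge0/hN.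
  have -> : t2 i = 0 by apply/eqP; rewrite eq_le t0 andbT oag_leNgt.
  by rewrite mul0rz.
have := value0_active st2 hN; rewrite valueN v0 oppr0 => /(_ erefl l tl).
by rewrite mulmxN mxE => /eqP; rewrite oppr_eq0 => /eqP ->.
Qed.

Definition active tau := #|[pred l | 0 < tau l]|.

Lemma minimal_toric_state : exists a tau, toric_state a tau /\
  forall a' tau', toric_state a' tau' -> (active tau <= active tau')%N.
Proof.
suff main n a tau : toric_state a tau -> (active tau < n)%N ->
    exists a tau, toric_state a tau /\
    forall a' tau', toric_state a' tau' -> (active tau <= active tau')%N.
  exact: main toric_state1 (ltnSn _).
elim: n a tau => // n IH a tau st lt.
have [[a' [tau' [st' lt']]]|none] := pselect (exists a' tau', toric_state a' tau' /\
   (active tau' < active tau)%N); first by apply: (IH a' tau') => //; apply: leq_trans lt' _.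
exists a, tau; split=> // a' tau' st'; rewrite leqNgt; apply/negP => lt'.
by apply: none; exists a', tau'.
Qed.

(** * Charts with the fewest coordinates of positive value *)

Section Minimal.
Variables (a : 'M[int]_N) (tau : 'I_N -> Phi).
Hypothesis st : toric_state a tau.
Hypothesis minimal : forall a' tau', toric_state a' tau' -> (active tau <= active tau')%N.

Lemma minimal_blowup_active a' tau' l : blowup a tau a' tau' -> (0 < tau' l) = (0 < tau l).
Proof.
move=> b; have sub : [pred l | 0 < tau' l] \subset [pred l | 0 < tau l].
  by apply/fintype.subsetP => i; rewrite !inE; apply: blowup_active b.
have eqc : #|[pred l | 0 < tau' l]| = #|[pred l | 0 < tau l]|.
  apply/eqP; rewrite eqn_leq subset_leq_card //=; apply: minimal.
  exact: blowup_state b st.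
by have /(_ l) := subset_cardP eqc sub; rewrite !inE.
Qed.

(** A relation is a Laurent monomial of value 0. Once [principalize] has given its active exponents
    one sign, they vanish; the inactive ones were zero and are not altered by blowing up. By
    minimality no coordinate becomes inactive, so all exponents vanish. *)
Lemma minimal_independent (c : 'cV[int]_N) : (forall l, ~~ (0 < tau l) -> c l 0 = 0) ->
  \sum_l tau l *~ c l 0 = 0 -> c = 0.
Proof.
move=> c0 sum0; have [[ua _] _ _] := st.
pose e := invmx a *m c; have ae : a *m e = c by rewrite mulmxA mulmxV // mul1mx.
have v0 : value e = 0 by rewrite (valueE _ st) ae.
have [a' [tau' [b h]]] := principalize a tau e.
have st' := blowup_state b st; have [[ua' _] _ _] := st'.
have act l : 0 < tau' l -> (a' *m e) l 0 = 0.
  case: h => h; first exact: value0_active.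
  move=> tl; have := value0_active st' h; rewrite valueN v0 oppr0 => /(_ erefl l tl).
  by rewrite mulmxN mxE => /eqP; rewrite oppr_eq0 => /eqP.
suff a'e : a' *m e = 0 by rewrite -ae -(mulKmx ua' e) a'e !mulmx0.
apply/matrixP => l z; rewrite (ord1 z) [RHS]mxE.
have [tl|nl] := boolP (0 < tau l); first by apply: act; rewrite (minimal_blowup_active _ b).
by rewrite (blowup_inactive e b nl) ae c0.
Qed.

Lemma minimal_blowup a' tau' : blowup a tau a' tau' ->
  toric_state a' tau' /\
  forall a2 tau2, toric_state a2 tau2 -> (active tau' <= active tau2)%N.
Proof.
move=> b; split; first exact: blowup_state b st.
move=> a2 t2 /minimal; apply: leq_trans; apply: subset_leq_card.
by apply/fintype.subsetP => i; rewrite !inE; apply: blowup_active b.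
Qed.

End Minimal.
End Perron.

(** * The strict transform at the center of the valuation *)

Section LocalRingInField.
Variables (A : comNzRingType) (K : fieldType) (Phi : oagType) (nu : valuation K Phi).
Variables (theta : {rmorphism A -> K}) (J : ideal A) (p : subscheme_point J).
Hypothesis J_ker : forall f, J f <-> theta f = 0.
Hypothesis theta_ge0 : forall f, vge nu 0 (theta f).
Hypothesis p_center : forall f, p f <-> vgt nu 0 (theta f).
Local Notation B := (local_ring p).

Lemma outside_center f : ~ p f -> theta f != 0.
Proof. by move=> nf; apply/eqP => e; apply: nf; apply/p_center; rewrite e; left. Qed.

Definition local_to_field (z : B) : K := theta (loc_num z) / theta (loc_den z).

Lemma local_to_fieldE a b (nb : ~ p b) : local_to_field (Defs.frac a nb) = theta a / theta b.
Proof.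
have [r nr /J_ker] := num_den a nb.
have d0 := outside_center (@denP _ _ p (Defs.frac a nb)); have b0 := outside_center nb.
rewrite rmorphM rmorphB !rmorphM => /eqP; rewrite mulf_eq0 (negbTE (outside_center nr)) /=.
rewrite subr_eq0 => /eqP e.
by rewrite /local_to_field; apply/eqP; rewrite eqr_div //; apply/eqP.
Qed.

Fact local_to_field_zmod_morphism : zmod_morphism local_to_field.
Proof.
elim/frac_ind=> a b nb; elim/frac_ind=> c d nd.
have -> : Defs.frac a nb - Defs.frac c nd = loc_add (Defs.frac a nb) (loc_opp (Defs.frac c nd)) by [].
rewrite loc_oppE loc_addE !local_to_fieldE !rmorphD !rmorphM rmorphN.
have b0 := outside_center nb; have d0 := outside_center nd.
by field; rewrite b0 d0.
Qed.

Fact local_to_field_monoid_morphism : monoid_morphism local_to_field.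
Proof.
split; first by rewrite (local_to_fieldE 1) rmorph1 divr1.
elim/frac_ind=> a b nb; elim/frac_ind=> c d nd.
have -> : Defs.frac a nb * Defs.frac c nd = loc_mul (Defs.frac a nb) (Defs.frac c nd) by [].
by rewrite loc_mulE !local_to_fieldE !rmorphM mulf_div.
Qed.

HB.instance Definition _ :=
  GRing.isZmodMorphism.Build B K local_to_field local_to_field_zmod_morphism.
HB.instance Definition _ :=
  GRing.isMonoidMorphism.Build B K local_to_field local_to_field_monoid_morphism.

Lemma local_to_field_germ f : local_to_field (germ p f) = theta f.
Proof. by rewrite local_to_fieldE rmorph1 divr1. Qed.

Lemma frac_germ a b (nb : ~ p b) : Defs.frac a nb * germ p b = germ p a.
Proof.
have -> : Defs.frac a nb * germ p b = loc_mul (Defs.frac a nb) (germ p b) by [].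
by rewrite loc_mulE; apply: frac_eqW; rewrite !mulr1.
Qed.

Lemma local_to_field_inj : injective local_to_field.
Proof.
move=> x y /eqP; rewrite -subr_eq0 -rmorphB => /eqP e; apply/eqP; rewrite -subr_eq0; apply/eqP.
move: (x - y) e; elim/frac_ind=> a b nb; rewrite /= local_to_fieldE => /eqP.
rewrite mulf_eq0 invr_eq0 (negbTE (outside_center nb)) orbF => /eqP /J_ker Ja.
by apply/frac_eqP; exists 1; [case: (point_prime p)|rewrite mul1r mulr1 mul0r subr0].
Qed.

Lemma local_to_field_ge0 z : vge nu 0 (local_to_field z).
Proof.
elim/frac_ind: z => a b nb; rewrite local_to_fieldE -[0]addr0; apply: vgeM => //.
have b0 := outside_center nb; right; rewrite valuationV //.
have -> : nu (theta b) = 0; last by rewrite oppr0.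
have [/eqP|ge0] := theta_ge0 b; first by rewrite (negbTE b0).
apply/eqP; rewrite eq_le ge0 andbT oag_leNgt; apply/negP => lt.
by apply: nb; apply/p_center; right.
Qed.

Lemma local_to_field_gt0 z : nonunits B z <-> vgt nu 0 (local_to_field z).
Proof.
split=> [nz|hz [y e]].
  elim/frac_ind: z nz => a b nb nz; rewrite local_to_fieldE.
  have [pa|na] := pselect (p a).
    have := local_to_field_ge0 (Defs.frac 1 nb); rewrite local_to_fieldE rmorph1 mul1r => h.
    by rewrite mulrC -[0]addr0; apply: vgtM => //; apply/p_center.
  case: nz; exists (Defs.frac b na).
  have -> : Defs.frac a nb * Defs.frac b na = loc_mul (Defs.frac a nb) (Defs.frac b na) by [].
  by rewrite loc_mulE; apply: frac_eqW; rewrite mulr1 mul1r mulrC.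
have := vgtM (local_to_field_ge0 y) hz; rewrite -rmorphM mulrC e rmorph1 addr0.
by case=> [/eqP|]; rewrite ?oner_eq0 // valuation1 ltxx.
Qed.

(** Ideals of the local ring are contracted to [C], through which A acts on it. In the application
    [C] is the polynomial ring over R. *)
Lemma local_ring_noetherian (C : comNzRingType) (h : {rmorphism A -> C}) :
  is_noetherian C -> (forall c, exists a, h a = c) -> (forall a, h a = 0 -> J a) ->
  is_noetherian B.
Proof.
move=> noethC surj ker I hI.
pose I' : set C := [set c | exists a, h a = c /\ I (germ p a)].
have hI' : is_ideal I'.
  split.
  - by exists 0; rewrite !rmorph0; split=> //; apply: is_ideal0.
  - move=> _ _ [a [<- Ia]] [b [<- Ib]]; exists (a + b); rewrite !rmorphD; split=> //.
    exact: is_idealD.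
  - move=> c _ [b [<- Ib]]; have [a <-] := surj c; exists (a * b); rewrite !rmorphM.
    by split=> //; apply: is_idealMl.
have [s es] := noethC I' hI'.
have /choice[g hg] : forall c, exists a, c \in s -> h a = c /\ I (germ p a).
  move=> c; have [cs|] := boolP (c \in s); last by exists 0.
  have : I' c by rewrite es; apply: generator_ideal_gen.
  by case=> a ha; exists a.
have hgen := @ideal_gen_ideal _ [set` [seq germ p (g c) | c <- s]].
exists [seq germ p (g c) | c <- s]; apply/seteqP; split; last first.
  by apply: ideal_gen_sub => // _ /= /mapP[c cs ->]; case: (hg c cs).
move=> z; elim/frac_ind: z => a b nb Iz.
have : I' (h a).
  by exists a; split=> //; rewrite -(frac_germ a nb); apply: is_idealMr.
rewrite es => /ideal_gen_seqP[c ec].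
have /choice[c' hc'] : forall i, exists a, h a = c i by move=> i; apply: surj.
have Jd : J (a - \sum_i c' i * g s`_i).
  apply: ker; rewrite rmorphB ec rmorph_sum; apply/eqP; rewrite subr_eq0; apply/eqP.
  apply: eq_bigr => i _; rewrite rmorphM hc'.
  by have [->] := hg s`_i (mem_nth 0 (ltn_ord i)).
have ea : germ p a = \sum_i germ p (c' i) * germ p (g s`_i).
  apply: local_to_field_inj; rewrite local_to_field_germ rmorph_sum.
  move/J_ker: Jd; rewrite rmorphB rmorph_sum => /eqP; rewrite subr_eq0 => /eqP ->.
  by apply: eq_bigr => i _; rewrite !rmorphM /= !local_to_field_germ.
have -> : Defs.frac a nb = Defs.frac 1 nb * germ p a.
  have -> : Defs.frac 1 nb * germ p a = loc_mul (Defs.frac 1 nb) (germ p a) by [].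
  by rewrite loc_mulE; apply: frac_eqW; rewrite mul1r !mulr1.
apply: is_idealMl => //; rewrite ea; apply: ideal_sum => // i _; apply: is_idealMl => //.
apply: generator_ideal_gen; apply: (map_f (fun c => germ p (g c))).
exact: mem_nth.
Qed.

Definition local_embedding : {rmorphism B -> K} := local_to_field.

End LocalRingInField.

(** * Laurent monomials and their values *)

Section LaurentMonomials.
Variables (K : fieldType) (Phi : oagType) (nu : valuation K Phi).
Variables (N : nat) (x : 'I_N -> K).
Hypothesis x_neq0 : forall i, x i != 0.
Implicit Types (e d : 'cV[int]_N).

Definition laurent e : K := \prod_i x i ^ e i 0.

Lemma laurent_neq0 e : laurent e != 0.
Proof. by apply/prodf_neq0 => i _; rewrite expfz_neq0. Qed.

Lemma laurentD e d : laurent (e + d) = laurent e * laurent d.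
Proof. by rewrite -big_split; apply: eq_bigr => i _; rewrite mxE expfzDr. Qed.

Lemma laurentN e : laurent (- e) = (laurent e)^-1.
Proof.
apply: (mulIf (laurent_neq0 e)); rewrite -laurentD addNr mulVf ?laurent_neq0 //.
by rewrite /laurent big1 // => i _; rewrite mxE expr0z.
Qed.

Lemma laurent_delta i : laurent (delta_mx i 0) = x i.
Proof.
rewrite /laurent (bigD1 i) //= mxE !eqxx expr1z big1 ?mulr1 // => j ne.
by rewrite mxE (negbTE ne) expr0z.
Qed.

Lemma valuation_exprz y z : y != 0 -> nu (y ^ z) = nu y *~ z.
Proof.
move=> y0; case: z => n; first by rewrite -exprnP valuationX // pmulrn.
have -> : y ^ Negz n = (y ^+ n.+1)^-1 by [].
by rewrite valuationV ?expf_neq0 // valuationX.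
Qed.

Lemma laurent_value e : nu (laurent e) = value (fun i => nu (x i)) e.
Proof.
rewrite valuation_prod => [|i]; last exact: expfz_neq0.
by apply: eq_bigr => i _; rewrite valuation_exprz.
Qed.

Lemma laurent_mulmx (b : 'M[int]_N) d : laurent (b *m d) = \prod_j laurent (col j b) ^ d j 0.
Proof.
have prodXz (I : finType) (F : I -> K) (z : int) : (\prod_i F i) ^ z = \prod_i F i ^ z.
  by rewrite (big_morph (fun y => y ^ z) (fun y1 y2 => expfzMl y1 y2 z) (exp1rz _ z)).
under eq_bigr => j _ do rewrite prodXz.
rewrite exchange_big; apply: eq_bigr => i _; rewrite mxE.
have -> (F : 'I_N -> int) : x i ^ (\sum_j F j) = \prod_j x i ^ F j.
  by apply: (big_morph (fun z => x i ^ z)) => [z1 z2|]; rewrite ?expfzDr ?expr0z.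
by apply: eq_bigr => j _; rewrite exprz_exp mxE.
Qed.

End LaurentMonomials.

Definition multinom_col (N : nat) (m : 'X_{1..N}) : 'cV[int]_N := \col_i (m i)%:Z.

Lemma multinom_col_parts (N : nat) (e : 'cV[int]_N) :
  exists m n, e = multinom_col m - multinom_col n.
Proof.
exists [multinom (if (0 <= e i 0)%R then `|e i 0%R|%N else 0%N) | i < N],
       [multinom (if (0 <= e i 0)%R then 0%N else `|e i 0%R|%N) | i < N].
apply/colP => i; rewrite !mxE !mnmE.
by move: (e i 0) => z; case: ifP; lia.
Qed.

(** * A chart of the strict transform inside Frac R *)

Section Chart.
Variables (RR : realType) (k : fieldType) (R : idomainType) (iota : {rmorphism k -> R}).
Hypothesis R_noetherian : is_noetherian R.
Hypothesis k_representatives : is_field_of_representatives iota.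
Variables (Phi : oagType) (nu : dominating_valuation R Phi).
Hypothesis nu_rational : is_rational nu.
Variables (N : nat) (xi : 'I_N -> R).
Hypothesis xi_maximal : forall i, nonunits R (xi i).
Hypothesis xi_neq0 : forall i, xi i != 0.
Hypothesis xi_generate : generates_algebra (gr_algebra_map nu iota)
  (fun i => initial_form nu (xi i)).
Local Notation S := {powerseries k[N]}.
Local Notation A := {mpoly {powerseries k[N]}[N]}.
Local Notation K := {fraction R}.
Local Notation "x %:F" := (tofrac x).
Variable pi : {rmorphism S -> R}.
Hypothesis pi_const : forall c : k, pi (psC c) = iota c.
Hypothesis pi_var : forall i, pi (psX k i) = xi i.

Local Notation v := (fun i => nu (xi i)%:F).
Local Notation wt := (weight v).
Local Notation X := (laurent (fun i => (xi i)%:F)).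

Let xiF_neq0 i : (xi i)%:F != 0. Proof. by rewrite tofrac_eq0. Qed.

Lemma xi_gt0 i : 0 < v i.
Proof.
have /(dom_ideal nu)[/eqP|//] := @xi_maximal i.
by rewrite (negbTE (xiF_neq0 i)).
Qed.

Lemma laurent_multinom m : X (multinom_col m) = (xi_mono xi m)%:F.
Proof. by rewrite rmorph_prod; apply: eq_bigr => i _; rewrite mxE rmorphXn. Qed.

Lemma value_multinom m : value v (multinom_col m) = wt m.
Proof. by apply: eq_bigr => i _; rewrite mxE pmulrn. Qed.

Section Theta.
Variables (a : 'M[int]_N) (tau : 'I_N -> Phi).
Hypothesis st : toric_state RR v a tau.

Let ca : fan_chart RR a. Proof. by case: st. Qed.
Let ua : a \in unitmx. Proof. by case: ca. Qed.
Let b := invmx a.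

(** The columns of the inverse matrix solve xi_i = y_1^(a_1i) ... y_N^(a_Ni) for the y_j. *)
Definition chart_var (j : 'I_N) : K := X (col j b).
Local Notation Y := chart_var.

Lemma chart_var_neq0 j : Y j != 0.
Proof. exact: laurent_neq0. Qed.

Lemma mulmx_col_inv j : a *m col j b = delta_mx j 0.
Proof. by rewrite colE mulmxA mulmxV // mul1mx. Qed.

Lemma chart_var_value j : nu (Y j) = tau j.
Proof.
rewrite laurent_value // (valueE _ st) mulmx_col_inv (bigD1 j) //= mxE !eqxx mulr1z.
by rewrite big1 ?addr0 // => l ne; rewrite mxE (negbTE ne) mulr0z.
Qed.

Lemma laurent_chart e : X e = \prod_l Y l ^ (a *m e) l 0.
Proof. by rewrite -laurent_mulmx // mulKmx. Qed.

Definition theta : {rmorphism A -> K} := mmap (@tofrac R \o pi) Y.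

Lemma thetaC g : theta g%:MP = (pi g)%:F.
Proof. exact: mmapC. Qed.

Lemma thetaX j : theta 'X_j = Y j.
Proof. by rewrite /theta /= mmapX mmap1U. Qed.

Lemma theta_toric i : theta (toric_monomial k a i) = (xi i)%:F.
Proof.
rewrite /toric_monomial rmorph_prod -[RHS](laurent_delta (fun i => (xi i)%:F)) laurent_chart.
apply: eq_bigr => j _; rewrite rmorphXn /= thetaX -colE mxE.
by rewrite -[in RHS](gez0_abs (fan_chart_ge0 j i ca)).
Qed.

Let II := inverse_image pi a.
Let hII : is_ideal II. Proof. exact: ideal_gen_ideal. Qed.

Lemma theta_inverse_image f : II f -> theta f = 0.
Proof.
move: f; apply: (@ideal_gen_sub _ _ [set f | theta f = 0]).
  split=> /=; first exact: rmorph0.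
    by move=> f g hf hg; rewrite [LHS]rmorphD /= hf hg addr0.
  by move=> f g hg; rewrite [LHS]rmorphM /= hg mulr0.
move=> f [[i ->]|[g pg ->]] /=; last by rewrite thetaC pg rmorph0.
by rewrite rmorphB thetaC pi_var theta_toric subrr.
Qed.

Let U (m : 'X_{1..N}) : A := (series_monomial k m)%:MP.

Let UD m n : U (m + n)%MM = U m * U n.
Proof. by rewrite /U /series_monomial mpolyXD !rmorphM. Qed.

Let toric_U m : II (U m - \prod_j 'X_j ^+ (\sum_i m i * `|a j i|)%N).
Proof.
have e : \prod_j 'X_j ^+ (\sum_i m i * `|a j i|)%N = \prod_i toric_monomial k a i ^+ m i.
  rewrite /toric_monomial; under [RHS]eq_bigr => i _ do rewrite -prodrXl.
  rewrite exchange_big; apply: eq_bigr => j _ /=.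
  rewrite -prodrXr; apply: eq_bigr => i _.
  by rewrite -exprM mulnC.
rewrite e /U series_monomial_prod rmorph_prod.
elim: (index_enum _) => [|i r IH]; first by rewrite !big_nil subrr; apply: is_ideal0.
rewrite !big_cons; apply: is_idealB_mul => //; rewrite rmorphXn.
elim: (m i) => [|d IHd]; first by rewrite !expr0 subrr; apply: is_ideal0.
rewrite !exprS; apply: is_idealB_mul => //.
by apply: generator_ideal_gen; left; exists i.
Qed.

Let u : S := \prod_i psX k i.

Let u_pow M (n : 'X_{1..N}) : (forall i, n i <= M)%N ->
  exists m, (u%:MP) ^+ M = U m * U n :> A.
Proof.
move=> le; exists [multinom (M - n i)%N | i < N]; rewrite -UD /U -rmorphXn.
congr (_%:MP); rewrite series_monomial_prod /u -prodrXl; apply: eq_bigr => i _.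
by rewrite mnmDE mnmE subnK.
Qed.

(** Each y_j is a quotient of monomials in the u_i, so multiplication by a power of u_1 ... u_N
    makes every function congruent to a power series. *)
Let clear_denominators f : exists M g, II (u%:MP ^+ M * f - g%:MP).
Proof.
move: f; apply: mpoly_alg_ind => [c|j|f g|f g].
- by exists 0%N, c; rewrite mul1r subrr; apply: is_ideal0.
- have [m [n e]] := multinom_col_parts (col j b).
  pose M := (\sum_i n i)%N.
  have [|m' em'] := @u_pow M n; first by move=> i; rewrite /M (bigD1 i) //= leq_addr.
  exists M, (series_monomial k (m' + m)%MM).
  rewrite em' -/(U _) UD -mulrA -mulrBr; apply: is_idealMl => //.
  have enm : \prod_l 'X_l ^+ (\sum_i m i * `|a l i|)%N =
     'X_j * \prod_l 'X_l ^+ (\sum_i n i * `|a l i|)%N :> A.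
    have sumE (q : 'X_{1..N}) l : (\sum_i q i * `|a l i|)%N%:Z = (a *m multinom_col q) l 0.
      rewrite mxE (big_morph Posz PoszD (erefl _)); apply: eq_bigr => i _.
      by rewrite PoszM mxE mulrC gez0_abs ?(fan_chart_ge0 _ _ ca).
    have expo l : (\sum_i m i * `|a l i|)%N = ((l == j) + (\sum_i n i * `|a l i|))%N.
      apply/eqP; rewrite -eqz_nat PoszD !sumE; apply/eqP.
      have -> : multinom_col m = col j b + multinom_col n by rewrite e subrK.
      by rewrite mulmxDr mulmx_col_inv mxE [delta_mx _ _ _ _]mxE eqxx andbT natz.
    under eq_bigr => l _ do rewrite expo exprD.
    rewrite big_split /=; congr (_ * _).
    rewrite (bigD1 j) //= eqxx expr1 big1 ?mulr1 // => l /negbTE ->.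
    exact: expr0.
  have -> : U n * 'X_j - U m = 'X_j * (U n - \prod_l 'X_l ^+ (\sum_i n i * `|a l i|)%N) -
     (U m - \prod_l 'X_l ^+ (\sum_i m i * `|a l i|)%N) by rewrite enm; ring.
  by apply: is_idealB => //; apply: is_idealMl.
- move=> [M [f' hf]] [M' [g' hg]]; exists (M + M')%N, (u ^+ M' * f' + u ^+ M * g').
  have -> : u%:MP ^+ (M + M') * (f + g) - (u ^+ M' * f' + u ^+ M * g')%:MP =
    u%:MP ^+ M' * (u%:MP ^+ M * f - f'%:MP) + u%:MP ^+ M * (u%:MP ^+ M' * g - g'%:MP).
    by rewrite rmorphD !rmorphM !rmorphXn exprD; ring.
  by apply: is_idealD => //; apply: is_idealMl.
- move=> [M [f' hf]] [M' [g' hg]]; exists (M + M')%N, (f' * g').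
  have -> : u%:MP ^+ (M + M') * (f * g) = (u%:MP ^+ M * f) * (u%:MP ^+ M' * g).
    by rewrite exprD; ring.
  by rewrite rmorphM; apply: is_idealB_mul.
Qed.

(** After clearing denominators, f is represented by a power series g; if theta f = 0 then pi g = 0,
    so g belongs to the inverse image of X. Conversely, theta maps u to a nonzero element. *)
Lemma strict_transform_ker f : strict_transform pi a f <-> theta f = 0.
Proof.
have uE : theta u%:MP != 0.
  rewrite thetaC tofrac_eq0 rmorph_prod; apply/prodf_neq0 => i _.
  by rewrite pi_var.
split=> [[n /theta_inverse_image /eqP]|e].
  by rewrite rmorphM rmorphXn mulf_eq0 expf_eq0 (negbTE uE) andbF /= => /eqP.
have [M [g hg]] := clear_denominators f; exists M.
have /eqP := theta_inverse_image hg.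
rewrite rmorphB rmorphM e mulr0 sub0r oppr_eq0 thetaC tofrac_eq0 => /eqP pg.
rewrite -(subrK g%:MP (_ * f)); apply: is_idealD => //.
by apply: generator_ideal_gen; right; exists g.
Qed.

Lemma theta_ge0 f : vge nu 0 (theta f).
Proof.
move: f; apply: mpoly_alg_ind => [c|j|f g hf hg|f g hf hg].
- by rewrite thetaC; apply: dom_ge0.
- by rewrite thetaX; right; rewrite chart_var_value; case: st.
- by rewrite rmorphD; apply: vgeD.
- by rewrite rmorphM -[0]addr0; apply: vgeM.
Qed.

Definition center_set : set A := [set f | vgt nu 0 (theta f)].

Lemma center_prime : is_prime_ideal center_set.
Proof.
split.
- split; rewrite /center_set /=; first by rewrite rmorph0; left.
    by move=> f g; rewrite rmorphD; apply: vgtD.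
  by move=> f g hg; rewrite rmorphM -[0]addr0; apply: vgtM => //; apply: theta_ge0.
- by rewrite /center_set /= rmorph1; case=> [/eqP|]; rewrite ?oner_eq0 // valuation1 ltxx.
- move=> f g; rewrite /center_set /= rmorphM => fg; apply: contrapT => /not_orP[nf ng].
  have val0 h : ~ vgt nu 0 (theta h) -> theta h != 0 /\ nu (theta h) = 0.
    move=> nh; case: (theta_ge0 h) => [e|ge]; first by case: nh; left.
    split; first by apply/eqP => e; apply: nh; left.
    by apply/eqP; rewrite eq_le ge andbT oag_leNgt; apply/negP => lt; apply: nh; right.
  have [f0 vf] := val0 f nf; have [g0 vg] := val0 g ng.
  case: fg => [/eqP|]; first by rewrite mulf_eq0 (negbTE f0) (negbTE g0).
  by rewrite Defs.valM // vf vg addr0 ltxx.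
Qed.

Lemma strict_transform_center : strict_transform pi a `<=` center_set.
Proof. by move=> f /strict_transform_ker e; rewrite /center_set /= e; left. Qed.

Definition center : subscheme_point (strict_transform pi a) :=
  Point center_prime strict_transform_center.

Lemma center_is_center : is_center_of_valuation nu center.
Proof.
exists theta; split=> //; last exact: theta_ge0.
by split; [exact: thetaC|move=> f /strict_transform_ker].
Qed.

(** * The maximal ideal at the center *)

Section Regularity.
Hypothesis independent : forall c : 'cV[int]_N,
  (forall l, ~~ (0 < tau l) -> c l 0 = 0) -> \sum_l tau l *~ c l 0 = 0 -> c = 0.
Hypothesis expansion : forall j, ~~ (0 < tau j) -> exists c (s : seq (S * 'cV[int]_N)),
  (forall x, x \in s -> 0 < value v x.2 /\ nonneg_on_active a tau x.2) /\
  Y j - (iota c)%:F = \sum_(x <- s) (pi x.1)%:F * X x.2.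

Local Notation p := center.
Local Notation B := (local_ring p).
Let p_center f : p f <-> vgt nu 0 (theta f). Proof. by []. Qed.
Let Theta : {rmorphism B -> K} := local_embedding strict_transform_ker p_center.
Let Theta_germ f : Theta (germ p f) = theta f.
Proof. exact: (local_to_field_germ strict_transform_ker p_center). Qed.
Let Theta_inj : injective Theta.
Proof. exact: (local_to_field_inj strict_transform_ker p_center). Qed.
Let Theta_ge0 z : vge nu 0 (Theta z).
Proof. exact: (local_to_field_ge0 strict_transform_ker theta_ge0 p_center). Qed.
Let Theta_gt0 z : nonunits B z <-> vgt nu 0 (Theta z).
Proof. exact: (local_to_field_gt0 strict_transform_ker theta_ge0 p_center). Qed.

Lemma center_var j : p 'X_j <-> 0 < tau j.
Proof.
rewrite /= /center_set /= -/(theta 'X_j) thetaX -chart_var_value; split; last by right.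
by case=> // /eqP; rewrite (negbTE (chart_var_neq0 j)).
Qed.

Let act := [seq j <- enum 'I_N | `[< p 'X_j >]].
Let gens : seq B := [seq germ p 'X_j | j <- act].

Let mem_act j : (j \in act) = (0 < tau j).
Proof.
rewrite mem_filter mem_enum andbT; apply/asboolP/idP; by move/center_var.
Qed.

Let M : set B := ideal_gen [set` gens].
Let hM : is_ideal M. Proof. exact: ideal_gen_ideal. Qed.

Let active_M j : 0 < tau j -> M (germ p 'X_j).
Proof. by move=> tj; apply: generator_ideal_gen; apply: map_f; rewrite mem_act. Qed.

Let M_nonunits : M `<=` nonunits B.
Proof.
apply: ideal_gen_sub => [|_ /= /mapP[j jact ->]]; last first.
  apply/Theta_gt0; rewrite Theta_germ thetaX; right; rewrite chart_var_value.
  by rewrite -mem_act.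
split.
- by apply/Theta_gt0; rewrite rmorph0; left.
- by move=> x y /Theta_gt0 hx /Theta_gt0 hy; apply/Theta_gt0; rewrite rmorphD; apply: vgtD.
- move=> x y /Theta_gt0 hy; apply/Theta_gt0; rewrite rmorphM -[0]addr0.
  exact: vgtM.
Qed.

(* A Laurent monomial whose exponents are nonnegative on the coordinates of   *)
(* positive value is regular at the center, where the others are units.       *)
Let laurent_germ e : nonneg_on_active a tau e ->
  exists z, Theta z = X e /\ (0 < value v e -> M z).
Proof.
move=> he; have /choice[z hz] : forall l, exists z : B, Theta z = Y l ^ (a *m e) l 0 /\
    (0 < tau l -> 0 < (a *m e) l 0 -> M z).
  move=> l; have [ge|lt] := leP 0 ((a *m e) l 0).
    exists (germ p 'X_l ^+ `|(a *m e) l 0|); split.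
      by rewrite rmorphXn Theta_germ thetaX -[in RHS](gez0_abs ge).
    move=> tl dl; have : (0 < `|(a *m e)%R l 0%R|)%N by rewrite absz_gt0 gt_eqF.
    case: `|_|%N => // n _; rewrite exprS; apply: is_idealMr => //; exact: active_M.
  have nl : ~~ (0 < tau l) by apply/negP => /he; rewrite leNgt lt.
  have [z ez] : exists z, germ p 'X_l * z = 1.
    apply: contrapT => h; have /Theta_gt0 : nonunits B (germ p 'X_l) by [].
    rewrite Theta_germ => /center_var; exact/negP.
  exists (z ^+ `|(a *m e) l 0|); split; last by move=> tl; rewrite tl in nl.
  have eY : Theta z = (Y l)^-1.
    apply: (mulfI (chart_var_neq0 l)); rewrite divff ?chart_var_neq0 //.
    by rewrite -thetaX -Theta_germ -rmorphM ez rmorph1.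
  have ed : (a *m e) l 0 = - (`|(a *m e)%R l 0%R|%N)%:Z by lia.
  by rewrite rmorphXn eY exprVn exprnN -ed.
exists (\prod_l z l); split.
  by rewrite rmorph_prod laurent_chart; apply: eq_bigr => l _; case: (hz l).
rewrite (valueE _ st) => gt0.
have [l [tl dl]] : exists l, 0 < tau l /\ 0 < (a *m e) l 0.
  apply: contrapT => none; move: gt0; rewrite big1 ?ltxx // => l _.
  have [tl|nl] := boolP (0 < tau l).
    have := he l tl; rewrite le_eqVlt => /orP[/eqP <-|dl]; first by rewrite mulr0z.
    by case: none; exists l.
  have -> : tau l = 0; last by rewrite mul0rz.
  by apply/eqP; case: st => _ t0 _; rewrite eq_le t0 andbT oag_leNgt.
rewrite (bigD1 l) //=; apply: is_idealMr => //.
by case: (hz l) => _; apply.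
Qed.

(** Every Laurent monomial in the expansion of y_j minus its residue has positive value and
    nonnegative active exponents, hence is a multiple of an active coordinate. *)
Let inactive_M j : ~~ (0 < tau j) -> exists c, M (germ p 'X_j - germ p (psC c)%:MP).
Proof.
move=> nj; have [c [s [hs es]]] := expansion nj; exists c.
have /choice[z hz] : forall x : S * 'cV[int]_N, exists z, x \in s -> Theta z = X x.2 /\ M z.
  move=> x; have [xs|] := boolP (x \in s); last by exists 0.
  have [gt0 /laurent_germ[z [ez Mz]]] := hs x xs; exists z => _; split=> //.
  exact: Mz.
have -> : germ p 'X_j - germ p (psC c)%:MP = \sum_(x <- s) germ p x.1%:MP * z x.
  apply: Theta_inj; rewrite rmorphB !Theta_germ thetaX thetaC pi_const es rmorph_sum.
  rewrite big_seq [RHS]big_seq; apply: eq_bigr => x xs.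
  by rewrite rmorphM Theta_germ thetaC; have [-> _] := hz x xs.
rewrite big_seq; apply: ideal_sum => // x xs; apply: is_idealMl => //.
by case: (hz x xs).
Qed.

Let series_var_M i : M (germ p (psX k i)%:MP).
Proof.
have -> : germ p (psX k i)%:MP = germ p (toric_monomial k a i).
  by apply: Theta_inj; rewrite !Theta_germ thetaC pi_var theta_toric.
have [j [tj aj]] : exists j, 0 < tau j /\ a j i != 0.
  apply: contrapT => none; have := xi_gt0 i; case: st => _ t0 -> ; rewrite big1 ?ltxx // => j _.
  have [->|aj] := eqVneq (a j i) 0; first by rewrite mulr0z.
  have -> : tau j = 0; last by rewrite mul0rz.
  by apply/eqP; rewrite eq_le t0 andbT oag_leNgt; apply/negP => tj; apply: none; exists j.
rewrite /toric_monomial (bigD1 j) //= rmorphM; apply: is_idealMr => //.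
have : (0 < `|a j i|)%N by rewrite absz_gt0.
case: `|a j i|%N => // n _; rewrite exprS rmorphM; apply: is_idealMr => //.
exact: active_M.
Qed.

Let series_M (g : S) : M (germ p g%:MP - germ p (psC (g 0%MM))%:MP).
Proof.
rewrite -!rmorphB; set f := g - _.
have : ideal_gen [set x | exists2 e, e <> 0%MM & x = series_monomial k e] f.
  apply: series_support_ideal => m nz e; move/eqP: nz; apply.
  by rewrite e /f -[LHS]/(g 0%MM - psC (g 0%MM) 0%MM) /psC eqxx subrr.
apply: (@ideal_gen_sub _ _ [set f | M (germ p f%:MP)]).
  split=> /=; first by rewrite !rmorph0; apply: is_ideal0.
    by move=> x y hx hy; rewrite !rmorphD; apply: is_idealD.
  by move=> x y hy; rewrite !rmorphM; apply: is_idealMl.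
move=> _ [e e0 ->] /=.
have [i ei] : exists i, (0 < e i)%N.
  apply: contrapT => none; apply: e0; apply/mnmP => i; rewrite mnm0E; apply/eqP.
  by rewrite -leqn0 leqNgt; apply/negP => lt; apply: none; exists i.
rewrite series_monomial_prod !rmorph_prod (bigD1 i) //=; apply: is_idealMr => //.
rewrite -(prednK ei) exprS !rmorphM; apply: is_idealMr => //; exact: series_var_M.
Qed.

Let psCD (c d : k) : psC (c + d) = psC c + psC d :> S.
Proof.
by apply/funext => m; rewrite -[RHS]/(psC c m + psC d m) /psC; case: eqP; rewrite ?addr0.
Qed.
Let psCM (c d : k) : psC (c * d) = psC c * psC d :> S.
Proof. by apply/funext => m; rewrite psC_mul /psC; case: eqP; rewrite ?mulr0. Qed.

(** Constants exhaust the residues modulo [M]: the u_i and active y_j lie in M, and the other y_j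
    are congruent to constants. *)
Let residue_M f : exists c, M (germ p f - germ p (psC c)%:MP).
Proof.
move: f; apply: mpoly_alg_ind => [g|j|f g [c hf] [d hg]|f g [c hf] [d hg]].
- by exists (g 0%MM); apply: series_M.
- have [tj|nj] := boolP (0 < tau j); last exact: inactive_M.
  exists 0; have -> : psC 0 = 0 :> S.
    by apply/funext => m; rewrite /psC; case: eqP.
  by rewrite !rmorph0 subr0; apply: active_M.
- exists (c + d); rewrite psCD !rmorphD opprD addrACA.
  exact: is_idealD.
- exists (c * d); rewrite psCM !rmorphM; exact: is_idealB_mul.
Qed.

(** The numerator of a nonunit is congruent modulo M to a constant of positive value, which must be
    0. *)
Lemma center_maximal_ideal : nonunits B = ideal_gen [set` gens].
Proof.
apply/seteqP; split; last exact: M_nonunits.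
move=> z; elim/frac_ind: z => f d nd /Theta_gt0 nz.
have hf : vgt nu 0 (theta f).
  rewrite -Theta_germ -(frac_germ f nd) rmorphM mulrC -[0]addr0.
  exact: vgtM.
have [c hc] := residue_M f.
have c0 : c = 0.
  apply: contrapT => /eqP c0; have /M_nonunits /Theta_gt0 := hc.
  rewrite rmorphB !Theta_germ thetaC pi_const => h.
  have : vgt nu 0 (iota c)%:F.
    have -> : (iota c)%:F = theta f - (theta f - (iota c)%:F) by ring.
    by apply: vgtD => //; apply: vgtN.
  case=> [/eqP|]; first by rewrite tofrac_eq0 fmorph_eq0 (negbTE c0).
  by rewrite iota_value // ltxx.
have psC0 : psC 0 = 0 :> S by apply/funext => m; rewrite /psC; case: eqP.
move: hc; rewrite c0 psC0 !rmorph0 subr0 => hc.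
have -> : Defs.frac f nd = Defs.frac 1 nd * germ p f.
  have -> : Defs.frac 1 nd * germ p f = loc_mul (Defs.frac 1 nd) (germ p f) by [].
  by rewrite loc_mulE; apply: frac_eqW; rewrite mul1r !mulr1.
exact: is_idealMl.
Qed.

Lemma center_noetherian : is_noetherian B.
Proof.
have surj := pi_surj k_representatives nu_rational xi_neq0 xi_generate pi_const pi_var.
apply: (@local_ring_noetherian _ _ _ nu theta _ p strict_transform_ker p_center
  {mpoly R[N]} (map_mpoly pi)).
- exact: noetherian_mpoly.
- apply: mpoly_alg_ind => [c|j|f g [f' <-] [g' <-]|f g [f' <-] [g' <-]].
  + by have [g <-] := surj c; exists g%:MP; rewrite /= map_mpolyC.
  + by exists 'X_j; rewrite /= map_mpolyX.
  + by exists (f' + g'); rewrite rmorphD.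
  + by exists (f' * g'); rewrite rmorphM.
- move=> f f0; apply/strict_transform_ker.
  have -> : theta f = mmap (@tofrac R) Y (map_mpoly pi f).
    move: f {f0}; apply: mpoly_alg_ind => [c|j|f g ef eg|f g ef eg].
    + by rewrite thetaC map_mpolyC mmapC.
    + by rewrite thetaX map_mpolyX mmapX mmap1U.
    + by rewrite !rmorphD ef eg.
    + by rewrite !rmorphM ef eg.
  by rewrite f0 mmap0.
Qed.

Theorem center_regular : is_regular_local_ring B /\ transversal_to_boundary p.
Proof.
have us : uniq act by rewrite filter_uniq // enum_uniq.
have /choice[idx hidx] : forall i : 'I_(size gens), exists j : 'I_N,
    [/\ 0 < tau j, Theta gens`_i = Y j & index j act = i].
  move=> i; have lt : (i < size act)%N by rewrite -(size_map (fun j => germ p 'X_j)).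
  have [j0 _] : exists j0, j0 \in act.
    by case: act lt => // j0 r _; exists j0; rewrite mem_head.
  exists (nth j0 act i); split; last exact: index_uniq.
    by rewrite -mem_act mem_nth.
  by rewrite (nth_map j0) // Theta_germ thetaX.
have idx_inj : injective idx.
  move=> i i' e; apply: val_inj; case: (hidx i) => _ _ /= ei; case: (hidx i') => _ _ /= ei'.
  by move: ei'; rewrite -e ei.
have gens0 (i : 'I_(size gens)) : Theta gens`_i != 0.
  by case: (hidx i) => _ -> _; apply: chart_var_neq0.
have wt_inj : injective (weight (fun i : 'I_(size gens) => nu (Theta gens`_i))).
  (* The difference of two exponents of equal weight, extended by zero to all coordinates, is a
     relation between the active values. *)
  move=> q q' e; pose c : 'cV[int]_N := \col_j \sum_(i | idx i == j) ((q i)%:Z - (q' i)%:Z).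
  have c0 : c = 0.
    apply: independent => [l nl|].
      rewrite mxE big1 // => i /eqP ei; move: nl; rewrite -ei.
      by case: (hidx i) => ->.
    transitivity (\sum_i tau (idx i) *~ ((q i)%:Z - (q' i)%:Z)).
      rewrite [RHS](partition_big idx predT) //=; apply: eq_bigr => l _.
      by rewrite mxE mulrz_sumr; apply: eq_bigr => i /eqP ->.
    under eq_bigr do rewrite mulrzBr -!pmulrn.
    rewrite sumrB; apply/eqP; rewrite subr_eq0; apply/eqP.
    have wE (x : 'X_{1..size gens}) : weight (fun i : 'I_(size gens) => nu (Theta gens`_i)) x =
        \sum_i tau (idx i) *+ x i.
      by apply: eq_bigr => i _; case: (hidx i) => _ -> _; rewrite chart_var_value.
    by rewrite -!wE.
  apply/mnmP => i; have := congr1 (fun c : 'cV[int]_N => c (idx i) 0) c0.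
  rewrite !mxE (big_pred1 i) => [/eqP|i']; last by rewrite /= (inj_eq idx_inj).
  by rewrite subr_eq0 => /eqP [].
have noethB := center_noetherian.
have reg := values_regular noethB Theta_ge0 Theta_gt0 gens0 center_maximal_ideal wt_inj.
split; last by exists [::]; rewrite cats0.
by have := values_regular_local_ring noethB Theta_ge0 Theta_gt0 gens0 center_maximal_ideal wt_inj.
Qed.

End Regularity.
End Theta.

(** With X^e = xi^m / xi^n and residue c, the element xi^m - c xi^n has value greater than [wt n];
    its series expansion uses finitely many monomials heavier than xi^n, and one divides by xi^n. *)
Lemma laurent_expansion (e : 'cV[int]_N) : value v e = 0 ->
  exists c (s : seq (S * 'cV[int]_N)), (forall x, x \in s -> 0 < value v x.2) /\
    X e - (iota c)%:F = \sum_(x <- s) (pi x.1)%:F * X x.2.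
Proof.
move=> v0; have [m [n en]] := multinom_col_parts e.
have valueB d1 d2 : value v (d1 - d2) = value v d1 - value v d2.
  by rewrite /value -sumrB; apply: eq_bigr => i _; rewrite !mxE mulrzBr.
have Xge : vge nu 0 (X e) by right; rewrite laurent_value ?v0.
have [c hc] := residue k_representatives nu_rational Xge.
have Xe : X e = (xi_mono xi m)%:F / (xi_mono xi n)%:F.
  by rewrite en laurentD // laurentN // !laurent_multinom.
have n0 := xi_mono_neq0 xi_neq0 n.
have ex : (xi_mono xi n)%:F * (X e - (iota c)%:F) = (xi_mono xi m - iota c * xi_mono xi n)%:F.
  by rewrite Xe mulrBr mulrCA divff // mulr1 rmorphB rmorphM (mulrC (iota c)%:F).
have hx : vgt nu (wt n) (xi_mono xi m - iota c * xi_mono xi n)%:F.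
  by rewrite -ex -[wt n]addr0; apply: vgtM => //; right; rewrite nu_xi_mono.
have [g [eg hg]] := series_expansion_gt k_representatives nu_rational xi_neq0 xi_generate
  pi_const pi_var hx.
have [l [h [t [ht et]]]] := series_support_ideal (D := [set q | wt n < wt q]) hg.
have /choice[q hq] : forall i, exists q, wt n < wt q /\ t i = series_monomial k q.
  by move=> i; have [q lt ->] := ht i; exists q.
exists c, [seq (h i, multinom_col (q i) - multinom_col n) | i <- enum 'I_l]; split.
  move=> _ /mapP[i _ ->] /=; rewrite valueB !value_multinom.
  by have [lt _] := hq i; rewrite oag_ltNge -(oag_leD2rE (wt n)) subrK add0r -oag_ltNge.
rewrite big_map big_enum /=.
apply: (mulfI n0); rewrite ex -eg et !rmorph_sum mulr_sumr; apply: eq_bigr => i _.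
rewrite laurentD // laurentN // !laurent_multinom [in LHS]rmorphM rmorphM.
have [_ ->] := hq i; rewrite (pi_monomial pi_var) /= mulrCA; congr (_ * _).
by rewrite mulrCA divff // mulr1.
Qed.

Theorem regular_chart : exists a : 'M[int]_N, fan_chart RR a /\
  exists p : subscheme_point (strict_transform pi a),
    [/\ is_center_of_valuation nu p, is_regular_local_ring (local_ring p)
      & transversal_to_boundary p].
Proof.
have v_ge0 i : 0 <= v i := ltW (xi_gt0 i).
have [a0 [t0 [st0 min0]]] := @minimal_toric_state RR Phi N v v_ge0.
have [[_ /= uat] _ _] := st0; have [ua0 _] := st0.
pose d_ j : 'cV[int]_N := col j (invmx a0).
have ad j : a0 *m d_ j = delta_mx j 0 by exact: mulmx_col_inv st0 j.
have vd j : value v (d_ j) = t0 j.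
  by rewrite -laurent_value //; exact: chart_var_value st0 j.
have /choice[E hE] : forall j, exists E : k * seq (S * 'cV[int]_N), ~~ (0 < t0 j) ->
    (forall x, x \in E.2 -> 0 < value v x.2) /\
    X (d_ j) - (iota E.1)%:F = \sum_(x <- E.2) (pi x.1)%:F * X x.2.
  move=> j; have [tj|nj] := boolP (0 < t0 j); first by exists (0, [::]).
  have [|c [s hs]] := @laurent_expansion (d_ j); last by exists (c, s).
  by rewrite vd; apply/eqP; case: st0 => _ ge0 _; rewrite eq_le ge0 andbT oag_leNgt.
(* All exponents occurring in the expansions of the inactive coordinates. *)
pose L := flatten [seq [seq x.2 | x <- (E j).2] | j <- enum 'I_N & ~~ (0 < t0 j)].
have [|a [tau [bl hL]]] := blowup_refine (E := [seq d_ j | j <- enum 'I_N] ++ L) st0.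
  move=> e; rewrite mem_cat => /orP[/mapP[j _ ->]|/flatten_mapP[j]].
    by rewrite vd; case: st0.
  rewrite mem_filter => /andP[nj _] /mapP[x xE ->]; apply: ltW.
  by have [h _] := hE j nj; apply: h.
have [st min] := minimal_blowup st0 min0 bl.
have actE l : (0 < tau l) = (0 < t0 l) := minimal_blowup_active st0 min0 l bl.
have [ca _ _] := st; exists a; split=> //; exists (center st).
have [|reg trans] := @center_regular a tau st (minimal_independent st min).
  move=> j; rewrite actE => nj; have [hs es] := hE j nj.
  exists (E j).1, (E j).2; split=> [x xE|].
    split; first exact: hs.
    apply: hL; rewrite mem_cat; apply/orP; right; apply/flatten_mapP; exists j.
      by rewrite mem_filter nj mem_enum.
    exact: map_f.
  (* The expansions were computed before refining, but inactive coordinates do not change: the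
     exponents of the old y_j in the new chart vanish on active coordinates, its value being 0, and
     are unaltered on inactive ones. *)
  have -> : chart_var a j = X (d_ j); last exact: es.
  congr laurent; have [ua _] := ca.
  apply: (can_inj (mulKmx ua)); rewrite (mulmx_col_inv st).
  have hd : nonneg_on_active a tau (d_ j).
    by apply: hL; rewrite mem_cat map_f // mem_enum.
  apply/colP => l; rewrite mxE eqxx andbT.
  have [tl|nl] := boolP (0 < t0 l).
    have -> : l == j = false by apply: contraNF nj => /eqP <-.
    apply/esym/(value0_active st hd); last by rewrite actE.
    rewrite vd; apply/eqP; case: st0 => _ ge0 _; rewrite eq_le ge0 andbT oag_leNgt //.
  by rewrite (blowup_inactive (d_ j) bl nl) ad mxE eqxx andbT.
by split=> //; apply: center_is_center.
Qed.

End Chart.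

Theorem theorem5p3 (RR : realType)
    (k : fieldType) (k_closed : GRing.closed_field_axiom k)
    (R : idomainType) (R_local : is_local R) (R_noetherian : is_noetherian R)
    (R_complete : is_adically_complete (nonunits R))
    (iota : {rmorphism k -> R})
    (k_representatives : is_field_of_representatives iota)
    (Phi : oagType) (nu : dominating_valuation R Phi)
    (nu_rational : is_rational nu)
    (gr_finitely_generated : exists n (g : 'I_n -> graded_ring nu),
       generates_algebra (gr_algebra_map nu iota) g)
    (N : nat) (xi : 'I_N -> R)
    (xi_maximal : forall i, nonunits R (xi i))
    (xi_neq0 : forall i, xi i != 0)
    (xi_generate : generates_algebra (gr_algebra_map nu iota)
       (fun i => initial_form nu (xi i)))
    (pi : {rmorphism {powerseries k[N]} -> R})
    (pi_const : forall c : k, pi (psC c) = iota c)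
    (pi_var : forall i, pi (psX k i) = xi i)
    (pi_continuous : is_continuous pi) :
  exists Sigma : seq (seq 'rV[int]_N),
    [/\ is_regular_fan RR Sigma,
        fan_support Sigma = @orthant RR N
      & exists a : 'M[int]_N, rows_of a \in Sigma /\
          exists p : subscheme_point (strict_transform pi a),
            [/\ is_center_of_valuation nu p,
                is_regular_local_ring (local_ring p)
              & transversal_to_boundary p]].
Proof.
have [a [[_ [Sigma gS aS]] hp]] := regular_chart RR R_noetherian k_representatives
  nu_rational xi_maximal xi_neq0 xi_generate pi_const pi_var.
exists Sigma; split; [exact: good_regular_fan|exact: good_support|by exists a].
Qed.
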